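(* Let $n\ge 2$, $s\in(0,1)\setminus\{\tfrac12\}$ and let $f\in\mathcal{S}(\mathbb{R}^n;S^2(\mathbb{R}^n))$ be a symmetric $2$-tensor field. Then for all $1\le i_1,i_2\le n$, $$f_{i_1i_2}(x)=\frac12(-\Delta)^s\Big[\delta_{i_1i_2}\mathcal{A}^0_{2,s}f(x)-2s\,\mathbf{R}_{i_1}\mathbf{R}_{i_2}\mathcal{A}^0_{2,s}f(x)-\mathcal{A}^{2,i_1,i_2}_{2,s}f(x)-2s\big(\mathbf{R}_{i_1}\mathcal{A}^{1,i_2}_{2,s}f(x)+\mathbf{R}_{i_2}\mathcal{A}^{1,i_1}_{2,s}f(x)\big)\Big].$$
   Context: $\mathcal{S}(\mathbb{R}^n;S^2(\mathbb{R}^n))$ is the space of symmetric $2$-tensor fields $f=(f_{ij})$ on $\mathbb{R}^n$ with complex-valued Schwartz components. Repeated indices are summed from $1$ to $n$. The fractional divergent beam ray transform of $f$ is $(\chi_{s,2}f)(x,\xi)=\int_0^\infty t^{2s-1}f_{j_1j_2}(x+t\xi)\xi^{j_1}\xi^{j_2}\,dt$ for $x\in\mathbb{R}^n$, $\xi\in\mathbb{S}^{n-1}$. Its averages are $$\mathcal{A}^0_{2,s}f(x)=c^{2,0}_{n,s}\int_{\mathbb{S}^{n-1}}(\chi_{s,2}f)(x,\xi)\,dS_\xi,\quad \mathcal{A}^{1,i}_{2,s}f(x)=c^{2,1}_{n,s}\int_{\mathbb{S}^{n-1}}\xi^i(\chi_{s,2}f)(x,\xi)\,dS_\xi,$$ $$\mathcal{A}^{2,i_1,i_2}_{2,s}f(x)=c^{2,2}_{n,s}\int_{\mathbb{S}^{n-1}}\xi^{i_1}\xi^{i_2}(\chi_{s,2}f)(x,\xi)\,dS_\xi,$$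 with $$c^{2,0}_{n,s}=\frac{-\Gamma\left(\frac{n+2-2s}{2}\right)}{2^{2s-1}\pi^{n/2}\Gamma(s)},\quad c^{2,1}_{n,s}=\frac{-\Gamma\left(\frac{n+3-2s}{2}\right)}{2^{2s-1}\pi^{n/2}\Gamma\left(s+\frac12\right)},\quad c^{2,2}_{n,s}=\frac{-\Gamma\left(\frac{n+4-2s}{2}\right)}{2^{2s-2}\pi^{n/2}\Gamma(s)}.$$ The Fourier transform is $\mathscr{F}u(y)=\int_{\mathbb{R}^n}e^{-\mathrm{i}\langle x,y\rangle}u(x)\,dx$, extended to tempered distributions. The Riesz transform $\mathbf{R}_i$ is the Fourier multiplier $\mathscr{F}(\mathbf{R}_iu)(y)=-\mathrm{i}\frac{y_i}{|y|}\mathscr{F}u(y)$, and $(-\Delta)^su=\mathscr{F}^{-1}(|y|^{2s}\mathscr{F}u)$ for tempered distributions $u$ whenever the right-hand side is well defined. $\delta_{ij}$ is the Kronecker delta. *)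

(* Defs.v *)
From HB Require Import structures.
From mathcomp Require Import all_boot all_order all_algebra.
From mathcomp Require Import complex.
From mathcomp Require Import all_classical all_reals all_analysis.
From mathcomp Require Import measurable_realfun.
Import Order.TTheory GRing.Theory Num.Theory.
Import numFieldNormedType.Exports.
Set Implicit Arguments.
Unset Strict Implicit.
Unset Printing Implicit Defensive.
Local Open Scope classical_set_scope.
Local Open Scope ring_scope.
Local Open Scope complex_scope.

Definition rV_display : measure_display.
Proof. exact: default_measure_display. Qed.

(* The product sigma-algebra on row vectors, as the library puts on n.-tuple. *)
Section measurable_rV.
Context {R : realType}.
Variable n : nat.

Let coord : 'I_n -> 'rV[R]_n -> measurableTypeR R := fun i x => x ord0 i.

Let rV_set0 : g_sigma_preimage coord set0.
Proof. exact: sigma_algebra0. Qed.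

Let rV_setC A : g_sigma_preimage coord A -> g_sigma_preimage coord (~` A).
Proof. exact: sigma_algebraC. Qed.

Let rV_bigcup (F : _^nat) : (forall i, g_sigma_preimage coord (F i)) ->
  g_sigma_preimage coord (\bigcup_i (F i)).
Proof. exact: sigma_algebra_bigcup. Qed.

HB.instance Definition _ := @isMeasurable.Build rV_display
  'rV[R]_n (g_sigma_preimage coord) rV_set0 rV_setC rV_bigcup.

End measurable_rV.

Lemma measurable_coord (R : realType) n (i : 'I_n) :
  measurable_fun [set: 'rV[R]_n] (fun x : 'rV[R]_n => x ord0 i : measurableTypeR R).
Proof.
move=> _ Y mY; rewrite setTI; apply: sub_sigma_algebra => /=.
rewrite -bigcup_seq/=; exists i => /=; first by rewrite mem_index_enum.
by exists Y => //; rewrite setTI.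
Qed.

Lemma measurable_rVP (R : realType) d (T : measurableType d) n (f : T -> 'rV[R]_n) :
  (forall i, measurable_fun [set: T] (fun t => f t ord0 i : measurableTypeR R)) ->
  measurable_fun [set: T] f.
Proof.
move=> tnthfS.
suff mf : g_sigma_preimage (fun i => (fun x : 'rV[R]_n => x ord0 i : measurableTypeR R) \o f)
    `<=` measurable.
  move=> _ A mA; apply: mf; rewrite g_sigma_preimage_comp.
  by exists A.
apply: smallest_sub; first exact: sigma_algebra_measurable.
case: n => [|n] in f tnthfS *; first by rewrite big_ord0.
rewrite -bigcup_mkord_ord; apply: bigcup_sub => i Ii.
by move=> A [B mB <-]; exact: tnthfS.
Qed.

Definition cons_rV (R : realType) n (p : measurableTypeR R * 'rV[R]_n) :
  'rV[R]_n.+1 := row_mx (p.1 : R)%:M p.2.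


Lemma measurable_cons_rV (R : realType) n :
  measurable_fun [set: _] (@cons_rV R n).
Proof.
apply: measurable_rVP => i.
case: (@split_ordP 1 n i) => j ->; rewrite /cons_rV.
  rewrite [X in measurable_fun _ X](_ : _ = fst); first exact: measurable_fst.
  by apply/funext => t /=; rewrite [LHS](@row_mxEl _ 1 1 n) (ord1 j) mxE eqxx mulr1n.
rewrite [X in measurable_fun _ X](_ : _ = (fun x : 'rV[R]_n => x ord0 j) \o snd).
  by apply: measurableT_comp; [exact: measurable_coord|exact: measurable_snd].
by apply/funext => t /=; rewrite [LHS](@row_mxEr _ 1 1 n).
Qed.



Section lebesgue_step.
Variables (R : realType) (n : nat).
Variable m : {sigma_finite_measure set 'rV[R]_n -> \bar R}.

Definition lebesgue_step :=
  pushforward (lebesgue_measure \x m)%E (@cons_rV R n).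

Let push : {measure set 'rV[R]_n.+1 -> \bar R}.
Proof.
refine (pushforward (lebesgue_measure \x m)%E (@cons_rV R n) : measure _ _).
exact: measurable_cons_rV.
Defined.

Let step0 : lebesgue_step set0 = 0%E.
Proof. exact: (measure0 push). Qed.

Let step_ge0 A : (0 <= lebesgue_step A)%E.
Proof. exact: (measure_ge0 push). Qed.

Let step_sigma_additive : semi_sigma_additive lebesgue_step.
Proof. exact: (@measure_semi_sigma_additive _ _ _ push). Qed.

HB.instance Definition _ := isMeasure.Build _ _ _ lebesgue_step
  step0 step_ge0 step_sigma_additive.

Let uncons (x : 'rV[R]_n.+1) : measurableTypeR R * 'rV[R]_n :=
  (x ord0 ord0, \row_j x ord0 (lift ord0 j)).

Let measurable_uncons : measurable_fun [set: _] uncons.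
Proof.
apply/measurable_fun_pair => /=; first exact: measurable_coord.
apply: measurable_rVP => i.
rewrite [X in measurable_fun _ X](_ : _ = fun x : 'rV[R]_n.+1 => x ord0 (lift ord0 i)).
  exact: measurable_coord.
by apply/funext => x; rewrite mxE.
Qed.

Let cons_rVK : cancel (@cons_rV R n) uncons.
Proof.
move=> [a v]; rewrite /uncons /cons_rV /=; congr pair.
  have -> : ord0 = @lshift 1 n ord0 by exact/val_inj.
  by rewrite [LHS](@row_mxEl _ 1 1 n) mxE eqxx mulr1n.
apply/rowP => j; rewrite mxE.
have -> : lift ord0 j = @rshift 1 n j by exact/val_inj.
by rewrite [LHS](@row_mxEr _ 1 1 n).
Qed.

Let step_sigma_finite : sigma_finite setT lebesgue_step.
Proof.
have /sigma_finiteP[F [TF ndF Foo]] := sigma_finiteT (@lebesgue_measure R).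
have /sigma_finiteP[G [TG ndG Goo]] := sigma_finiteT m.
exists (fun k => uncons @^-1` (F k `*` G k)).
  rewrite -preimage_bigcup (_ : \bigcup_k _ = setT) ?preimage_setT//.
  rewrite -setXTT TF TG predeqE => -[x y]; split.
    by move=> [k _ []/= ? ?]; split; exists k.
  move=> [/= [k _ Fkx] [l _ Gly]]; exists (maxn k l) => //; split.
  - by move: x Fkx; exact/subsetPset/ndF/leq_maxl.
  - by move: y Gly; exact/subsetPset/ndG/leq_maxr.
move=> k; have [mF Fk] := Foo k; have [mG Gk] := Goo k; split.
  by rewrite -[X in measurable X]setTI; apply: measurable_uncons => //; exact: measurableX.
rewrite /lebesgue_step /pushforward /= -comp_preimage.
rewrite (_ : _ \o _ = id); last by apply/funext => p /=; exact: cons_rVK.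
by rewrite preimage_id product_measure1E// lte_mul_pinfty// ge0_fin_numE.
Qed.

HB.instance Definition _ := Measure_isSigmaFinite.Build _ _ _ lebesgue_step
  step_sigma_finite.

End lebesgue_step.

Fixpoint lebesgue_rV (R : realType) (n : nat) :
    {sigma_finite_measure set 'rV[R]_n -> \bar R} :=
  match n with
  | 0 => \d_(0 : 'rV[R]_0)
  | k.+1 => lebesgue_step (lebesgue_rV R k)
  end.

Definition dotr (R : realType) n (x y : 'rV[R]_n) : R :=
  \sum_(i < n) x ord0 i * y ord0 i.

Definition enorm (R : realType) n (x : 'rV[R]_n) : R := Num.sqrt (dotr x x).

Lemma measurable_enorm (R : realType) n :
  measurable_fun [set: 'rV[R]_n] (fun x => enorm x : measurableTypeR R).
Proof.
apply: (@measurableT_comp _ _ _ _ _ _ (@Num.sqrt R)).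
  by apply: continuous_measurable_fun; exact: sqrt_continuous.
by apply: measurable_sum => i; apply: measurable_funM; exact: measurable_coord.
Qed.

Definition normalize (R : realType) n (x : 'rV[R]_n) : 'rV[R]_n :=
  (enorm x)^-1 *: x.

Lemma measurable_normalize (R : realType) n :
  measurable_fun [set: 'rV[R]_n] (@normalize R n).
Proof.
apply: measurable_rVP => i.
rewrite [X in measurable_fun _ X](_ : _ =
  fun x : 'rV[R]_n => enorm x `^ (-1) * x ord0 i).
  apply: measurable_funM; last exact: measurable_coord.
  by apply: (measurableT_comp (measurable_powR _)); exact: measurable_enorm.
by apply/funext => x; rewrite mxE powR_inv1// sqrtr_ge0.
Qed.

Lemma measurable_unit_ball (R : realType) n :
  measurable [set x : 'rV[R]_n | enorm x <= 1].
Proof.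
have := @measurable_enorm R n measurableT _ (measurable_itv `]-oo, 1%R]).
by rewrite setTI (_ : _ @^-1` _ = [set x | enorm x <= 1]).
Qed.

(* Surface measure of the unit sphere, via polar coordinates: the measure of
   a set A of directions is n times the volume of the cone over A in the unit
   ball.  It is concentrated on the vectors of Euclidean norm 1. *)
Section sphere_measure.
Variables (R : realType) (n : nat).

Definition sphere_measure (A : set 'rV[R]_n) : \bar R :=
  (n%:R%:E * lebesgue_rV R n
     [set x | (enorm x <= 1)%R /\ A (normalize x)])%E.

Let push : {measure set 'rV[R]_n -> \bar R}.
Proof.
refine (pushforward (mrestr (lebesgue_rV R n) (@measurable_unit_ball R n))
  (@normalize R n) : measure _ _).
exact: measurable_normalize.
Defined.

Let sphere_measureE : sphere_measure = mscale n%:R%:nng push.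
Proof.
apply/funext => A; rewrite /sphere_measure /mscale /=; congr (_ * _)%E.
by rewrite /pushforward /mrestr setIC.
Qed.

Let sphere0 : sphere_measure set0 = 0%E.
Proof. by rewrite sphere_measureE measure0. Qed.

Let sphere_ge0 A : (0 <= sphere_measure A)%E.
Proof. by rewrite sphere_measureE measure_ge0. Qed.

Let sphere_sigma_additive : semi_sigma_additive sphere_measure.
Proof. by rewrite sphere_measureE; exact: measure_semi_sigma_additive. Qed.

HB.instance Definition _ := isMeasure.Build _ _ _ sphere_measure
  sphere0 sphere_ge0 sphere_sigma_additive.

End sphere_measure.

Definition unit_sphere (R : realType) n : set 'rV[R]_n :=
  [set xi | enorm xi = 1].

Definition cintegral d (T : measurableType d) (R : realType)
    (mu : {measure set T -> \bar R}) (D : set T) (f : T -> R[i]) : R[i] :=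
  (\int[mu]_(x in D) complex.Re (f x)) +i*
  (\int[mu]_(x in D) complex.Im (f x)).

(* Only meaningful for a > 0; every argument used below is positive. *)
Definition Gamma (R : realType) (a : R) : R :=
  \int[lebesgue_measure]_(t in `]0, +oo[) (t `^ (a - 1) * expR (- t)).

Definition cpartial (R : realType) n (i : 'I_n) (u : 'rV[R]_n -> R[i]) :
    'rV[R]_n -> R[i] := fun x =>
  ('D_(delta_mx ord0 i) (@complex.Re R \o u) x) +i*
  ('D_(delta_mx ord0 i) (@complex.Im R \o u) x).

Definition cpartials (R : realType) n (l : seq 'I_n) (u : 'rV[R]_n -> R[i]) :
    'rV[R]_n -> R[i] := foldr (@cpartial R n) u l.

Definition csmooth (R : realType) n (u : 'rV[R]_n -> R[i]) : Prop :=
  forall l : seq 'I_n,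
    [/\ continuous (@complex.Re R \o cpartials l u),
        continuous (@complex.Im R \o cpartials l u) &
        forall (i : 'I_n) (x : 'rV[R]_n),
          derivable (@complex.Re R \o cpartials l u) x (delta_mx ord0 i) /\
          derivable (@complex.Im R \o cpartials l u) x (delta_mx ord0 i)].

Definition schwartz (R : realType) n (u : 'rV[R]_n -> R[i]) : Prop :=
  csmooth u /\
  forall (l : seq 'I_n) (N : nat), exists M : R, forall x : 'rV[R]_n,
    (1 + enorm x) ^+ N * Normc.normc (cpartials l u x) <= M.

Definition schwartz_sym2_tensor (R : realType) n
    (f : 'rV[R]_n -> 'M[R[i]]_n) : Prop :=
  (forall x, (f x)^T = f x) /\ forall j k, schwartz (fun x => f x j k).

(* Functionals are total on all functions, but only
   their values on Schwartz functions are meaningful, see [eq_dist]. *)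

Definition functional (R : realType) (n : nat) : Type :=
  ('rV[R]_n -> R[i]) -> R[i].

Definition eq_dist (R : realType) n (T U : functional R n) : Prop :=
  forall phi, schwartz phi -> T phi = U phi.

(* Linear and bounded by finitely many Schwartz seminorms. *)
Definition tempered (R : realType) n (T : functional R n) : Prop :=
  (forall (a : R[i]) (phi psi : 'rV[R]_n -> R[i]),
     schwartz phi -> schwartz psi ->
     T (fun x => a * phi x + psi x) = a * T phi + T psi) /\
  exists (C : R) (N : nat), forall phi, schwartz phi -> forall M : R,
    (forall l : seq 'I_n, (size l <= N)%N -> forall x : 'rV[R]_n,
       (1 + enorm x) ^+ N * Normc.normc (cpartials l phi x) <= M) ->
    Normc.normc (T phi) <= C * M.

(* Locally integrable functions of at most polynomial growth in the mean;
   they define tempered distributions. *)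
Definition tempered_fun (R : realType) n (g : 'rV[R]_n -> R[i]) : Prop :=
  [/\ measurable_fun [set: 'rV[R]_n] (@complex.Re R \o g : _ -> measurableTypeR R),
      measurable_fun [set: 'rV[R]_n] (@complex.Im R \o g : _ -> measurableTypeR R) &
      exists N : nat, (lebesgue_rV R n).-integrable setT
        (fun x => (Normc.normc (g x) / (1 + enorm x) ^+ N)%:E)].

Definition dist_of (R : realType) n (g : 'rV[R]_n -> R[i]) : functional R n :=
  fun phi => cintegral (lebesgue_rV R n) setT (fun x => g x * phi x).

Definition fourier (R : realType) n (u : 'rV[R]_n -> R[i]) (y : 'rV[R]_n) :
    R[i] :=
  cintegral (lebesgue_rV R n) setT
    (fun x => (cos (dotr x y) -i* sin (dotr x y)) * u x).

Definition fourier_dist (R : realType) n (T : functional R n) : functional R n :=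
  fun phi => T (fourier phi).

(* [fourier_multiplier m T U]: the product m . F(T) is well defined and U is
   its inverse Fourier transform, i.e. F(U) = m . F(T).  A non-smooth symbol m cannot multiply an
   arbitrary distribution, so F(T) is required to be (integration against) a
   function g, unique almost everywhere, such that m g is again tempered.
   As F is bijective on tempered distributions, U is unique. *)
Definition fourier_multiplier (R : realType) n (m : 'rV[R]_n -> R[i])
    (T U : functional R n) : Prop :=
  [/\ tempered T, tempered U &
    exists g : 'rV[R]_n -> R[i],
      [/\ tempered_fun g, tempered_fun (fun y => m y * g y),
          eq_dist (fourier_dist T) (dist_of g) &
          eq_dist (fourier_dist U) (dist_of (fun y => m y * g y))]].

(* U = R_i T *)
Definition is_riesz (R : realType) n (i : 'I_n) : functional R n ->
    functional R n -> Prop :=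
  fourier_multiplier (fun y => - 'i * (y ord0 i / enorm y)%:C).

(* U = (-Delta)^s T *)
Definition is_frac_laplacian (R : realType) n (s : R) : functional R n ->
    functional R n -> Prop :=
  fourier_multiplier (fun y => (enorm y `^ (2 * s))%:C).

Section averages.
Variables (R : realType) (n : nat) (s : R) (f : 'rV[R]_n -> 'M[R[i]]_n).

Definition divergent_beam (x xi : 'rV[R]_n) : R[i] :=
  cintegral lebesgue_measure `]0, +oo[ (fun t : measurableTypeR R =>
    (t `^ (2 * s - 1))%:C *
    \sum_(j < n) \sum_(k < n)
      f (x + (t : R) *: xi) j k * (xi ord0 j)%:C * (xi ord0 k)%:C).

Definition c20 : R := - Gamma ((n%:R + 2 - 2 * s) / 2) /
  (2 `^ (2 * s - 1) * pi `^ (n%:R / 2) * Gamma s).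

Definition c21 : R := - Gamma ((n%:R + 3 - 2 * s) / 2) /
  (2 `^ (2 * s - 1) * pi `^ (n%:R / 2) * Gamma (s + 1 / 2)).

Definition c22 : R := - Gamma ((n%:R + 4 - 2 * s) / 2) /
  (2 `^ (2 * s - 2) * pi `^ (n%:R / 2) * Gamma s).

Definition avg0 (x : 'rV[R]_n) : R[i] :=
  c20%:C * cintegral (@sphere_measure R n) (@unit_sphere R n)
    (fun xi => divergent_beam x xi).

Definition avg1 (i : 'I_n) (x : 'rV[R]_n) : R[i] :=
  c21%:C * cintegral (@sphere_measure R n) (@unit_sphere R n)
    (fun xi => (xi ord0 i)%:C * divergent_beam x xi).

Definition avg2 (i1 i2 : 'I_n) (x : 'rV[R]_n) : R[i] :=
  c22%:C * cintegral (@sphere_measure R n) (@unit_sphere R n)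
    (fun xi => (xi ord0 i1)%:C * (xi ord0 i2)%:C * divergent_beam x xi).

End averages.

(* Main.v *)
(* By polar coordinates the averages are correlations of the components of f
   with the kernels y_I |y|^(2s-n-m), m = |I|.  Writing |y|^(-a) as a Gamma
   integral of Gaussians e^(-t|y|^2), using the explicit Fourier transforms of
   y_I e^(-t|y|^2) and integrating in t, each such correlation has Fourier
   transform |xi|^(-2s) times a polynomial in xi/|xi| times the transform of
   the component.  Products of at most four coordinates of xi/|xi| are
   therefore multipliers realized by linear combinations of correlations, so
   the iterated Riesz transforms exist without Fourier inversion, and the
   formula becomes a polynomial identity in xi/|xi| and the Kronecker deltas. *)
Require Import Defs.
From HB Require Import structures.
From mathcomp Require Import all_boot all_order all_algebra.
From mathcomp Require Import complex.
From mathcomp Require Import all_classical all_reals all_analysis.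
From mathcomp Require Import measurable_realfun.
From mathcomp Require Import ring lra.
Import Order.TTheory GRing.Theory Num.Theory.
Import numFieldNormedType.Exports.
Set Implicit Arguments.
Unset Strict Implicit.
Unset Printing Implicit Defensive.
Local Open Scope classical_set_scope.
Local Open Scope ring_scope.
Local Open Scope complex_scope.

(** A kernel of degree 2s-n is locally integrable but in general not integrable at infinity, so its
    Fourier transform exists only weakly: the correlation is paired with [fourier phi], and every
    exchange of integrals takes place with both f and phi present to supply decay. The inequality 2s
    < n, which comes from s < 1 and n >= 2, keeps |xi|^(-2s) locally integrable and makes all Gamma
    arguments of the form (n+m-2s)/2 positive. The constants c20, c21, c22 are exactly such that,
    against the Gamma factors of the subordination, each symbol has coefficients polynomial in s,
    the term with the most Kronecker deltas having coefficient -1. In the final combination every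
    term containing a direction xi_i/|xi| cancels, for each pair (j,k) of tensor indices separately.
    What survives is delta_{i1 j} delta_{i2 k} + delta_{i1 k} delta_{i2 j}, which selects f_{i1 i2}
    and f_{i2 i1}; symmetry of f makes them equal, hence the factor 1/2. *)

Local Notation Re := complex.Re.
Local Notation Im := complex.Im.
Local Notation normc := Normc.normc.

(** * Complex-valued integrals *)

Section complex_lemmas.
Variable R : realType.
Implicit Types z w : R[i].

Lemma Re_add z w : Re (z + w) = Re z + Re w.
Proof. by case: z w => a b [c d]. Qed.

Lemma Im_add z w : Im (z + w) = Im z + Im w.
Proof. by case: z w => a b [c d]. Qed.

Lemma Re_mul z w : Re (z * w) = Re z * Re w - Im z * Im w.
Proof. by case: z w => a b [c d]. Qed.

Lemma Im_mul z w : Im (z * w) = Re z * Im w + Im z * Re w.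
Proof. by case: z w => a b [c d]. Qed.

Lemma Re_real (x : R) : Re x%:C = x. Proof. by []. Qed.
Lemma Im_real (x : R) : Im x%:C = 0. Proof. by []. Qed.

Lemma complex_ext z w : Re z = Re w -> Im z = Im w -> z = w.
Proof. by case: z w => a b [c d] /= -> ->. Qed.

Lemma normc_ge0 z : 0 <= normc z.
Proof. by case: z => a b; exact: sqrtr_ge0. Qed.

Lemma normc_Re z : `|Re z| <= normc z.
Proof.
by case: z => a b /=; rewrite -sqrtr_sqr ler_wsqrtr// lerDl sqr_ge0.
Qed.

Lemma normc_Im z : `|Im z| <= normc z.
Proof.
by case: z => a b /=; rewrite -sqrtr_sqr ler_wsqrtr// lerDr sqr_ge0.
Qed.

Lemma normc_le z : normc z <= `|Re z| + `|Im z|.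
Proof.
case: z => a b /=; rewrite -[leRHS]ger0_norm ?addr_ge0// -sqrtr_sqr ler_wsqrtr//.
rewrite sqrrD !real_normK ?num_real// addrAC lerDl.
by rewrite mulrn_wge0 ?mulr_ge0.
Qed.

Lemma normc_real (x : R) : normc x%:C = `|x|.
Proof. by rewrite /= expr0n/= addr0 sqrtr_sqr. Qed.

End complex_lemmas.

Section cmeasurable.
Context d (T : measurableType d) (R : realType).
Implicit Types f g : T -> R[i].

Definition cmeasurable f :=
  measurable_fun [set: T] (fun x => Re (f x) : measurableTypeR R) /\
  measurable_fun [set: T] (fun x => Im (f x) : measurableTypeR R).

Lemma cmeasurable_cst z : cmeasurable (fun=> z).
Proof. by split; exact: measurable_cst. Qed.

Lemma cmeasurableD f g : cmeasurable f -> cmeasurable g ->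
  cmeasurable (fun x => f x + g x).
Proof.
move=> [f1 f2] [g1 g2]; split.
  by under eq_fun do rewrite Re_add; exact: measurable_funD.
by under eq_fun do rewrite Im_add; exact: measurable_funD.
Qed.

Lemma cmeasurableM f g : cmeasurable f -> cmeasurable g ->
  cmeasurable (fun x => f x * g x).
Proof.
move=> [f1 f2] [g1 g2]; split.
  by under eq_fun do rewrite Re_mul; apply: measurable_funB; exact: measurable_funM.
by under eq_fun do rewrite Im_mul; apply: measurable_funD; exact: measurable_funM.
Qed.

Lemma cmeasurable_sum I (r : seq I) (F : I -> T -> R[i]) :
  (forall i, cmeasurable (F i)) -> cmeasurable (fun x => \sum_(i <- r) F i x).
Proof.
move=> mF; elim: r => [|i r IH].
  by under eq_fun do rewrite big_nil; exact: cmeasurable_cst.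
by under eq_fun do rewrite big_cons; exact: cmeasurableD.
Qed.

Lemma cmeasurable_real (f : T -> R) :
  measurable_fun [set: T] (f : T -> measurableTypeR R) ->
  cmeasurable (fun x => (f x)%:C).
Proof. by move=> mf; split => //=; exact: measurable_cst. Qed.

Lemma cmeasurable_normc f : cmeasurable f ->
  measurable_fun [set: T] (fun x => normc (f x) : measurableTypeR R).
Proof.
move=> [f1 f2].
rewrite (_ : (fun _ => _) = (fun x => Num.sqrt (Re (f x) ^+ 2 + Im (f x) ^+ 2))).
  apply: (@measurableT_comp _ _ _ _ _ _ (@Num.sqrt R)).
    by apply: continuous_measurable_fun; exact: sqrt_continuous.
  by apply: measurable_funD; exact: measurable_funX.
by apply/funext => x; case: (f x).
Qed.

End cmeasurable.

Lemma cmeasurable_comp d1 d2 (T1 : measurableType d1) (T2 : measurableType d2)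
    (R : realType) (f : T2 -> R[i]) (h : T1 -> T2) :
  cmeasurable f -> measurable_fun [set: T1] h -> cmeasurable (f \o h).
Proof.
by move=> [f1 f2] mh; split;
  [exact: (measurableT_comp f1 mh)|exact: (measurableT_comp f2 mh)].
Qed.

Section cintegrable.
Context d (T : measurableType d) (R : realType) (mu : {measure set T -> \bar R}).
Implicit Types f g : T -> R[i].

Definition cintegrable f :=
  mu.-integrable setT (fun x => (Re (f x))%:E) /\
  mu.-integrable setT (fun x => (Im (f x))%:E).

Lemma integrable_measurable (g : T -> R) : mu.-integrable setT (fun x => (g x)%:E) ->
  measurable_fun [set: T] (g : T -> measurableTypeR R).
Proof. by move=> /measurable_int /measurable_EFinP. Qed.

Lemma cintegrable_cmeasurable f : cintegrable f -> cmeasurable f.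
Proof. by move=> [i1 i2]; split; exact: integrable_measurable. Qed.

Lemma le_integrableR (g h : T -> R) :
  measurable_fun [set: T] (g : T -> measurableTypeR R) ->
  (forall x, `|g x| <= h x) ->
  mu.-integrable setT (fun x => (h x)%:E) ->
  mu.-integrable setT (fun x => (g x)%:E).
Proof.
move=> mg gh ih; apply: (le_integrable measurableT _ _ ih).
  exact/measurable_EFinP.
move=> x _ /=; rewrite lee_fin (le_trans (gh x))//.
by rewrite ler_norm.
Qed.

Lemma cintegrable_le f (g : T -> R) : cmeasurable f ->
  (forall x, normc (f x) <= g x) ->
  mu.-integrable setT (fun x => (g x)%:E) -> cintegrable f.
Proof.
move=> [f1 f2] fg ig; split.
  by apply: (le_integrableR f1 _ ig) => x; exact: le_trans (normc_Re _) (fg x).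
by apply: (le_integrableR f2 _ ig) => x; exact: le_trans (normc_Im _) (fg x).
Qed.

Lemma integrable_normc f : cintegrable f ->
  mu.-integrable setT (fun x => (normc (f x))%:E).
Proof.
move=> fi; have [f1 f2] := fi; have mf := cintegrable_cmeasurable fi.
apply: (@le_integrableR _ (fun x => `|Re (f x)| + `|Im (f x)|)).
- exact: cmeasurable_normc.
- by move=> x; rewrite ger0_norm ?normc_ge0// normc_le.
- under eq_fun do rewrite EFinD.
  by apply: integrableD => //; [exact: (integrable_norm f1)|exact: (integrable_norm f2)].
Qed.

Lemma cintegrableD f g : cintegrable f -> cintegrable g ->
  cintegrable (fun x => f x + g x).
Proof.
move=> [f1 f2] [g1 g2]; split.
  by under eq_fun do rewrite Re_add EFinD; exact: integrableD.
by under eq_fun do rewrite Im_add EFinD; exact: integrableD.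
Qed.

Lemma cintegrableZ z f : cintegrable f -> cintegrable (fun x => z * f x).
Proof.
move=> fi; apply: (@cintegrable_le _ (fun x => normc z * normc (f x))).
- by apply: cmeasurableM; [exact: cmeasurable_cst|exact: cintegrable_cmeasurable].
- by move=> x; rewrite Normc.normcM.
- by under eq_fun do rewrite EFinM; apply: integrableZl => //; exact: integrable_normc.
Qed.

Lemma cintegrable_bounded f g (M : R) : cmeasurable f ->
  (forall x, normc (f x) <= M) -> cintegrable g ->
  cintegrable (fun x => f x * g x).
Proof.
move=> mf fM gi; apply: (@cintegrable_le _ (fun x => M * normc (g x))).
- by apply: cmeasurableM => //; exact: cintegrable_cmeasurable.
- by move=> x; rewrite Normc.normcM ler_wpM2r ?normc_ge0.
- by under eq_fun do rewrite EFinM; apply: integrableZl => //; exact: integrable_normc.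
Qed.

Lemma cintegralD f g : cintegrable f -> cintegrable g ->
  cintegral mu setT (fun x => f x + g x) =
  cintegral mu setT f + cintegral mu setT g.
Proof.
move=> [f1 f2] [g1 g2]; apply: complex_ext.
  by rewrite Re_add /= -RintegralD//; apply: eq_Rintegral => x _; rewrite Re_add.
by rewrite Im_add /= -RintegralD//; apply: eq_Rintegral => x _; rewrite Im_add.
Qed.

Lemma integrableZR (a : R) (g : T -> R) : mu.-integrable setT (fun x => (g x)%:E) ->
  mu.-integrable setT (fun x => (a * g x)%:E).
Proof. by move=> gi; under eq_fun do rewrite EFinM; exact: integrableZl. Qed.

Lemma cintegralZ z f : cintegrable f ->
  cintegral mu setT (fun x => z * f x) = z * cintegral mu setT f.
Proof.
move=> [f1 f2]; apply: complex_ext.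
  rewrite Re_mul /= -!RintegralZl// -RintegralB//; try exact: integrableZR.
  by apply: eq_Rintegral => x _; rewrite Re_mul.
rewrite Im_mul /= -!RintegralZl// -RintegralD//; try exact: integrableZR.
by apply: eq_Rintegral => x _; rewrite Im_mul.
Qed.

Lemma eq_cintegral f g : f =1 g -> cintegral mu setT f = cintegral mu setT g.
Proof. by move=> /funext ->. Qed.

Lemma cintegralZr z f : cintegrable f ->
  cintegral mu setT (fun x => f x * z) = cintegral mu setT f * z.
Proof.
by move=> fi; rewrite mulrC -cintegralZ//; apply: eq_cintegral => x; rewrite mulrC.
Qed.

Lemma cintegral_real (f : T -> R) :
  cintegral mu setT (fun x => (f x)%:C) = (\int[mu]_x f x)%:C.
Proof.
apply: complex_ext => //=.
by rewrite /Rintegral integral0.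
Qed.

Lemma cintegralZ_real z (f : T -> R) :
  mu.-integrable setT (fun x => (f x)%:E) ->
  cintegral mu setT (fun x => z * (f x)%:C) = z * (\int[mu]_x f x)%:C.
Proof.
move=> fi; rewrite cintegralZ ?cintegral_real//; split => //=.
exact: integrable0.
Qed.

Lemma le_normc_cintegral f (g : T -> R) : cmeasurable f ->
  (forall x, normc (f x) <= g x) ->
  mu.-integrable setT (fun x => (g x)%:E) ->
  normc (cintegral mu setT f) <= 2 * \int[mu]_x g x.
Proof.
move=> mf fg ig; have [f1 f2] := cintegrable_le mf fg ig.
rewrite (le_trans (normc_le _))// mulr_natl mulr2n lerD//=.
  rewrite (le_trans (le_normr_Rintegral _ f1))// le_Rintegral//.
    exact: (integrable_norm f1).
  by move=> x _; exact: le_trans (normc_Re _) (fg x).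
rewrite (le_trans (le_normr_Rintegral _ f2))// le_Rintegral//.
  exact: (integrable_norm f2).
by move=> x _; exact: le_trans (normc_Im _) (fg x).
Qed.

Lemma ae_eq_cintegral f g (N : set T) : measurable N -> mu N = 0%E ->
  cmeasurable f -> cmeasurable g ->
  (forall x, ~ N x -> f x = g x) ->
  cintegral mu setT f = cintegral mu setT g.
Proof.
move=> mN N0 [f1 f2] [g1 g2] fg; rewrite /cintegral; congr Complex; congr fine.
  apply: ae_eq_integral => //; try exact/measurable_EFinP.
  by exists N; split => // x /= nx; apply: contrapT => /fg h; apply: nx => _; rewrite h.
apply: ae_eq_integral => //; try exact/measurable_EFinP.
by exists N; split => // x /= nx; apply: contrapT => /fg h; apply: nx => _; rewrite h.
Qed.

End cintegrable.

(** * Fubini for complex integrands *)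

Section cfubini.
Context d1 d2 (T1 : measurableType d1) (T2 : measurableType d2) (R : realType).
Variable m1 : {sigma_finite_measure set T1 -> \bar R}.
Variable m2 : {sigma_finite_measure set T2 -> \bar R}.

(** Tonelli applies to the positive and negative parts separately, and [fine] of the difference
    stays measurable even at points where an inner integral is infinite. *)
Lemma measurable_Rintegral_prod (f : T1 * T2 -> R) :
  measurable_fun setT (f : _ -> measurableTypeR R) ->
  measurable_fun setT (fun x => \int[m2]_y f (x, y) : measurableTypeR R).
Proof.
move=> mf; rewrite /Rintegral.
apply: (@measurableT_comp _ _ _ _ _ _ (@fine R)).
  exact: fine_measurable.
have mEf : measurable_fun setT (EFin \o f) by exact/measurable_EFinP.
rewrite (_ : (fun _ => _) = (fun x => \int[m2]_y (EFin \o f)^\+ (x, y)) \-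
   (fun x => \int[m2]_y (EFin \o f)^\- (x, y)))%E.
  apply: emeasurable_funB.
    apply: (measurable_fun_fubini_tonelli_F (EFin \o f)^\+%E) => //.
    exact: measurable_funepos.
  apply: (measurable_fun_fubini_tonelli_F (EFin \o f)^\-%E) => //.
  exact: measurable_funeneg.
apply/funext => x; rewrite [LHS]integralE; congr (_ - _)%E;
by apply: eq_integral => y _; rewrite ?(funeposE, funenegE).
Qed.

Lemma cmeasurable_prod (f : T1 * T2 -> R[i]) : cmeasurable f ->
  cmeasurable (fun x => cintegral m2 setT (fun y => f (x, y))).
Proof.
move=> [f1 f2]; split => /=.
  exact: (@measurable_Rintegral_prod (fun p => Re (f p))).
exact: (@measurable_Rintegral_prod (fun p => Im (f p))).
Qed.

(** The inner integral is truncated by [fine], which is harmless only where it is finite; Fubini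
    guarantees this for almost every x, so the outer integrands agree almost everywhere. *)
Lemma Rintegral_prod (f : T1 * T2 -> R) :
  (m1 \x m2)%E.-integrable setT (EFin \o f) ->
  \int[m1]_x \int[m2]_y f (x, y) = \int[(m1 \x m2)%E]_z f z.
Proof.
move=> fi; rewrite [RHS]/Rintegral -integral12_prod_meas1// /Rintegral; congr fine.
have mF := measurable_int _ (integrable_fubini_F fi).
apply: ae_eq_integral => //.
  apply/measurable_EFinP; apply: measurable_Rintegral_prod.
  by apply/measurable_EFinP; exact: measurable_int fi.
have := integrable_ae measurableT (integrable_fubini_F fi).
apply: filterS => x /(_ I) h _.
by rewrite /fubini_F fineK.
Qed.

Lemma Rintegral_prod2 (f : T1 * T2 -> R) :
  (m1 \x m2)%E.-integrable setT (EFin \o f) ->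
  \int[m2]_y \int[m1]_x f (x, y) = \int[(m1 \x m2)%E]_z f z.
Proof.
move=> fi; rewrite [RHS]/Rintegral -integral21_prod_meas1// /Rintegral; congr fine.
have mG := measurable_fubini_G fi.
apply: ae_eq_integral => //.
  by apply/measurable_EFinP; exact: (measurableT_comp (fine_measurable measurableT) mG).
have := ae_integrable2 fi.
apply: filterS => y h _.
by rewrite /fubini_G fineK//; exact: integrable_fin_num h.
Qed.

Lemma cfubini (f : T1 * T2 -> R[i]) : cintegrable (m1 \x m2)%E f ->
  cintegral m1 setT (fun x => cintegral m2 setT (fun y => f (x, y))) =
  cintegral m2 setT (fun y => cintegral m1 setT (fun x => f (x, y))).
Proof.
move=> [f1 f2]; rewrite /cintegral /=; congr Complex.
  rewrite (@Rintegral_prod (fun p => Re (f p)))//.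
  by rewrite (@Rintegral_prod2 (fun p => Re (f p))).
rewrite (@Rintegral_prod (fun p => Im (f p)))//.
by rewrite (@Rintegral_prod2 (fun p => Im (f p))).
Qed.

Lemma cintegrable_prod (f : T1 * T2 -> R[i]) : cmeasurable f ->
  (\int[m1]_x \int[m2]_y (normc (f (x, y)))%:E < +oo)%E ->
  cintegrable (m1 \x m2)%E f.
Proof.
move=> mf fi; apply: (@cintegrable_le _ _ _ _ _ (fun z => normc (f z))) => //.
apply/integrable12ltyP.
  by apply/measurable_EFinP; exact: cmeasurable_normc.
apply: le_lt_trans fi; rewrite le_eqVlt; apply/orP; left; apply/eqP.
apply: eq_integral => x _; apply: eq_integral => y _ /=.
by rewrite ger0_norm// normc_ge0.
Qed.

End cfubini.

(** * Lebesgue measure on row vectors *)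

Section affine.
Variable R : realType.
Notation mu := (@lebesgue_measure R).

(** Lebesgue measure is determined by its values on half-open intervals, and there the scaled
    pushforward can be computed directly. *)
Lemma lebesgue_measure_affine (c b : R) (A : set (measurableTypeR R)) : 0 < c ->
  measurable A ->
  lebesgue_measure A =
  (c%:E * pushforward lebesgue_measure (fun x : measurableTypeR R => (c * (x : R) + b)%R : measurableTypeR R) A)%E.
Proof.
move=> c0 mA; have c0' := ltW c0.
have mphi : measurable_fun setT (fun x : measurableTypeR R => c * (x : R) + b : measurableTypeR R).
  by apply: measurable_funD => //; exact: measurable_funM.
pose push : {measure set (measurableTypeR R) -> \bar R} :=
  mscale (NngNum c0') (measure_function_pushforward__canonical__measure_function_Measure mu mphi).
rewrite -[RHS]/(push A).
apply: lebesgue_measure_unique => // _ [[u v]] _ <-.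
transitivity (c%:E * mu (`](u - b) / c, (v - b) / c]%classic)%R)%E; last first.
  congr (_ * mu _)%E.
  apply/seteqP; split => x /=; rewrite !in_itv/= ltr_pdivrMr// ler_pdivlMr// ltrBlDr lerBrDr.
    by rewrite (mulrC x).
  by rewrite (mulrC x).
rewrite !lebesgue_measure_itv/= !lte_fin ltr_pM2r ?invr_gt0// ltrD2r.
case: ifPn => _; last by rewrite mule0.
rewrite -EFinB -!EFinD -EFinM; congr EFin.
by field; rewrite gt_eqF.
Qed.

Local Open Scope ereal_scope.
Lemma ge0_integral_affine (c b : R) (g : R -> \bar R) : (0 < c)%R ->
  measurable_fun [set: measurableTypeR R] g -> (forall x, 0 <= g x) ->
  c%:E * \int[mu]_x g (c * x + b)%R = \int[mu]_x g x.
Proof.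
move=> c0 mg g0; have c0' := ltW c0.
have mphi : measurable_fun setT (fun x : measurableTypeR R => (c * (x : R) + b)%R : measurableTypeR R).
  by apply: measurable_funD => //; exact: measurable_funM.
rewrite [RHS](eq_measure_integral (mscale (NngNum c0') (pushforward mu
   (fun x : measurableTypeR R => (c * (x : R) + b)%R : measurableTypeR R)))); last first.
  by move=> A mA _; exact: lebesgue_measure_affine.
rewrite ge0_integral_mscale//=.
by congr *%E; rewrite ge0_integral_pushforward.
Qed.

End affine.

Section transfer.
Context d1 d2 (X : measurableType d1) (Y : measurableType d2) (R : realType).
Variables (mu : {measure set X -> \bar R}) (nu : {measure set Y -> \bar R}).
Variable phi : X -> Y.
Hypothesis mphi : measurable_fun setT phi.
Hypothesis munu : forall g : Y -> \bar R, measurable_fun setT g ->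
  (forall y, 0 <= g y)%E -> (\int[mu]_x g (phi x) = \int[nu]_y g y)%E.

(** A change of variables known for nonnegative functions extends to signed and complex ones through
    positive and negative parts. It is applied to translations. *)
Lemma integral_transfer (f : Y -> \bar R) : measurable_fun setT f ->
  (\int[mu]_x f (phi x) = \int[nu]_y f y)%E.
Proof.
move=> mf; rewrite integralE [RHS]integralE -!munu//.
- by congr (_ - _)%E; apply: eq_integral => x _; rewrite ?(funeposE, funenegE).
- exact: measurable_funeneg.
- exact: measurable_funepos.
Qed.

Lemma integrable_transfer (f : Y -> R) :
  measurable_fun setT (f : Y -> measurableTypeR R) ->
  mu.-integrable setT (fun x => (f (phi x))%:E) <->
  nu.-integrable setT (fun y => (f y)%:E).
Proof.
move=> mf; have mf' : measurable_fun setT (fun x => f (phi x) : measurableTypeR R).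
  exact: (measurableT_comp mf).
split => /integrableP[_ fi]; apply/integrableP; split; try exact/measurable_EFinP.
  rewrite -munu//; apply/measurable_EFinP; exact: (measurableT_comp (@normr_measurable R setT) mf).
rewrite (munu (g := fun y => `|(f y)%:E|%E))//.
apply/measurable_EFinP; exact: (measurableT_comp (@normr_measurable R setT) mf).
Qed.

Lemma Rintegral_transfer (f : Y -> R) :
  measurable_fun setT (f : Y -> measurableTypeR R) ->
  \int[mu]_x f (phi x) = \int[nu]_y f y.
Proof.
move=> mf; congr fine; apply: (@integral_transfer (EFin \o f)).
exact/measurable_EFinP.
Qed.

Lemma cintegral_transfer (f : Y -> R[i]) : cmeasurable f ->
  cintegral mu setT (fun x => f (phi x)) = cintegral nu setT f.
Proof.
by move=> [f1 f2]; rewrite /cintegral (Rintegral_transfer f1) (Rintegral_transfer f2).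
Qed.

Lemma cintegrable_transfer (f : Y -> R[i]) : cmeasurable f ->
  cintegrable mu (fun x => f (phi x)) <-> cintegrable nu f.
Proof.
by move=> [f1 f2]; split => -[i1 i2]; split;
  by [apply/(integrable_transfer f1)|apply/(integrable_transfer f2)].
Qed.

End transfer.

Section cons_rV_lemmas.
Variable R : realType.

Lemma cons_rV0 n (a : R) (v : 'rV[R]_n) : cons_rV (a, v) ord0 ord0 = a.
Proof.
have -> : ord0 = @lshift 1 n ord0 by exact/val_inj.
by rewrite /cons_rV [LHS](@row_mxEl _ 1 1 n) mxE eqxx mulr1n.
Qed.

Lemma cons_rVS n (a : R) (v : 'rV[R]_n) i : cons_rV (a, v) ord0 (lift ord0 i) = v ord0 i.
Proof.
have -> : lift ord0 i = @rshift 1 n i by exact/val_inj.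
by rewrite /cons_rV [LHS](@row_mxEr _ 1 1 n).
Qed.

Lemma rV_ext n (x y : 'rV[R]_n.+1) : x ord0 ord0 = y ord0 ord0 ->
  (forall i, x ord0 (lift ord0 i) = y ord0 (lift ord0 i)) -> x = y.
Proof.
move=> h0 hS; apply/rowP => i; case: (unliftP ord0 i) => [j ->|->]//.
Qed.

Lemma cons_rVD n (a b : R) (v w : 'rV[R]_n) :
  cons_rV (a, v) + cons_rV (b, w) = cons_rV (a + b, v + w).
Proof.
by apply: rV_ext => [|i]; rewrite [LHS]mxE ?cons_rV0// !cons_rVS mxE.
Qed.

Lemma cons_rVZ n (c a : R) (v : 'rV[R]_n) :
  c *: cons_rV (a, v) = cons_rV (c * a, c *: v).
Proof.
by apply: rV_ext => [|i]; rewrite [LHS]mxE ?cons_rV0// !cons_rVS mxE.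
Qed.

Lemma cons_rVP n (x : 'rV[R]_n.+1) :
  x = cons_rV (x ord0 ord0, \row_i x ord0 (lift ord0 i)).
Proof. by apply: rV_ext => [|i]; rewrite ?cons_rV0// cons_rVS mxE. Qed.

End cons_rV_lemmas.

Section enorm.
Variables (R : realType) (n : nat).
Implicit Types (x y : 'rV[R]_n) (c : R).

Lemma dotr_ge0 x : 0 <= dotr x x.
Proof. by apply: sumr_ge0 => i _; rewrite -expr2 sqr_ge0. Qed.

Lemma enorm_ge0 x : 0 <= enorm x. Proof. exact: sqrtr_ge0. Qed.

Lemma sqr_enorm x : enorm x ^+ 2 = dotr x x.
Proof. by rewrite sqr_sqrtr ?dotr_ge0. Qed.

Lemma coord_le_enorm x i : `|x ord0 i| <= enorm x.
Proof.
rewrite -sqrtr_sqr ler_wsqrtr// /dotr (bigD1 i)//= expr2 lerDl.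
by apply: sumr_ge0 => j _; rewrite -expr2 sqr_ge0.
Qed.

Lemma dotrZ c x y : dotr (c *: x) y = c * dotr x y.
Proof. by rewrite /dotr mulr_sumr; apply: eq_bigr => i _; rewrite mxE mulrA. Qed.

Lemma dotrC x y : dotr x y = dotr y x.
Proof. by apply: eq_bigr => i _; rewrite mulrC. Qed.

Lemma dotrD x y z : dotr (x + y) z = dotr x z + dotr y z.
Proof. by rewrite /dotr -big_split; apply: eq_bigr => i _; rewrite mxE mulrDl. Qed.

Lemma dotrN x y : dotr (- x) y = - dotr x y.
Proof. by rewrite -scaleN1r dotrZ mulN1r. Qed.

Lemma enormZ c x : enorm (c *: x) = `|c| * enorm x.
Proof.
rewrite /enorm dotrZ dotrC dotrZ mulrA -expr2 sqrtrM ?sqr_ge0//.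
by rewrite sqrtr_sqr.
Qed.

Lemma enorm_eq0 x : (enorm x == 0) = (x == 0).
Proof.
apply/eqP/eqP => [x0|->]; last by rewrite -(scale0r 0) enormZ normr0 mul0r.
apply/rowP => i; rewrite mxE; apply/eqP; rewrite -normr_le0 -x0.
exact: coord_le_enorm.
Qed.

Lemma enorm_gt0 x : (0 < enorm x) = (x != 0).
Proof. by rewrite lt_neqAle eq_sym enorm_eq0 enorm_ge0 andbT. Qed.

Lemma measurable_dotr y : measurable_fun setT (fun x => dotr x y : measurableTypeR R).
Proof.
by apply: measurable_sum => i; apply: measurable_funM => //; exact: measurable_coord.
Qed.

Lemma measurable_rV_scale c : measurable_fun setT (fun x => c *: x).
Proof.
apply: measurable_rVP => i; under eq_fun do rewrite mxE.
by apply: measurable_funM => //; exact: measurable_coord.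
Qed.

Lemma measurable_rV_shift a : measurable_fun setT (fun x => x + a).
Proof.
apply: measurable_rVP => i; under eq_fun do rewrite mxE.
by apply: measurable_funD => //; exact: measurable_coord.
Qed.

End enorm.

Section lebesgue_rV_lemmas.
Variable R : realType.
Notation mu := (@lebesgue_measure R).
Local Open Scope ereal_scope.

Lemma ge0_integral_rVS n (g : 'rV[R]_n.+1 -> \bar R) : measurable_fun setT g ->
  (forall x, 0 <= g x) ->
  \int[lebesgue_rV R n.+1]_x g x =
  \int[mu]_a \int[lebesgue_rV R n]_v g (cons_rV (a, v)).
Proof.
move=> mg g0; rewrite [LHS](_ : _ = \int[mu \x lebesgue_rV R n]_p g (cons_rV p)).
  rewrite (fubini_tonelli1 (g \o (@cons_rV R n)))//.
    exact: (measurableT_comp mg (@measurable_cons_rV R n)).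
  by move=> p /=.
rewrite [LHS](_ : _ = \int[pushforward (mu \x lebesgue_rV R n) (@cons_rV R n)]_x g x)//.
rewrite ge0_integral_pushforward//.
exact: measurable_cons_rV.
Qed.

Lemma ge0_integral_rV0 (g : 'rV[R]_0 -> \bar R) : measurable_fun setT g ->
  (forall x, 0 <= g x) ->
  \int[lebesgue_rV R 0]_x g x = g 0%R.
Proof.
by move=> mg g0; rewrite /= integral_dirac// diracT mul1e.
Qed.

Lemma measurable_cons_rVl n (a : R) : measurable_fun setT (fun v : 'rV[R]_n => cons_rV (a, v)).
Proof. exact: (measurableT_comp (@measurable_cons_rV R n)). Qed.

(** Induction on the dimension: peel off the first coordinate, translate the remaining ones inside,
    then use the affine rule on the line outside. *)
Lemma ge0_integral_rV_shift n (a : 'rV[R]_n) (g : 'rV[R]_n -> \bar R) :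
  measurable_fun setT g -> (forall x, 0 <= g x) ->
  \int[lebesgue_rV R n]_x g (x + a)%R = \int[lebesgue_rV R n]_x g x.
Proof.
elim: n a g => [a g mg g0|n IH a g mg g0].
  rewrite !ge0_integral_rV0//; first by congr g; apply/rowP => -[].
  exact: (measurableT_comp mg (measurable_rV_shift _)).
rewrite !ge0_integral_rVS//; last exact: (measurableT_comp mg (measurable_rV_shift _)).
rewrite [a]cons_rVP; set b := a ord0 ord0; set w := (\row_i _)%R.
transitivity (\int[mu]_u (\int[lebesgue_rV R n]_v g (cons_rV ((u : R) + b, v)%R))).
  apply: eq_integral => u _; under eq_integral do rewrite cons_rVD.
  rewrite (IH w (fun v => g (cons_rV ((u : R) + b, v)%R)))//.
  exact: (measurableT_comp mg (measurable_cons_rVl _)).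
rewrite -(@ge0_integral_affine R 1 b (fun u => \int[lebesgue_rV R n]_v g (cons_rV (u, v)))).
- by rewrite mul1e; apply: eq_integral => u _; rewrite mul1r.
- by [].
- apply: (measurable_fun_fubini_tonelli_F (g \o (@cons_rV R n))); last by move=> p; exact: g0.
  exact: (measurableT_comp mg (@measurable_cons_rV R n)).
- by move=> u; exact: integral_ge0.
Qed.

Lemma ge0_integral_rV_scale n (c : R) (g : 'rV[R]_n -> \bar R) : (0 < c)%R ->
  measurable_fun setT g -> (forall x, 0 <= g x) ->
  (c ^+ n)%:E * \int[lebesgue_rV R n]_x g (c *: x)%R = \int[lebesgue_rV R n]_x g x.
Proof.
move=> c0; elim: n g => [g mg g0|n IH g mg g0].
  rewrite !ge0_integral_rV0//; first by rewrite mul1e; congr g; apply/rowP => -[].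
  exact: (measurableT_comp mg (measurable_rV_scale _)).
rewrite !ge0_integral_rVS//; last exact: (measurableT_comp mg (measurable_rV_scale _)).
have mG : measurable_fun setT (fun u => \int[lebesgue_rV R n]_v g (cons_rV (u, v))).
  apply: (measurable_fun_fubini_tonelli_F (g \o (@cons_rV R n))); last by move=> p; exact: g0.
  exact: (measurableT_comp mg (@measurable_cons_rV R n)).
have mG' : measurable_fun setT (fun u : measurableTypeR R => \int[lebesgue_rV R n]_v g (cons_rV ((u : R) * c, c *: v)%R)).
  apply: (measurable_fun_fubini_tonelli_F (m2 := lebesgue_rV R n) (fun p : measurableTypeR R * 'rV[R]_n => g (cons_rV ((p.1 : R) * c, c *: p.2)%R))) => //.
  apply: (measurableT_comp mg); apply: (measurableT_comp (@measurable_cons_rV R n)).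
  apply/measurable_fun_pair => /=.
    by apply: measurable_funM => //; exact: measurable_fst.
  by apply: (measurableT_comp (@measurable_rV_scale _ _ _)); exact: measurable_snd.
rewrite -[RHS](@ge0_integral_affine R c 0 (fun u => \int[lebesgue_rV R n]_v g (cons_rV (u, v))))//; last first.
  by move=> u; exact: integral_ge0.
rewrite exprS EFinM -muleA; congr *%E.
rewrite -ge0_integralZl//; last 3 first.
- rewrite (_ : (fun _ => _) = (fun u : measurableTypeR R => \int[lebesgue_rV R n]_v g (cons_rV ((u : R) * c, c *: v)%R)))//.
  by apply/funext => u; apply: eq_integral => v _; rewrite cons_rVZ mulrC.
- by move=> u _; exact: integral_ge0.
- by rewrite lee_fin exprn_ge0// ltW.
apply: eq_integral => u _; rewrite addr0.
rewrite -(IH (fun v => g (cons_rV (c * (u : R), v)%R)))//; last first.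
  exact: (measurableT_comp mg (measurable_cons_rVl _)).
by congr *%E; apply: eq_integral => v _; rewrite cons_rVZ.
Qed.

Lemma ge0_integral_rV_prod n (F : 'I_n -> R -> R) :
  (forall i, measurable_fun setT (F i : measurableTypeR R -> measurableTypeR R)) ->
  (forall i x, 0 <= F i x)%R ->
  \int[lebesgue_rV R n]_x (\prod_(i < n) F i (x ord0 i))%:E =
  \prod_(i < n) \int[mu]_x (F i x)%:E.
Proof.
elim: n F => [F mF F0|n IH F mF F0].
  rewrite ge0_integral_rV0; first by rewrite !big_ord0.
    by apply/measurable_EFinP; apply: measurable_prod => -[].
  by move=> x; rewrite big_ord0.
have mP m (G : 'I_m -> R -> R) :
    (forall i, measurable_fun setT (G i : measurableTypeR R -> measurableTypeR R)) ->
    measurable_fun setT (fun x : 'rV[R]_m => (\prod_(i < m) G i (x ord0 i))%R : measurableTypeR R).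
  by move=> mG; apply: measurable_prod => i _; apply: (measurableT_comp (mG i)); exact: measurable_coord.
rewrite ge0_integral_rVS; last 2 first.
- by apply/measurable_EFinP; exact: mP.
- by move=> x; rewrite lee_fin; exact: prodr_ge0.
rewrite big_ord_recl -IH//.
rewrite -ge0_integralZr//; last 3 first.
- by apply/measurable_EFinP; exact: mF.
- by move=> x _; rewrite lee_fin.
- by apply: integral_ge0 => x _; rewrite lee_fin; exact: prodr_ge0.
apply: eq_integral => u _.
rewrite -ge0_integralZl//; last 3 first.
- by apply/measurable_EFinP; apply: (mP _ (fun i => F (lift ord0 i))).
- by move=> x _; rewrite lee_fin; exact: prodr_ge0.
- by rewrite lee_fin.
apply: eq_integral => v _; rewrite -EFinM big_ord_recl cons_rV0; congr (_ * _)%:E%R.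
by apply: eq_bigr => i _; rewrite cons_rVS.
Qed.

End lebesgue_rV_lemmas.

(** * Borel measurability for the coordinate sigma-algebra *)

Section continuous_measurable.
Variables (R : realType) (n : nat).

Let box (q : 'rV[rat]_n) (k : nat) : set 'rV[R]_n :=
  [set y | forall i, `|y ord0 i - ratr (q ord0 i)| < k.+1%:R^-1].

Let measurable_box q k : measurable (box q k).
Proof.
rewrite (_ : box q k = \big[setI/setT]_(i <- enum 'I_n)
   [set y : 'rV[R]_n | `|y ord0 i - ratr (q ord0 i)| < k.+1%:R^-1]).
  apply: bigsetI_measurable => i _.
  have := @measurable_coord R n i measurableT
    [set a : R | `|a - ratr (q ord0 i)| < k.+1%:R^-1].
  rewrite setTI; apply.
  rewrite (_ : [set a : R | _] = ball (ratr (q ord0 i) : R) k.+1%:R^-1); first exact: measurable_ball.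
  by apply/seteqP; split => a /=; rewrite /ball/= distrC.
apply/seteqP; split => y /=.
  by move=> h; elim/big_ind: _ => //= i _.
by rewrite -bigcap_seq => h i; apply: (h i) => /=; rewrite mem_enum.
Qed.

(** The sigma-algebra is generated by the coordinates, so open sets have to be reached by countable
    unions: U is the union of the boxes with rational centre and radius 1/(k+1) that it contains,
    enumerated by [unpickle]. *)
Lemma open_measurable_rV (U : set 'rV[R]_n) : open U -> measurable U.
Proof.
move=> oU; pose B (m : nat) : set 'rV[R]_n :=
  if unpickle m is Some (q, k) then
    (if `[< box q k `<=` U >] then box q k else set0) else set0.
have mB m : measurable (B m).
  rewrite /B; case: (unpickle m : option ('rV[rat]_n * nat)) => [[q k]|//].
  by case: ifPn => _ //; exact: measurable_box.
suff -> : U = \bigcup_m B m by exact: bigcupT_measurable.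
apply/seteqP; split => [x Ux|x [m _]]; last first.
  rewrite /B; case: (unpickle m : option ('rV[rat]_n * nat)) => [[q k]|//].
  by case: ifPn => // /asboolP; exact.
have /nbhs_ballP[e /= e0 eU] := open_nbhs_nbhs (conj oU Ux).
have [k hk] : exists k : nat, k.+1%:R^-1 < e / 2.
  have e20 : 0 < e / 2 by rewrite divr_gt0.
  have := near_infty_natSinv_lt (PosNum e20) => -[k _ /(_ k)] /= h; exists k.
  exact: h.
have k0 : 0 < k.+1%:R^-1 :> R by rewrite invr_gt0.
have /choice[q hq] : forall i : 'I_n, exists q : rat, `|x ord0 i - ratr q| < k.+1%:R^-1.
  move=> i; have /rat_in_itvoo[q] : x ord0 i - k.+1%:R^-1 < x ord0 i + k.+1%:R^-1.
    by rewrite ltrD2l gtrN.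
  rewrite in_itv/= => /andP[q1 q2]; exists q.
  by rewrite distrC ltr_distl q1.
exists (pickle (\row_i q i, k)) => //; rewrite /B pickleK.
have bx : box (\row_i q i) k x by move=> i; rewrite mxE.
rewrite asboolT// => y yb; apply: eU; split => // i j.
rewrite /ball /= ord1 (le_lt_trans (ler_distD (ratr (q j)) _ _))//.
rewrite [ltRHS]splitr ltrD//; first by rewrite (lt_trans _ hk)// hq.
by rewrite (lt_trans _ hk)// distrC; have := yb j; rewrite mxE.
Qed.

Lemma continuous_measurable_rV (f : 'rV[R]_n -> R) : continuous f ->
  measurable_fun setT (f : _ -> measurableTypeR R).
Proof.
move=> /continuousP cf; apply: (measurability _ (RGenOpens.measurableE R)).
move=> _ [_ [a [b ->] <-]]; rewrite setTI; apply: open_measurable_rV.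
exact/cf/interval_open.
Qed.

End continuous_measurable.

Section shift_rV.
Variables (R : realType) (n : nat) (a : 'rV[R]_n).
Notation lam := (lebesgue_rV R n).

Lemma cintegral_rV_shift (f : 'rV[R]_n -> R[i]) : cmeasurable f ->
  cintegral lam setT (fun x => f (x + a)) = cintegral lam setT f.
Proof.
move=> mf; apply: (@cintegral_transfer _ _ _ _ _ lam lam (fun x => x + a)) => //.
by move=> g mg g0; exact: ge0_integral_rV_shift.
Qed.

Lemma Rintegral_rV_shift (f : 'rV[R]_n -> R) :
  measurable_fun setT (f : _ -> measurableTypeR R) ->
  \int[lam]_x f (x + a) = \int[lam]_x f x.
Proof.
move=> mf; apply: (@Rintegral_transfer _ _ _ _ _ lam lam (fun x => x + a)) => //.
by move=> g mg g0; exact: ge0_integral_rV_shift.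
Qed.

Lemma integrable_rV_shift (f : 'rV[R]_n -> R) :
  measurable_fun setT (f : _ -> measurableTypeR R) ->
  lam.-integrable setT (fun x => (f (x + a))%:E) <->
  lam.-integrable setT (fun x => (f x)%:E).
Proof.
move=> mf; apply: (@integrable_transfer _ _ _ _ _ lam lam (fun x => x + a)) => //.
  exact: measurable_rV_shift.
by move=> g mg g0; exact: ge0_integral_rV_shift.
Qed.

Lemma cintegrable_rV_shift (f : 'rV[R]_n -> R[i]) : cmeasurable f ->
  cintegrable lam (fun x => f (x + a)) <-> cintegrable lam f.
Proof.
move=> mf; apply: (@cintegrable_transfer _ _ _ _ _ lam lam (fun x => x + a)) => //.
  exact: measurable_rV_shift.
by move=> g mg g0; exact: ge0_integral_rV_shift.
Qed.

End shift_rV.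

(** * An integrable weight and rapidly decreasing functions *)

Section weights.
Variable R : realType.
Notation mu := (@lebesgue_measure R).

Lemma ge0_integral_even (f : R -> R) : (forall x, 0 <= f x) ->
  continuous f -> (forall x, f (- x) = f x) ->
  (\int[mu]_x (f x)%:E = 2%:E * \int[mu]_(x in `[0%R, +oo[) (f x)%:E)%E.
Proof.
move=> f0 cf ef; rewrite ge0_symfun_integralT//; last by move=> x /=; rewrite ef.
by congr (_ * integral _ _ _)%E; apply/seteqP; split => x /=; rewrite in_itv/= andbT.
Qed.

Lemma integral_oneDsqr : (\int[mu]_x (oneDsqr x)^-1%:E = pi%:E)%E.
Proof.
rewrite ge0_integral_even.
- by rewrite integral0y_oneDsqr -EFinM mulrC divfK.
- by move=> x; rewrite invr_ge0 addr_ge0// sqr_ge0.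
- by move=> x; exact: continuous_oneDsqrV.
- by move=> x; rewrite /oneDsqr sqrrN.
Qed.

(** The exponent 2n is chosen so that the weight lies below the product of the 1/(1+x_i^2), whose
    integral factors by Tonelli into n copies of pi. *)
Definition rV_weight n (x : 'rV[R]_n) : R := ((1 + enorm x) ^+ n.*2)^-1.

Lemma onePenorm_gt0 n (x : 'rV[R]_n) : 0 < 1 + enorm x.
Proof. by rewrite ltr_pwDl// enorm_ge0. Qed.

Lemma rV_weight_ge0 n (x : 'rV[R]_n) : 0 <= rV_weight x.
Proof. by rewrite invr_ge0 exprn_ge0// ltW// onePenorm_gt0. Qed.

Lemma measurable_onePenorm_exp n N :
  measurable_fun setT (fun x : 'rV[R]_n => ((1 + enorm x) ^+ N)^-1 : measurableTypeR R).
Proof.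
rewrite (_ : (fun _ => _) = (fun x => (1 + enorm x) `^ (- N%:R))).
  apply: (measurableT_comp (measurable_powR _)).
  by apply: measurable_funD => //; exact: measurable_enorm.
by apply/funext => x; rewrite powR_invn// ltW// onePenorm_gt0.
Qed.

Lemma measurable_rV_weight n :
  measurable_fun setT (@rV_weight n : _ -> measurableTypeR R).
Proof. exact: measurable_onePenorm_exp. Qed.

Lemma rV_weight_le n (x : 'rV[R]_n) :
  rV_weight x <= \prod_(i < n) (oneDsqr (x ord0 i))^-1.
Proof.
rewrite prodfV lef_pV2 ?posrE ?exprn_gt0 ?onePenorm_gt0//; last first.
  by apply: prodr_gt0 => i _; rewrite ltr_pwDl// sqr_ge0.
rewrite -mul2n exprM.
rewrite -[X in _ <= _ ^+ X](card_ord n) -prodr_const; apply: ler_prod => i _.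
rewrite addr_ge0 ?sqr_ge0//=.
rewrite sqrrD expr1n mul1r /oneDsqr -addrA lerD2l -real_normK ?num_real//.
rewrite (@le_trans _ _ (enorm x ^+ 2))//.
  by rewrite ler_pXn2r ?nnegrE ?enorm_ge0// coord_le_enorm.
by rewrite lerDr mulrn_wge0// enorm_ge0.
Qed.

Lemma integrable_prod_oneDsqrV n : (lebesgue_rV R n).-integrable setT
  (fun x : 'rV[R]_n => (\prod_(i < n) (oneDsqr (x ord0 i))^-1)%:E).
Proof.
have p0 (x : 'rV[R]_n) : 0 <= \prod_(i < n) (oneDsqr (x ord0 i))^-1.
  by apply: prodr_ge0 => i _; rewrite invr_ge0 addr_ge0// sqr_ge0.
apply/integrableP; split.
  apply/measurable_EFinP; apply: measurable_prod => i _.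
  apply: (@measurableT_comp _ _ _ _ _ _ (fun a : R => (oneDsqr a)^-1)); last exact: measurable_coord.
  by apply: continuous_measurable_fun => ?; exact: continuous_oneDsqrV.
under eq_integral => x _ do rewrite gee0_abs ?lee_fin ?p0//.
rewrite (@ge0_integral_rV_prod R n (fun _ a => (oneDsqr a)^-1)).
- rewrite (eq_bigr (fun=> pi%:E)); last by move=> i _; exact: integral_oneDsqr.
  by rewrite prodEFin ltry.
- by move=> _; apply: continuous_measurable_fun => ?; exact: continuous_oneDsqrV.
- by move=> i x; rewrite invr_ge0 addr_ge0// sqr_ge0.
Qed.

Lemma integrable_rV_weight n :
  (lebesgue_rV R n).-integrable setT (fun x => (rV_weight x)%:E).
Proof.
apply: (le_integrableR _ _ (integrable_prod_oneDsqrV n)).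
  exact: measurable_rV_weight.
by move=> x; rewrite ger0_norm ?rV_weight_ge0// rV_weight_le.
Qed.

Definition rapid n (u : 'rV[R]_n -> R) := forall N : nat, exists M : R,
  forall x, (1 + enorm x) ^+ N * `|u x| <= M.

Lemma rapid_bound n (u : 'rV[R]_n -> R) : rapid u ->
  exists M : R, 0 <= M /\ forall x, `|u x| <= M * rV_weight x.
Proof.
move=> /(_ n.*2)[M hM]; exists M; split.
  by rewrite (le_trans _ (hM 0))// mulr_ge0// exprn_ge0// ltW// onePenorm_gt0.
move=> x; rewrite ler_pdivlMr ?exprn_gt0 ?onePenorm_gt0// mulrC; exact: hM.
Qed.

Lemma rapid_integrable n (u : 'rV[R]_n -> R) :
  measurable_fun setT (u : _ -> measurableTypeR R) -> rapid u ->
  (lebesgue_rV R n).-integrable setT (fun x => (u x)%:E).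
Proof.
move=> mu' /rapid_bound[M [M0 hM]].
apply: (le_integrableR mu' hM); apply: integrableZR; exact: integrable_rV_weight.
Qed.

End weights.

(** * The Gamma function *)

Section halfline.
Variable R : realType.
Notation mu := (@lebesgue_measure R).

Local Notation pR := (`]0%R, +oo[%classic : set R).

(** The intervals avoid both ends of the half line, since integrands such as t^(b-1) may be singular
    at 0. They are also invariant under t -> 1/t. *)
Definition halfline_approx (k : nat) : set R := `[k.+1%:R^-1, k.+1%:R]%classic.
Local Notation A := halfline_approx.

Lemma bigcup_halfline : \bigcup_k A k = `]0, +oo[%classic.
Proof.
apply/seteqP; split => [x [k _]|x]; rewrite /A /= !in_itv/= ?andbT.
  by move=> /andP[+ _]; apply: lt_le_trans; rewrite invr_gt0.
move=> x0; have [m hm] : exists m : nat, x <= m.+1%:R.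
  have /ltW h := archi_boundP (ltW x0).
  by exists (Num.bound x); rewrite (le_trans h)// ler_nat.
have [k hk] : exists k : nat, k.+1%:R^-1 <= x.
  have /ltW h : x^-1 < (Num.bound x^-1)%:R by apply: archi_boundP; rewrite invr_ge0 ltW.
  exists (Num.bound x^-1); rewrite -[leRHS]invrK lef_pV2 ?posrE ?invr_gt0//.
  by rewrite (le_trans h)// ler_nat.
exists (maxn k m) => //=; rewrite in_itv/=; apply/andP; split.
  by rewrite (le_trans _ hk)// lef_pV2 ?posrE// ler_nat ltnS leq_maxl.
by rewrite (le_trans hm)// ler_nat ltnS leq_maxr.
Qed.

Let ndA : nondecreasing_seq A.
Proof.
move=> m n mn; apply/subsetPset => x; rewrite /A /= !in_itv/= => /andP[h1 h2].
apply/andP; split; last by rewrite (le_trans h2)// ler_nat ltnS.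
by rewrite (le_trans _ h1)// lef_pV2 ?posrE// ler_nat ltnS.
Qed.

Let subA k : A k `<=` `]0, +oo[%classic.
Proof. by rewrite -bigcup_halfline => x Ax; exists k. Qed.

Lemma ge0_cvg_integral_halfline (f : R -> \bar R) :
  measurable_fun pR f -> (forall x : R, (0 < x)%R -> (0 <= f x)%E) ->
  (\int[mu]_(x in A k) f x @[k --> \oo] -->
   \int[mu]_(x in pR) f x)%E.
Proof.
move=> mf f0; rewrite -[X in integral _ X]bigcup_halfline.
apply: ge0_nondecreasing_set_cvg_integral => //.
- by move=> k; exact: measurable_itv.
- by move=> k; apply: measurable_funS mf => //; exact: subA.
- by move=> k x /subA/=; rewrite in_itv/= andbT => /f0.
Qed.

Lemma cvg_integral_halfline (f : R -> R) :
  mu.-integrable pR (EFin \o f) ->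
  (\int[mu]_(x in A k) (f x)%:E @[k --> \oo] -->
   \int[mu]_(x in pR) (f x)%:E)%E.
Proof.
move=> fi; have mf := measurable_int _ fi.
rewrite integralE; under eq_fun do rewrite integralE.
apply: cvgeB.
- apply: fin_num_adde_defl; rewrite fin_numN.
  by apply: integrable_neg_fin_num => //.
- by apply: ge0_cvg_integral_halfline => //; exact: measurable_funepos.
- by apply: ge0_cvg_integral_halfline => //; exact: measurable_funeneg.
Qed.

(** For k = 0 the interval degenerates to the point 1; a positive k gives the strict inequality of
    endpoints that the fundamental theorem asks for. *)
Lemma FTC_segment_halfline (f F : R -> R) (k : nat) : (0 < k)%N ->
  {in `]0, +oo[, continuous f} ->
  (forall x : R, 0 < x -> is_derive x 1 F (f x)) ->
  (\int[mu]_(x in A k) (f x)%:E =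
   (F k.+1%:R)%:E - (F k.+1%:R^-1)%:E)%E.
Proof.
move=> k0 cf dF.
have pos x : k.+1%:R^-1 <= x -> 0 < x by apply: lt_le_trans; rewrite invr_gt0.
have cF x : 0 < x -> {for x, continuous F}.
  by move=> x0; apply/differentiable_continuous/derivable1_diffP; have [] := dF _ x0.
apply: continuous_FTC2.
- by rewrite (@lt_trans _ _ 1)// ?invf_lt1 ?ltr1n.
- apply: continuous_in_subspaceT => x; rewrite inE/= in_itv/= => /andP[/pos x0 _].
  by apply: cf; rewrite in_itv/= x0.
- split.
  + by move=> x; rewrite in_itv/= => /andP[/ltW/pos/dF[]].
  + by apply: cvg_at_right_filter; apply: cF; rewrite invr_gt0.
  + by apply: cvg_at_left_filter; apply: cF.
- move=> x; rewrite in_itv/= => /andP[/ltW/pos/dF h _].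
  by rewrite derive1E; exact: derive_val.
Qed.

Lemma cvg_FTC_halfline (f F : R -> R) (L l : R) :
  {in `]0, +oo[, continuous f} ->
  (forall x : R, 0 < x -> is_derive x 1 F (f x)) ->
  F x @[x --> +oo] --> l -> F x @[x --> 0^'+] --> L ->
  (\int[mu]_(x in A k) (f x)%:E @[k --> \oo] --> (l - L)%:E)%E.
Proof.
move=> cf dF Fl FL.
have h : (F k.+1%:R - F k.+1%:R^-1) @[k --> \oo] --> l - L.
  apply: cvgB.
    apply: (cvg_comp _ _ _ Fl).
    apply/cvgryPge => M; near=> k; rewrite (@le_trans _ _ k%:R)// ?ler_nat//.
    by near: k; exact: nbhs_infty_ger.
  by apply: ((cvg_at_rightP F 0 L).1 FL (fun k => k.+1%:R^-1)); split => //; exact: cvg_harmonic.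
have {}h : ((F k.+1%:R - F k.+1%:R^-1)%:E @[k --> \oo] --> (l - L)%:E)%E.
  by apply: cvg_EFin => //; exact: nearW.
apply: cvg_trans h.
apply: near_eq_cvg; near=> k; rewrite FTC_segment_halfline//.
by near: k; exact: nbhs_infty_gt.
Unshelve. all: end_near. Qed.

Lemma continuous_measurable_halfline (f : R -> R) :
  {in `]0, +oo[, continuous f} -> measurable_fun pR f.
Proof.
move=> cf; apply: open_continuous_measurable_fun => //.
by move=> x; rewrite inE => xi; exact: cf.
Qed.

Lemma ge0_FTC_halfline (f F : R -> R) (L l : R) :
  {in `]0, +oo[, continuous f} -> (forall x : R, 0 < x -> 0 <= f x) ->
  (forall x : R, 0 < x -> is_derive x 1 F (f x)) ->
  F x @[x --> +oo] --> l -> F x @[x --> 0^'+] --> L ->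
  (\int[mu]_(x in `]0%R, +oo[) (f x)%:E = (l - L)%:E)%E.
Proof.
move=> cf f0 dF Fl FL.
have h1 := cvg_FTC_halfline cf dF Fl FL.
have h2 := @ge0_cvg_integral_halfline (EFin \o f) _ _.
apply: (cvg_unique _ (h2 _ _) h1) => //.
  by apply/measurable_EFinP; exact: continuous_measurable_halfline.
Qed.

Lemma integrable_FTC_halfline (f F : R -> R) (L l : R) :
  {in `]0, +oo[, continuous f} -> mu.-integrable pR (EFin \o f) ->
  (forall x : R, 0 < x -> is_derive x 1 F (f x)) ->
  F x @[x --> +oo] --> l -> F x @[x --> 0^'+] --> L ->
  (\int[mu]_(x in `]0%R, +oo[) (f x)%:E = (l - L)%:E)%E.
Proof.
move=> cf fi dF Fl FL.
exact: (cvg_unique _ (cvg_integral_halfline fi) (cvg_FTC_halfline cf dF Fl FL)).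
Qed.

(** Inversion maps each approximating interval onto itself, so the substitution is carried out on
    compact intervals away from 0 and only then passed to the limit. *)
Lemma ge0_integral_halfline_inv (G : R -> R) :
  {in `]0, +oo[, continuous G} -> (forall x : R, 0 < x -> 0 <= G x) ->
  (\int[mu]_(x in `]0%R, +oo[) (G x)%:E =
   \int[mu]_(x in `]0%R, +oo[) (G x^-1 * x ^- 2)%:E)%E.
Proof.
move=> cG G0.
have cV2 (x : R) : 0 < x -> {for x, continuous (fun x : R => x ^- 2)}.
  move=> x0; apply: cvgV; last exact: exprn_continuous.
  by rewrite gt_eqF// exprn_gt0.
have cG' : {in `]0, +oo[, continuous (fun x : R => G x^-1 * x ^- 2)}.
  move=> x; rewrite in_itv/= andbT => x0.
  have cV : {for x, continuous (@GRing.inv R)} by apply: inv_continuous; rewrite gt_eqF.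
  apply: cvgM.
    by apply: (@continuous_comp _ _ _ (@GRing.inv R) G) => //; apply: cG; rewrite in_itv/= invr_gt0 x0.
  exact: cV2.
have h1 := @ge0_cvg_integral_halfline (EFin \o G) _ _.
have h2 := @ge0_cvg_integral_halfline (fun x => (G x^-1 * x ^- 2)%:E) _ _.
suff E k : (\int[mu]_(x in A k) (EFin \o G) x =
            \int[mu]_(x in A k) (G x^-1 * x ^- 2)%:E)%E.
  apply: (cvg_unique _ (h1 _ _)) => //.
    by apply/measurable_EFinP; exact: continuous_measurable_halfline.
  rewrite (funext E); apply: h2.
    by apply/measurable_EFinP; exact: continuous_measurable_halfline.
  by move=> x x0; rewrite lee_fin mulr_ge0 ?invr_ge0 ?exprn_ge0 ?(ltW x0)//; apply: G0; rewrite invr_gt0.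
have kk : k.+1%:R^-1 <= k.+1%:R :> R by rewrite (@le_trans _ _ 1)// ?invf_le1 ?ler1n.
have pos (x : R) : k.+1%:R^-1 <= x -> 0 < x by apply: lt_le_trans; rewrite invr_gt0.
pose V (x : R) := x^-1.
have cVV (x : R) : 0 < x -> {for x, continuous V} by move=> x0; apply: inv_continuous; rewrite gt_eqF.
have dV (x : R) : 0 < x -> is_derive x 1 (V) (- x ^- 2).
  move=> x0; apply: is_derive_eq; first by apply: is_deriveV; rewrite gt_eqF.
  by rewrite scaler1.
have dVE (x : R) : 0 < x -> V^`()%classic x = - x ^- 2.
  by move=> /dV h; rewrite derive1E; exact: derive_val.
have cD (x : R) : 0 < x -> {for x, continuous V^`()%classic}.
  move=> x0; rewrite /prop_for /continuous_at dVE//.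
  have hN : - (y ^- 2) @[y --> x] --> - (x ^- 2) by apply: cvgN; exact: (cV2 x x0).
  apply: cvg_trans hN.
  apply: near_eq_cvg; near=> y; rewrite dVE//; near: y; exact: lt_nbhsr.
transitivity (\int[mu]_(x in (`[V k.+1%:R, V k.+1%:R^-1]%classic)%R) (G x)%:E)%E.
  by rewrite /A /V invrK.
rewrite (@integration_by_substitution_decreasing R V G k.+1%:R^-1 k.+1%:R kk).
- apply: eq_integral => x; rewrite inE/= in_itv/= => /andP[/pos x0 _].
  by rewrite !fctE /= dVE// opprK.
- move=> x y; rewrite !in_itv/= => /andP[/pos x0 _] /andP[/pos y0 _] xy.
  by rewrite ltf_pV2.
- by move=> x; rewrite in_itv/= => /andP[/ltW/pos x0 _]; exact: cD.
- by apply: cvgP; apply: cvg_at_right_filter; apply: cD; rewrite invr_gt0.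
- by apply: cvgP; apply: cvg_at_left_filter; exact: cD.
- split.
  + by move=> x; rewrite in_itv/= => /andP[/ltW/pos/dV[]].
  + by apply: cvg_at_right_filter; apply: cVV; rewrite invr_gt0.
  + by apply: cvg_at_left_filter; exact: cVV.
- apply: continuous_in_subspaceT => x; rewrite inE/= /V invrK in_itv/= => /andP[/pos x0 _].
  by apply: cG; rewrite in_itv/= x0.
Unshelve. all: end_near. Qed.

End halfline.

Section gamma.
Variable R : realType.
Notation mu := (@lebesgue_measure R).
Local Notation pR := (`]0%R, +oo[%classic : set R).
Implicit Types (b c : R).

Definition gamma_fun b (t : R) : R := t `^ (b - 1) * expR (- t).

Lemma continuous_powR_pos b (x : R) : 0 < x -> {for x, continuous (fun t : R => t `^ b)}.
Proof.
move=> x0; apply/differentiable_continuous/derivable1_diffP.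
by apply: derivable_powR; rewrite in_itv/= andbT.
Qed.

Lemma continuous_gamma_fun b : {in pR, continuous (gamma_fun b)}.
Proof.
move=> x; rewrite inE/= in_itv/= andbT => x0; apply: cvgM; first exact: continuous_powR_pos.
by apply: (@continuous_comp _ _ _ (@GRing.opp R) expR); [exact: oppr_continuous|exact: continuous_expR].
Qed.

Lemma gamma_fun_ge0 b t : 0 <= gamma_fun b t.
Proof. by rewrite mulr_ge0// ?powR_ge0 ?expR_ge0. Qed.

Lemma measurable_gamma_fun b : measurable_fun setT (gamma_fun b : measurableTypeR R -> measurableTypeR R).
Proof.
apply: measurable_funM; first exact: measurable_powR.
by apply: (measurableT_comp (@measurable_expR R)).
Qed.

Lemma expR_ge_powX (N : nat) (t : R) : 0 <= t -> t ^+ N <= N`!%:R * expR t.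
Proof.
case: N => [|N] t0; first by rewrite expr0 fact0 mul1r (le_trans _ (expR_ge1Dx t))// lerDl.
have := expR_ge1Dxn N t0; rewrite -ler_pdivrMl ?ltr0n ?fact_gt0//.
by apply: le_trans; rewrite mulrC lerDr.
Qed.

Lemma measurable_powR1D b : measurable_fun setT (fun t : measurableTypeR R => (1 + (t : R)) `^ b : measurableTypeR R).
Proof.
apply: (@measurableT_comp _ _ _ _ _ _ (@powR R ^~ b)); first exact: measurable_powR.
exact: measurable_funD.
Qed.

Lemma integral_powR_ratio b : 0 < b ->
  (\int[mu]_(t in pR) (t `^ (b - 1) * (1 + t) `^ (- b - 1))%:E = (b^-1)%:E)%E.
Proof.
move=> b0; pose F (t : R) := b^-1 * (t `^ b * (1 + t) `^ (- b)).
have c1 (a t : R) : 0 < 1 + t -> {for t, continuous (fun t : R => (1 + t) `^ a)}.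
  move=> t0; apply: (@continuous_comp _ _ _ (fun t : R => 1 + t) (@powR R ^~ a)).
    by apply: cvgD => //; exact: cvg_cst.
  exact: continuous_powR_pos.
transitivity ((b^-1 - 0)%:E); last by rewrite subr0.
apply: (@ge0_FTC_halfline R _ F 0 b^-1).
- move=> t; rewrite in_itv/= andbT => t0; apply: cvgM; first exact: continuous_powR_pos.
  by apply: c1; rewrite addr_gt0.
- by move=> t _; rewrite mulr_ge0 ?powR_ge0.
- move=> t t0; have t10 : 0 < 1 + t by rewrite addr_gt0.
  have h1 : is_derive t 1 (fun t : R => (1 + t) `^ (- b)) (- b * (1 + t) `^ (- b - 1)).
    have := @is_derive1_comp R (@powR R ^~ (- b)) (fun t : R => 1 + t) t _ 1 (is_derive1_powR (- b) t10) _.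
    rewrite mulr1; apply.
    by have := is_deriveD (is_derive_cst (1 : R) t 1) (is_derive_id t 1); rewrite add0r.
  have h2 := is_derive1_powR b t0.
  apply: is_derive_eq.
  rewrite !/GRing.scale/=.
  have -> : (1 + t) `^ (- b) = (1 + t) `^ (- b - 1) * (1 + t).
    by rewrite -[X in _ = _ * X]powRr1 ?ltW// -powRD ?(gt_eqF t10) ?implybT//; congr (_ `^ _); ring.
  have -> : t `^ b = t `^ (b - 1) * t.
    by rewrite -[X in _ = _ * X]powRr1 ?ltW// -powRD ?(gt_eqF t0) ?implybT//; congr (_ `^ _); ring.
  by field; rewrite gt_eqF.
- rewrite -[X in _ --> X]mulr1; apply: cvgM; first exact: cvg_cst.
  have h : (1 + t^-1) `^ (- b) @[t --> +oo] --> (1 : R).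
    rewrite [X in _ --> X](_ : 1 = (1 + 0) `^ (- b)); last by rewrite addr0 powR1.
    apply: (@cvg_comp _ _ _ (fun t : R => t^-1) (fun t : R => (1 + t) `^ (- b)) _ (nbhs (0 : R))).
      by apply/gtr0_cvgV0; [near=> t; near: t; exact: nbhs_pinfty_gt|exact: cvg_id].
    by apply: c1; rewrite addr0.
  apply: cvg_trans h; apply: near_eq_cvg; near=> t.
  have t0 : 0 < t by near: t; exact: nbhs_pinfty_gt.
  have -> : 1 + t = t * (1 + t^-1) by field; rewrite gt_eqF.
  rewrite powRM ?ltW// ?addr_gt0 ?invr_gt0// mulrA -powRD ?subrr ?powRr0 ?mul1r//.
  by rewrite (gt_eqF t0) implybT.
- rewrite [X in _ --> X](_ : 0 = b^-1 * (0 * 1)); last by rewrite mul0r mulr0.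
  apply: cvgM; first exact: cvg_cst.
  apply: cvgM; first exact: powR_cvg0.
  apply: cvg_at_right_filter; have := @c1 (- b) 0; rewrite addr0 => /(_ ltr01).
  by rewrite /prop_for /continuous_at/= addr0 powR1.
Unshelve. all: end_near. Qed.

(* The majorant t^(b-1) (1+t)^(-b-1) has the antiderivative b^-1 (t / (1+t))^b. *)
Lemma gamma_lty b : 0 < b -> (\int[mu]_(t in pR) (gamma_fun b t)%:E < +oo)%E.
Proof.
move=> b0; pose N := (Num.bound b).+2.
have tpos (t : R) : pR t -> 0 < t by rewrite /= in_itv/= andbT.
(* The bound t^N <= N! e^t is used at 1 + t, which produces the extra factor e. *)
pose C : R := N`!%:R * expR 1.
apply: (@le_lt_trans _ _ (\int[mu]_(t in pR) (C * (t `^ (b - 1) * (1 + t) `^ (- b - 1)))%:E)%E).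
  apply: ge0_le_integral => //.
  - by move=> t _; rewrite lee_fin gamma_fun_ge0.
  - by apply/measurable_EFinP; apply: measurable_funTS; exact: measurable_gamma_fun.
  - apply/measurable_EFinP; apply: measurable_funTS; apply: measurable_funM => //.
    apply: measurable_funM; first exact: measurable_powR.
    exact: measurable_powR1D.
  - move=> t /tpos t0; rewrite lee_fin mulrCA ler_wpM2l ?powR_ge0//.
    have t1 : 1 <= 1 + t by rewrite lerDl ltW.
    rewrite -opprD powRN ler_pdivlMr ?powR_gt0 ?(lt_le_trans _ t1)// expRN.
    rewrite mulrC ler_pdivrMr ?expR_gt0// /C -mulrA -expRD.
    apply: (le_trans _ (@expR_ge_powX N (1 + t) (le_trans ler01 t1))).
    rewrite -powR_mulrn ?(le_trans ler01 t1)//; apply: ler_powR => //.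
    rewrite /N -addn1 natrD lerD2r (@le_trans _ _ (Num.bound b)%:R)// ?ler_nat//.
    by apply: ltW; apply: archi_boundP; exact: ltW.
under eq_integral do rewrite EFinM.
rewrite ge0_integralZl_EFin//.
- by rewrite integral_powR_ratio// -EFinM ltry.
- by move=> t _; rewrite lee_fin mulr_ge0 ?powR_ge0.
- apply/measurable_EFinP; apply: measurable_funTS; apply: measurable_funM; first exact: measurable_powR.
  exact: measurable_powR1D.
- by rewrite mulr_ge0 ?expR_ge0.
Qed.

Lemma gammaE b : 0 < b -> (\int[mu]_(t in pR) (gamma_fun b t)%:E = (Gamma b)%:E)%E.
Proof.
move=> b0; rewrite /Gamma /Rintegral fineK// ge0_fin_numE ?gamma_lty//.
by apply: integral_ge0 => t _; rewrite lee_fin gamma_fun_ge0.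
Qed.

(** On [1,2] the integrand is at least e^(-2)/2, because t^(b-1) >= t^(-1) >= 1/2 there. *)
Lemma Gamma_gt0 b : 0 < b -> 0 < Gamma b.
Proof.
move=> b0; rewrite -lte_fin -gammaE//.
apply: (@lt_le_trans _ _ (\int[mu]_(t in `[1%R, 2%R]) (2^-1 * expR (-2))%:E)%E).
  rewrite integral_cst//= lebesgue_measure_itv/= lte_fin ltr1n/= -EFinB -EFinM lte_fin.
  by rewrite mulr_gt0 ?mulr_gt0 ?expR_gt0// subr_gt0 ltr1n.
apply: (@le_trans _ _ (\int[mu]_(t in `[1%R, 2%R]) (gamma_fun b t)%:E)%E).
  apply: ge0_le_integral => //.
  - by apply/measurable_EFinP; apply: measurable_funTS; exact: measurable_gamma_fun.
  - move=> t /=; rewrite in_itv/= => /andP[t1 t2]; rewrite lee_fin.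
    rewrite ler_pM ?expR_ge0//; last by rewrite ler_expR lerN2.
    apply: (@le_trans _ _ (t `^ (-1))).
      by rewrite powR_inv1 ?(le_trans ler01)// lef_pV2 ?posrE// (lt_le_trans ltr01).
    by apply: ler_powR => //; rewrite lerBrDr addrC subrr ltW.
apply: ge0_subset_integral => //.
- by apply/measurable_EFinP; apply: measurable_funTS; exact: measurable_gamma_fun.
- by move=> t _; rewrite lee_fin gamma_fun_ge0.
- by move=> t /=; rewrite !in_itv/= andbT => /andP[t1 _]; rewrite (lt_le_trans ltr01).
Qed.

Lemma integrable_gamma_fun b : 0 < b -> mu.-integrable pR (EFin \o gamma_fun b).
Proof.
move=> b0; apply/integrableP; split.
  by apply/measurable_EFinP; apply: measurable_funTS; exact: measurable_gamma_fun.
under eq_integral do rewrite /= ger0_norm ?gamma_fun_ge0//.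
exact: gamma_lty.
Qed.

Lemma cvg_powR_expRN b : t `^ b * expR (- t) @[t --> +oo%R] --> (0 : R).
Proof.
pose N := (Num.bound b).
have h : N.+1`!%:R * t^-1 @[t --> +oo%R] --> (0 : R).
  rewrite -[X in _ --> X](mulr0 N.+1`!%:R); apply: cvgM; first exact: cvg_cst.
  by apply/gtr0_cvgV0; [near=> t; near: t; exact: nbhs_pinfty_gt|exact: cvg_id].
apply: (@squeeze_cvgr _ _ _ _ (cst 0) _ _ _ _ _ h); last exact: cvg_cst.
near=> t; have t1 : 1 <= t by near: t; exact: nbhs_pinfty_ge.
have t0 : 0 < t by rewrite (lt_le_trans ltr01).
rewrite /= mulr_ge0 ?powR_ge0 ?expR_ge0//= expRN ler_pdivrMr ?expR_gt0//.
rewrite mulrAC ler_pdivlMr// (le_trans _ (@expR_ge_powX N.+1 t (ltW t0)))//.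
rewrite exprSr ler_pM2r// -powR_mulrn ?(ltW t0)//; apply: ler_powR => //.
have [b0|b0] := leP 0 b; first by apply: ltW; exact: archi_boundP.
by rewrite (le_trans (ltW b0)).
Unshelve. all: end_near. Qed.

(** The difference of the two integrands is the derivative of -t^b e^(-t), which tends to 0 at both
    ends of the half line. *)
Lemma GammaS b : 0 < b -> Gamma (b + 1) = b * Gamma b.
Proof.
move=> b0; have b10 : 0 < b + 1 by rewrite addr_gt0.
have i1 := integrable_gamma_fun b10; have i2 := integrable_gamma_fun b0.
have i3 : mu.-integrable pR (fun t => (b * gamma_fun b t)%:E).
  rewrite (_ : (fun t => _) = (fun t => b%:E * (EFin \o gamma_fun b) t)%E)//.
  exact: integrableZl.
apply/eqP; rewrite -subr_eq0; apply/eqP.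
apply: EFin_inj; rewrite EFinB EFinM -!gammaE//.
rewrite -integralZl// -integralB_EFin//.
pose F (t : R) := - (t `^ b * expR (- t)).
rewrite -[X in _ = X%:E](subrr (0 : R)).
apply: (@integrable_FTC_halfline R (fun t => gamma_fun (b + 1) t - b * gamma_fun b t) F 0 0).
- move=> t tp; apply: cvgB; first by apply: continuous_gamma_fun; rewrite inE.
  by apply: cvgM; [exact: cvg_cst|apply: continuous_gamma_fun; rewrite inE].
- rewrite (_ : EFin \o _ = (fun t => (gamma_fun (b + 1) t)%:E - (b * gamma_fun b t)%:E)%E)//.
  exact: integrableB.
- move=> t t0; have h2 := is_derive1_powR b t0.
  apply: is_derive_eq.
  rewrite /gamma_fun addrK /GRing.scale/=.
  by ring.
- by rewrite -oppr0; apply: cvgN; exact: cvg_powR_expRN.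
- rewrite -[X in _ --> X]oppr0 -[X in _ --> - X](mul0r (expR (- 0))); apply: cvgN; apply: cvgM; first exact: powR_cvg0.
  apply: cvg_at_right_filter.
  by apply: (@continuous_comp _ _ _ (@GRing.opp R) expR); [exact: oppr_continuous|exact: continuous_expR].
Qed.

Lemma ge0_integral_halfline_scale c (f : R -> \bar R) : 0 < c ->
  measurable_fun setT (f : measurableTypeR R -> \bar R) -> (forall t, 0 <= f t)%E ->
  (c%:E * \int[mu]_(t in pR) f (c * t)%R = \int[mu]_(t in pR) f t)%E.
Proof.
move=> c0 mf f0; rewrite [in RHS]integral_mkcond [in LHS]integral_mkcond.
rewrite -[RHS](@ge0_integral_affine R c 0)//.
- congr (_ * _)%E; apply: eq_integral => t _; rewrite !patchE addr0.
  rewrite (_ : (c * t \in pR) = (t \in pR))//.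
  by apply/idP/idP; rewrite !inE/= !in_itv/= !andbT pmulr_rgt0.
- by apply/(measurable_restrictT _ _).1 => //; exact: measurable_funTS.
- by move=> t; rewrite patchE; case: ifPn.
Qed.

Lemma integral_gamma_scale b c : 0 < b -> 0 < c ->
  (\int[mu]_(t in pR) (t `^ (b - 1) * expR (- (c * t)))%:E = (Gamma b * c `^ (- b))%:E)%E.
Proof.
move=> b0 c0.
have mf : measurable_fun setT (fun t : measurableTypeR R => (t : R) `^ (b - 1) * expR (- (c * t)) : measurableTypeR R).
  apply: measurable_funM; first exact: measurable_powR.
  by apply: (measurableT_comp (@measurable_expR R)); apply: measurableT_comp => //; exact: measurable_funM.
have mg : measurable_fun setT (fun t : measurableTypeR R => (gamma_fun b t)%:E).
  by apply/measurable_EFinP; exact: measurable_gamma_fun.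
have := ge0_integral_halfline_scale c0 mg (fun t => gamma_fun_ge0 b t : (0 <= (gamma_fun b t)%:E)%E).
rewrite gammaE// EFinM => <-.
have -> : (\int[mu]_(t in pR) (gamma_fun b (c * t))%:E =
  (c `^ (b - 1))%:E * \int[mu]_(t in pR) (t `^ (b - 1) * expR (- (c * t)))%:E)%E.
  rewrite -ge0_integralZl_EFin ?powR_ge0//.
  - apply: eq_integral => t; rewrite inE/= in_itv/= andbT => t0.
    by rewrite /gamma_fun powRM ?ltW// -EFinM mulrA.
  - by move=> t _; rewrite lee_fin mulr_ge0 ?powR_ge0 ?expR_ge0.
  - by apply/measurable_EFinP; exact: measurable_funTS.
rewrite muleC !muleA -!EFinM.
have -> : c `^ (- b) * c * c `^ (b - 1) = 1; last by rewrite mul1e.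
rewrite -[X in _ * X * _](powRr1 (ltW c0)) -!powRD ?(gt_eqF c0) ?implybT//.
by rewrite (_ : - b + 1 + (b - 1) = 0) ?powRr0//; ring.
Qed.

(** The form needed after a Fourier transform: the transformed Gaussian has exponent -|xi|^2/(4t),
    with t in the denominator. *)
Lemma integral_gamma_inv b c : 0 < b -> 0 < c ->
  (\int[mu]_(t in pR) (t `^ (- b - 1) * expR (- (c / t)))%:E = (Gamma b * c `^ (- b))%:E)%E.
Proof.
move=> b0 c0; rewrite -integral_gamma_scale// [RHS]ge0_integral_halfline_inv.
- apply: eq_integral => t; rewrite inE/= in_itv/= andbT => t0; congr EFin.
  rewrite mulrAC; congr (_ * _).
  rewrite -powR_inv1 ?ltW// -powRrM -(powR_invn 2) ?ltW// -powRD; last by rewrite (gt_eqF t0) implybT.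
  by congr (_ `^ _); ring.
- move=> x; rewrite in_itv/= andbT => x0; apply: cvgM; first exact: continuous_powR_pos.
  apply: (@continuous_comp _ _ _ (fun t : R => - (c * t)) expR); last exact: continuous_expR.
  by apply: cvgN; apply: cvgM => //; exact: cvg_cst.
- by move=> t _; rewrite mulr_ge0 ?powR_ge0 ?expR_ge0.
Qed.

End gamma.

(** * Integration by parts and Fourier transforms *)

Section line_derivative.
Variables (R : realType) (n : nat).
Implicit Types (f : 'rV[R]_n -> R) (x v : 'rV[R]_n) (h d : R).

Let line_quotient f x v h :
  (fun k : R => k^-1 *: ((f \o shift (h *: v + x)) (k *: v) - f (h *: v + x))) =
  (fun k : R => k^-1 *: (((fun k : R => f (k *: v + x)) \o shift h) (k *: (1 : R)) -
     f (h *: v + x))).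
Proof.
apply/funext => k /=; congr (_ *: (f _ - _)).
by rewrite addrA -scalerDl /GRing.scale/= mulr1.
Qed.

(** Directional derivatives reduce to one-variable derivatives along a line, which makes the
    one-variable chain rule and differentiation under the integral available. *)
Lemma is_derive_lineP f x v h d :
  is_derive (h *: v + x) v f d <-> is_derive h 1 (fun k : R => f (k *: v + x)) d.
Proof.
split => -[fd fE]; split.
- by move: fd; rewrite /derivable line_quotient.
- by rewrite -fE /derive line_quotient.
- by rewrite /derivable line_quotient.
- by rewrite -fE [LHS]/derive line_quotient.
Qed.

Lemma is_derive_line0 f x v d :
  is_derive (0 : R) 1 (fun k : R => f (k *: v + x)) d -> is_derive x v f d.
Proof. by move/is_derive_lineP; rewrite scale0r add0r. Qed.

End line_derivative.

Section rapid_lemmas.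
Variables (R : realType) (n : nat).
Implicit Types (u v : 'rV[R]_n -> R).

Lemma onePenorm_ge1 (x : 'rV[R]_n) : 1 <= 1 + enorm x.
Proof. by rewrite lerDl enorm_ge0. Qed.

Lemma rapid_le u v (C : R) (k : nat) : rapid u ->
  (forall x, `|v x| <= C * (1 + enorm x) ^+ k * `|u x|) -> rapid v.
Proof.
move=> ru vu N; have [M hM] := ru (N + k)%N; exists (`|C| * M) => x.
have N0 : 0 <= (1 + enorm x) ^+ N by rewrite exprn_ge0// ltW// onePenorm_gt0.
rewrite (le_trans (ler_wpM2l N0 (vu x)))//.
rewrite -!mulrA mulrCA.
rewrite (@le_trans _ _ (`|C| * ((1 + enorm x) ^+ N * ((1 + enorm x) ^+ k * `|u x|))))//.
  by rewrite ler_wpM2r ?ler_norm// !mulr_ge0// exprn_ge0// ltW// onePenorm_gt0.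
by rewrite ler_wpM2l// mulrA -exprD.
Qed.

Lemma rapidD u v : rapid u -> rapid v -> rapid (fun x => u x + v x).
Proof.
move=> ru rv N; have [M hM] := ru N; have [M' hM'] := rv N; exists (M + M') => x.
rewrite (le_trans _ (lerD (hM x) (hM' x)))// -mulrDr ler_wpM2l ?ler_normD//.
by rewrite exprn_ge0// ltW// onePenorm_gt0.
Qed.

End rapid_lemmas.

Lemma dotrBB (R : realType) n (y z : 'rV[R]_n) :
  dotr (y - z) (y - z) = dotr y y - 2 * dotr y z + dotr z z.
Proof.
rewrite /dotr mulr_sumr -sumrB -big_split /=; apply: eq_bigr => i _.
by rewrite !mxE; ring.
Qed.

Section integration_by_parts.
Variables (R : realType) (n : nat) (i : 'I_n).
Notation lam := (lebesgue_rV R n).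
Notation ei := (delta_mx ord0 i : 'rV[R]_n).

(** The triangle inequality for a displacement along one axis, proved by squaring; it makes the
    domination in the next lemma uniform in h. *)
Lemma enorm_line (x : 'rV[R]_n) (h : R) : `|h| <= 1 ->
  enorm x <= 1 + enorm (h *: ei + x).
Proof.
move=> h1; set y := h *: ei + x.
have y0 := enorm_ge0 y.
rewrite -(@ler_pXn2r _ 2) ?nnegrE ?enorm_ge0 ?addr_ge0//.
have -> : x = y - h *: ei by rewrite /y addrAC subrr add0r.
have De z : dotr z ei = z ord0 i.
  rewrite /dotr (bigD1 i)//= big1 ?addr0 ?mxE ?eqxx ?mulr1// => j ji.
  by rewrite mxE (negbTE ji) andbF mulr0.
have D1 : dotr y (h *: ei) = h * y ord0 i by rewrite dotrC dotrZ dotrC De.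
have D2 : dotr (h *: ei) (h *: ei) = h * h.
  by rewrite dotrZ dotrC De !mxE !eqxx mulr1.
rewrite sqr_enorm dotrBB D1 D2 -sqr_enorm.
have hy : `|h * y ord0 i| <= enorm y.
  by rewrite normrM -[leRHS]mul1r ler_pM// coord_le_enorm.
have hh : h * h <= 1 by rewrite -expr2 -real_normK ?num_real// exprn_ile1.
have := lerNnormlW hy.
set a := h * y ord0 i; set b := enorm y => H.
nra.
Qed.

(* The integral of u (x + h e_i) does not depend on h: differentiate it at 0. *)
Lemma Rintegral_partial (u u' : 'rV[R]_n -> R) :
  measurable_fun setT (u : _ -> measurableTypeR R) ->
  (forall x, is_derive x ei u (u' x)) ->
  rapid u -> rapid u' -> \int[lam]_x u' x = 0.
Proof.
move=> mu du ru ru'.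
pose f (h : R) (x : 'rV[R]_n) := u (h *: ei + x).
have dfE (h : R) x : is_derive h 1 (f^~ x) (u' (h *: ei + x)).
  by apply/is_derive_lineP; exact: du.
have [M hM] := ru' n.*2.
have M0 : 0 <= M by rewrite (le_trans _ (hM 0))// mulr_ge0// exprn_ge0// ltW// onePenorm_gt0.
(* For |h| <= 1 one has 1 + |x| <= 2 (1 + |x + h e_i|), which costs the factor 2^(2n). *)
pose G (x : 'rV[R]_n) := (2 ^+ n.*2 * M) * rV_weight x.
have I0 : `](-1), 1[%classic (0 : R) by rewrite /= in_itv/= ltrN10 ltr01.
have iu : lam.-integrable setT (fun x => (u x)%:E) by exact: rapid_integrable.
have Ff h : \int[lam]_x f h x = \int[lam]_x u x.
  rewrite -(@Rintegral_rV_shift R n (h *: ei) u mu).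
  by apply: eq_Rintegral => x _; rewrite /f addrC.
have := @differentiation_under_integral R _ _ lam f setT measurableT 0 (-1) 1 I0 _ _ G _ _ _.
rewrite (_ : (fun x' => _) = cst (\int[lam]_x u x)); last by apply/funext => h; exact: Ff.
rewrite derive1_cst => ->.
- by apply: eq_Rintegral => x _; rewrite partial1of2E (@derive_val _ _ _ _ _ _ _ (dfE 0 x)) scale0r add0r.
- move=> h _; rewrite (_ : EFin \o f h = fun x => (u (x + h *: ei))%:E); last first.
    by apply/funext => x; rewrite /f /= addrC.
  by apply/(@integrable_rV_shift R n (h *: ei) u mu).
- by move=> h x _ _; have [] := dfE h x.
- by move=> x; rewrite !mulr_ge0// rV_weight_ge0.
- by apply: integrableZR; exact: integrable_rV_weight.
- move=> h x; rewrite /= in_itv/= => /andP[h1 h2] _.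
  rewrite partial1of2E (@derive_val _ _ _ _ _ _ _ (dfE h x)).
  rewrite /G /rV_weight ler_pdivlMr ?exprn_gt0 ?onePenorm_gt0//.
  have P : 2 ^+ n.*2 * ((1 + enorm (h *: ei + x)) ^+ n.*2 * `|u' (h *: ei + x)|) <= 2 ^+ n.*2 * M.
    by rewrite ler_wpM2l// exprn_ge0.
  apply: le_trans P; rewrite mulrC.
  rewrite mulrA ler_wpM2r// -exprMn; apply: lerXn2r; rewrite ?nnegrE.
  + by rewrite ltW// onePenorm_gt0.
  + by rewrite mulr_ge0// ltW// onePenorm_gt0.
  + have := @enorm_line x h; rewrite ler_norml (ltW h1) (ltW h2) => /(_ isT).
    have := enorm_ge0 (h *: ei + x); lra.
Qed.

End integration_by_parts.

Section cis.
Variable R : realType.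

Definition cis (a : R) : R[i] := cos a +i* sin a.

Lemma normc_cis a : normc (cis a) = 1.
Proof. by rewrite /= cos2Dsin2 sqrtr1. Qed.

Lemma cisD a b : cis (a + b) = cis a * cis b.
Proof. by apply: complex_ext; rewrite ?Re_mul ?Im_mul/= ?cosD ?sinD// addrC. Qed.

Lemma cisN a : cis (- a) = cos a -i* sin a.
Proof. by rewrite /cis cosN sinN. Qed.

Lemma cmeasurable_cis d (T : measurableType d) (f : T -> R) :
  measurable_fun setT (f : T -> measurableTypeR R) -> cmeasurable (fun x => cis (f x)).
Proof.
move=> mf; split.
  apply: (@measurableT_comp _ _ _ _ _ _ (@cos R)) => //.
  by apply: continuous_measurable_fun; exact: continuous_cos.
apply: (@measurableT_comp _ _ _ _ _ _ (@sin R)) => //.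
by apply: continuous_measurable_fun; exact: continuous_sin.
Qed.

End cis.

Section ft.
Variables (R : realType) (n : nat).
Notation lam := (lebesgue_rV R n).
Implicit Types (w : 'rV[R]_n -> R[i]) (xi x y : 'rV[R]_n).

(** The sign in the exponent is opposite to that of [fourier]; both signs occur when a product of
    transforms is moved under one integral. *)
Definition ft w xi : R[i] := cintegral lam setT (fun x => w x * cis (dotr x xi)).

Lemma fourierE w xi : fourier w xi = ft w (- xi).
Proof.
by apply: eq_cintegral => x; rewrite (dotrC x (- xi)) dotrN (dotrC xi) cisN mulrC.
Qed.

Definition crapid w := rapid (fun x => normc (w x)).

Definition cderive (i : 'I_n) w w' := forall x,
  is_derive x (delta_mx ord0 i) (fun x => Re (w x)) (Re (w' x)) /\
  is_derive x (delta_mx ord0 i) (fun x => Im (w x)) (Im (w' x)).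

Lemma crapid_Re w : crapid w -> rapid (fun x => Re (w x)).
Proof.
move=> rw; apply: (@rapid_le _ _ _ _ 1 0 rw) => x.
by rewrite expr0 !mul1r (le_trans (normc_Re _))// ler_norm.
Qed.

Lemma crapid_Im w : crapid w -> rapid (fun x => Im (w x)).
Proof.
move=> rw; apply: (@rapid_le _ _ _ _ 1 0 rw) => x.
by rewrite expr0 !mul1r (le_trans (normc_Im _))// ler_norm.
Qed.

Lemma crapid_cintegrable w : cmeasurable w -> crapid w -> cintegrable lam w.
Proof.
move=> mw rw; apply: (@cintegrable_le _ _ _ _ _ (fun x => normc (w x))) => //.
by apply: rapid_integrable => //; exact: cmeasurable_normc.
Qed.

Lemma crapid_le w w' (C : R) (k : nat) : crapid w ->
  (forall x, normc (w' x) <= C * (1 + enorm x) ^+ k * normc (w x)) -> crapid w'.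
Proof.
move=> rw h; apply: (rapid_le rw) => x; rewrite !ger0_norm ?normc_ge0//; exact: h.
Qed.

Lemma crapidD w w' : crapid w -> crapid w' -> crapid (fun x => w x + w' x).
Proof.
move=> rw rw'; apply: (@rapid_le _ _ _ _ 1 0 (rapidD rw rw')) => x.
rewrite expr0 !mul1r !ger0_norm ?normc_ge0 ?addr_ge0 ?normc_ge0//.
exact: le_normcD.
Qed.

Lemma cintegral_partial i w w' : cmeasurable w -> cderive i w w' ->
  crapid w -> crapid w' -> cintegral lam setT w' = 0.
Proof.
move=> [m1 m2] dw rw rw'; apply: complex_ext => /=.
  apply: (@Rintegral_partial _ _ i _ _ m1 _ (crapid_Re rw) (crapid_Re rw')).
  by move=> x; have [] := dw x.
apply: (@Rintegral_partial _ _ i _ _ m2 _ (crapid_Im rw) (crapid_Im rw')).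
by move=> x; have [] := dw x.
Qed.

Lemma cderiveM i w1 w1' w2 w2' : cderive i w1 w1' -> cderive i w2 w2' ->
  cderive i (fun x => w1 x * w2 x) (fun x => w1' x * w2 x + w1 x * w2' x).
Proof.
move=> d1 d2 x; have [a1 b1] := d1 x; have [a2 b2] := d2 x.
split.
  under eq_fun do rewrite Re_mul.
  apply: is_derive_eq.
  by rewrite Re_add !Re_mul /GRing.scale/=; ring.
under eq_fun do rewrite Im_mul.
apply: is_derive_eq.
by rewrite Im_add !Im_mul /GRing.scale/=; ring.
Qed.

Lemma is_derive_coord (v x : 'rV[R]_n) j : is_derive x v (fun x => x ord0 j) (v ord0 j).
Proof.
apply: is_derive_line0.
have -> : (fun k : R => (k *: v + x) ord0 j) = (fun k : R => k * v ord0 j + x ord0 j).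
  by apply/funext => k; rewrite !mxE.
apply: is_derive_eq.
by rewrite addr0 scaler0 add0r /GRing.scale/= mulr1.
Qed.

Lemma is_derive_dotr (x xi : 'rV[R]_n) i :
  is_derive x (delta_mx ord0 i) (fun x => dotr x xi) (xi ord0 i).
Proof.
rewrite (_ : (fun x => _) = \sum_(j < n) (fun x : 'rV[R]_n => x ord0 j * xi ord0 j)); last first.
  by apply/funext => y; rewrite fct_sumE.
have h j : is_derive x (delta_mx ord0 i) (fun x : 'rV[R]_n => x ord0 j * xi ord0 j)
    ((i == j)%:R * xi ord0 j).
  have h := is_derive_coord (delta_mx ord0 i) x j.
  apply: is_derive_eq.
  by rewrite scaler0 add0r mxE eqxx /= /GRing.scale/= mulrC eq_sym.
have := is_derive_sum (h := fun j => fun x : 'rV[R]_n => x ord0 j * xi ord0 j) h.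
have -> // : \sum_(j < n) (i == j)%:R * xi ord0 j = xi ord0 i.
rewrite (bigD1 i)//= eqxx mul1r big1 ?addr0// => j ji.
by rewrite eq_sym (negbTE ji) mul0r.
Qed.

Lemma is_derive_comp_rV (g : R -> R) (f : 'rV[R]_n -> R) x v (dg df : R) :
  is_derive (f x) 1 g dg -> is_derive x v f df ->
  is_derive x v (fun y => g (f y)) (dg * df).
Proof.
move=> hg hf; apply: is_derive_line0.
apply: (@is_derive1_comp R g (fun k : R => f (k *: v + x)) 0).
  by rewrite scale0r add0r.
by apply/is_derive_lineP; rewrite scale0r add0r.
Qed.

Lemma cderive_cis i xi :
  cderive i (fun x => cis (dotr x xi)) (fun x => 'i * (xi ord0 i)%:C * cis (dotr x xi)).
Proof.
move=> x; have h := is_derive_dotr x xi i; split => /=.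
  have := @is_derive_comp_rV (@cos R) (fun x => dotr x xi) x _ _ _ (is_derive_cos (dotr x xi)) h.
  by move=> hh; apply: (@is_derive_eq _ _ _ _ _ _ _ _ hh); ring.
have := @is_derive_comp_rV (@sin R) (fun x => dotr x xi) x _ _ _ (is_derive_sin (dotr x xi)) h.
by move=> hh; apply: (@is_derive_eq _ _ _ _ _ _ _ _ hh); ring.
Qed.

Lemma cmeasurable_cis_dotr xi : cmeasurable (fun x => cis (dotr x xi)).
Proof. by apply: cmeasurable_cis; exact: measurable_dotr. Qed.

Lemma crapid_cis w xi : crapid w -> crapid (fun x => w x * cis (dotr x xi)).
Proof.
move=> rw; apply: (@crapid_le _ _ 1 0 rw) => x.
by rewrite Normc.normcM normc_cis expr0 !mul1r mulr1.
Qed.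

Lemma cintegrable_cis w xi : cintegrable lam w ->
  cintegrable lam (fun x => w x * cis (dotr x xi)).
Proof.
move=> iw; under eq_fun do rewrite mulrC.
apply: (@cintegrable_bounded _ _ _ _ _ _ 1) => //.
  exact: cmeasurable_cis_dotr.
by move=> x; rewrite normc_cis.
Qed.

(** The derivative of w times the oscillating exponential has integral zero; expanding it by the
    product rule gives the formula. *)
Lemma ft_partial i w w' xi : cmeasurable w -> cmeasurable w' -> cderive i w w' ->
  crapid w -> crapid w' -> ft w' xi = - ('i * (xi ord0 i)%:C) * ft w xi.
Proof.
move=> mw mw' dw rw rw'.
have iw := cintegrable_cis xi (crapid_cintegrable mw rw).
have iw' := cintegrable_cis xi (crapid_cintegrable mw' rw').
have d := cderiveM dw (cderive_cis i xi).
have := @cintegral_partial i _ _ _ d (crapid_cis xi rw) _.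
have E x : w' x * cis (dotr x xi) + w x * ('i * (xi ord0 i)%:C * cis (dotr x xi)) =
  w' x * cis (dotr x xi) + 'i * (xi ord0 i)%:C * (w x * cis (dotr x xi)) by rewrite mulrCA.
rewrite (eq_cintegral _ E) cintegralD// ?cintegralZ//; last exact: cintegrableZ.
move=> h; rewrite mulNr; apply/eqP; rewrite -addr_eq0; apply/eqP; apply: h.
  by apply: cmeasurableM => //; exact: cmeasurable_cis_dotr.
apply: crapidD; first exact: crapid_cis.
apply: (@crapid_le w _ `|xi ord0 i| 0 rw) => x.
rewrite !Normc.normcM normc_cis normc_real expr0 !mulr1 /=.
by rewrite expr0n expr1n add0r sqrtr1 mul1r mulrC.
Qed.

Lemma le_normc_ft w xi : cintegrable lam w ->
  normc (ft w xi) <= 2 * \int[lam]_x normc (w x).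
Proof.
move=> iw; apply: le_normc_cintegral.
- by have := cintegrable_cmeasurable (cintegrable_cis xi iw).
- by move=> x; rewrite Normc.normcM normc_cis mulr1.
- exact: integrable_normc.
Qed.

End ft.

(** * Transforms of Schwartz functions *)

Section schwartz_lemmas.
Variables (R : realType) (n : nat) (phi : 'rV[R]_n -> R[i]).
Hypothesis hphi : schwartz phi.
Notation lam := (lebesgue_rV R n).

Lemma schwartz_crapid l : crapid (cpartials l phi).
Proof.
move=> N; have [M hM] := hphi.2 l N; exists M => x.
by rewrite ger0_norm ?normc_ge0//; exact: hM.
Qed.

Lemma schwartz_cmeasurable l : cmeasurable (cpartials l phi).
Proof. by have [c1 c2 _] := hphi.1 l; split; exact: continuous_measurable_rV. Qed.

Lemma schwartz_cintegrable : cintegrable lam phi.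
Proof.
apply: crapid_cintegrable; first exact: (schwartz_cmeasurable [::]).
exact: (schwartz_crapid [::]).
Qed.

Lemma schwartz_cderive i l : cderive i (cpartials l phi) (cpartials (i :: l) phi).
Proof.
move=> x; have [_ _ /(_ i x)[d1 d2]] := hphi.1 l.
by split => /=; exact: derivableP.
Qed.

Lemma ft_cpartials l xi :
  ft (cpartials l phi) xi = (\prod_(i <- l) - ('i * (xi ord0 i)%:C)) * ft phi xi.
Proof.
elim: l => [|i l IH]; first by rewrite big_nil mul1r.
rewrite big_cons -mulrA -IH; apply: ft_partial.
- exact: schwartz_cmeasurable.
- exact: schwartz_cmeasurable.
- exact: schwartz_cderive.
- exact: schwartz_crapid.
- exact: schwartz_crapid.
Qed.

(** Every factor 1 + xi_i^2 is absorbed at the price of two more derivatives of phi, and the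
    transforms of all derivatives are bounded. *)
Lemma ft_decay : exists C : R, forall xi,
  normc (ft phi xi) <= C * \prod_(i < n) (oneDsqr (xi ord0 i))^-1.
Proof.
(* The induction on r carries an arbitrary list l of extra factors |xi_i|, since splitting 1 +
   xi_i^2 calls the hypothesis at l and at l with i added twice. *)
suff h (r : seq 'I_n) : forall l : seq 'I_n, exists C : R, forall xi : 'rV[R]_n,
    (\prod_(i <- r) oneDsqr (xi ord0 i)) * (\prod_(i <- l) `|xi ord0 i|) * normc (ft phi xi) <= C.
  have [C hC] := h (index_enum _) [::]; exists C => xi.
  rewrite prodfV ler_pdivlMr; last by apply: prodr_gt0 => i _; rewrite ltr_pwDl// sqr_ge0.
  by have := hC xi; rewrite big_nil mulr1 mulrC.
elim: r => [l|i r IH l].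
  exists (2 * \int[lam]_x normc (cpartials l phi x)) => xi.
  rewrite big_nil mul1r.
  have := le_normc_ft xi (crapid_cintegrable (schwartz_cmeasurable l) (schwartz_crapid l)).
  rewrite ft_cpartials Normc.normcM; congr (_ * _ <= _).
  elim: l => [|i l IH]; first by rewrite !big_nil Normc.normc1.
  rewrite !big_cons Normc.normcM IH; congr (_ * _).
  by rewrite normcN Normc.normcM normc_real /= expr0n expr1n add0r sqrtr1 mul1r.
have [C1 h1] := IH l; have [C2 h2] := IH [:: i, i & l].
exists (C1 + C2) => xi; rewrite (le_trans _ (lerD (h1 xi) (h2 xi)))//.
rewrite !big_cons {1}/oneDsqr.
rewrite le_eqVlt; apply/orP; left; apply/eqP.
rewrite -(real_normK (num_real (xi ord0 i))).
ring.
Qed.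

Lemma cmeasurable_ft w : cmeasurable w -> cmeasurable (@ft R n w).
Proof.
move=> mw.
apply: (@cmeasurable_prod _ _ _ _ _ lam (fun p : 'rV[R]_n * 'rV[R]_n => w p.2 * cis (dotr p.2 p.1))).
apply: cmeasurableM; first exact: (cmeasurable_comp mw measurable_snd).
apply: cmeasurable_cis; apply: measurable_sum => i; apply: measurable_funM.
  exact: (measurableT_comp (@measurable_coord _ _ _) measurable_snd).
exact: (measurableT_comp (@measurable_coord _ _ _) measurable_fst).
Qed.

End schwartz_lemmas.

(** * Gaussian moments *)

(** Keeping the imaginary unit inside the coordinate gives all Gaussian moments positive real
    coefficients. *)
Definition ixi (R : realType) n (xi : 'rV[R]_n) i : R[i] := 'i * (xi ord0 i)%:C.

Definition kron (R : realType) n (i j : 'I_n) : R[i] := (i == j)%:R.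

Section gaussian.
Variables (R : realType) (n : nat) (t : R).
Hypothesis t0 : 0 < t.
Notation lam := (lebesgue_rV R n).
Implicit Types (p : 'rV[R]_n -> R) (x y xi : 'rV[R]_n).

Definition gaussian y : R := expR (- (t * dotr y y)).

Lemma gaussian_ge0 y : 0 <= gaussian y. Proof. exact: expR_ge0. Qed.

Lemma measurable_dotrr : measurable_fun setT (fun y : 'rV[R]_n => dotr y y : measurableTypeR R).
Proof.
by apply: measurable_sum => i; apply: measurable_funM; exact: measurable_coord.
Qed.

Lemma measurable_gaussian : measurable_fun setT (gaussian : _ -> measurableTypeR R).
Proof.
apply: (measurableT_comp (@measurable_expR R)); apply: measurableT_comp => //.
by apply: measurable_funM => //; exact: measurable_dotrr.
Qed.

Lemma rapid_gaussian : rapid gaussian.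
Proof.
(* With r = |y|, (1+r)^N <= N! e^(1+r), and completing the square gives r - t r^2 <= 1/(4t). *)
move=> N; exists (N`!%:R * expR (1 + (4 * t)^-1)) => y.
rewrite ger0_norm ?gaussian_ge0// /gaussian -sqr_enorm expRN ler_pdivrMr ?expR_gt0//.
have r0 := enorm_ge0 y.
rewrite (le_trans (@expR_ge_powX R N (1 + enorm y) _))// ?addr_ge0//.
rewrite -mulrA ler_wpM2l// -expRD ler_expR -addrA lerD2l.
rewrite -subr_ge0 (_ : _ - _ = t * (enorm y - (2 * t)^-1) ^+ 2); last first.
  by field; rewrite gt_eqF.
by rewrite mulr_ge0 ?sqr_ge0// ltW.
Qed.

Lemma is_derive_gaussian i x :
  is_derive x (delta_mx ord0 i) gaussian (- (2 * t) * x ord0 i * gaussian x).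
Proof.
have h : is_derive x (delta_mx ord0 i) (fun y => dotr y y) (2 * x ord0 i).
  rewrite (_ : (fun y => _) = \sum_(j < n) (fun y : 'rV[R]_n => y ord0 j * y ord0 j)); last first.
    by apply/funext => y; rewrite fct_sumE.
  have h j : is_derive x (delta_mx ord0 i) (fun y : 'rV[R]_n => y ord0 j * y ord0 j)
      ((i == j)%:R * (2 * x ord0 j)).
    have hj := is_derive_coord (delta_mx ord0 i) x j.
    apply: is_derive_eq.
    by rewrite mxE eqxx /= /GRing.scale/= eq_sym; ring.
  have := is_derive_sum (h := fun j => fun y : 'rV[R]_n => y ord0 j * y ord0 j) h.
  have -> // : \sum_(j < n) (i == j)%:R * (2 * x ord0 j) = 2 * x ord0 i.
  rewrite (bigD1 i)//= eqxx mul1r big1 ?addr0// => j ji.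
  by rewrite eq_sym (negbTE ji) mul0r.
have h2 : is_derive x (delta_mx ord0 i) (fun y => - (t * dotr y y)) (- (t * (2 * x ord0 i))).
  by apply: is_derive_eq.
have := @is_derive_comp_rV R n expR (fun y => - (t * dotr y y)) x _ _ _ (is_derive_expR _) h2.
by move=> hh; apply: (@is_derive_eq _ _ _ _ _ _ _ _ hh); rewrite /gaussian; ring.
Qed.

Definition polybounded p := exists C k, forall y, `|p y| <= C * (1 + enorm y) ^+ k.

Lemma rapid_pgaussian p : polybounded p -> rapid (fun y => p y * gaussian y).
Proof.
move=> [C [k hp]]; apply: (rapid_le (C := C) (k := k) rapid_gaussian) => y.
by rewrite normrM ler_wpM2r.
Qed.

Lemma polyboundedM p1 p2 : polybounded p1 -> polybounded p2 ->
  polybounded (fun y => p1 y * p2 y).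
Proof.
move=> [C1 [k1 h1]] [C2 [k2 h2]]; exists (C1 * C2), (k1 + k2)%N => y.
by rewrite normrM exprD mulrACA ler_pM.
Qed.

Lemma polyboundedD p1 p2 : polybounded p1 -> polybounded p2 ->
  polybounded (fun y => p1 y + p2 y).
Proof.
move=> [C1 [k1 h1]] [C2 [k2 h2]]; exists (`|C1| + `|C2|), (k1 + k2)%N => y.
rewrite (le_trans (ler_normD _ _))// mulrDl lerD//.
  rewrite (le_trans (h1 y))// exprD mulrA (le_trans (ler_wpM2r _ (ler_norm C1)))//.
    by rewrite exprn_ge0// ltW// onePenorm_gt0.
  by rewrite ler_peMr ?exprn_ege1 ?onePenorm_ge1// mulr_ge0// exprn_ge0// ltW// onePenorm_gt0.
rewrite (le_trans (h2 y))// exprD mulrCA (le_trans (ler_wpM2r _ (ler_norm C2)))//.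
  by rewrite exprn_ge0// ltW// onePenorm_gt0.
by rewrite ler_peMl ?exprn_ege1 ?onePenorm_ge1// mulr_ge0// exprn_ge0// ltW// onePenorm_gt0.
Qed.

Lemma polybounded_cst (a : R) : polybounded (fun=> a).
Proof. by exists `|a|, 0%N => y; rewrite expr0 mulr1. Qed.

Lemma polybounded_coord j : polybounded (fun y => y ord0 j).
Proof.
by exists 1, 1%N => y; rewrite mul1r expr1 (le_trans (coord_le_enorm _ _))// lerDr.
Qed.

Definition gmoment p xi : R[i] := ft (fun y => (p y * gaussian y)%:C) xi.

Lemma cmeasurable_pgaussian p : measurable_fun setT (p : _ -> measurableTypeR R) ->
  cmeasurable (fun y => (p y * gaussian y)%:C).
Proof.
move=> mp; apply: cmeasurable_real; apply: measurable_funM => //.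
exact: measurable_gaussian.
Qed.

Lemma crapid_real (u : 'rV[R]_n -> R) : rapid u -> crapid (fun y => (u y)%:C).
Proof.
move=> ru; apply: (rapid_le (C := 1) (k := 0) ru) => y.
by rewrite normc_real normr_id expr0 !mul1r.
Qed.

Lemma crapid_pgaussian p : polybounded p -> crapid (fun y => (p y * gaussian y)%:C).
Proof. by move=> bp; apply: crapid_real; exact: rapid_pgaussian. Qed.

Lemma pgaussian_cintegrable p : measurable_fun setT (p : _ -> measurableTypeR R) ->
  polybounded p -> cintegrable lam (fun y => (p y * gaussian y)%:C).
Proof.
move=> mp bp; apply: crapid_cintegrable; first exact: cmeasurable_pgaussian.
exact: crapid_pgaussian.
Qed.

Lemma gmomentD p1 p2 xi :
  measurable_fun setT (p1 : _ -> measurableTypeR R) -> polybounded p1 ->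
  measurable_fun setT (p2 : _ -> measurableTypeR R) -> polybounded p2 ->
  gmoment (fun y => p1 y + p2 y) xi = gmoment p1 xi + gmoment p2 xi.
Proof.
move=> m1 b1 m2 b2; rewrite /gmoment /ft -cintegralD.
- by apply: eq_cintegral => y; rewrite -mulrDl -rmorphD/= mulrDl.
- by apply: cintegrable_cis; exact: pgaussian_cintegrable.
- by apply: cintegrable_cis; exact: pgaussian_cintegrable.
Qed.

Lemma gmomentZ (a : R) p xi :
  measurable_fun setT (p : _ -> measurableTypeR R) -> polybounded p ->
  gmoment (fun y => a * p y) xi = a%:C * gmoment p xi.
Proof.
move=> m1 b1; rewrite /gmoment /ft -cintegralZ.
  by apply: eq_cintegral => y; rewrite mulrA -rmorphM/= mulrA.
by apply: cintegrable_cis; exact: pgaussian_cintegrable.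
Qed.

Definition has_partial i p p' :=
  forall x, is_derive x (delta_mx ord0 i) p (p' x).

(* Integration by parts, since y_i e^(-t|y|^2) is -1/(2t) times a partial derivative. *)
Lemma gmoment_rec i p p' xi :
  measurable_fun setT (p : _ -> measurableTypeR R) -> polybounded p ->
  measurable_fun setT (p' : _ -> measurableTypeR R) -> polybounded p' ->
  has_partial i p p' ->
  gmoment (fun y => y ord0 i * p y) xi =
  ((2 * t)^-1)%:C * (gmoment p' xi + 'i * (xi ord0 i)%:C * gmoment p xi).
Proof.
move=> mp bp mp' bp' dp.
have mi := @measurable_coord R n i.
have mip : measurable_fun setT (fun y => y ord0 i * p y : measurableTypeR R) by exact: measurable_funM.
have bip := polyboundedM (polybounded_coord i) bp.
have mw : measurable_fun setT (fun y => p' y + - (2 * t) * (y ord0 i * p y) : measurableTypeR R).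
  by apply: measurable_funD => //; exact: measurable_funM.
have bw : polybounded (fun y => p' y + - (2 * t) * (y ord0 i * p y)).
  by apply: polyboundedD => //; apply: polyboundedM => //; exact: polybounded_cst.
have := @ft_partial R n i (fun y => (p y * gaussian y)%:C)
  (fun y => ((p' y + - (2 * t) * (y ord0 i * p y)) * gaussian y)%:C) xi
  (cmeasurable_pgaussian mp) (cmeasurable_pgaussian mw) _ (crapid_pgaussian bp) (crapid_pgaussian bw).
rewrite -/(gmoment _ _) -/(gmoment p _) gmomentD//; last 2 first.
- by apply: measurable_funM.
- by apply: polyboundedM => //; exact: polybounded_cst.
rewrite gmomentZ// => h.
have {}h : gmoment p' xi + (- (2 * t))%:C * gmoment (fun y => y ord0 i * p y) xi =
    - ('i * (xi ord0 i)%:C) * gmoment p xi.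
  apply: h => x; split => /=; last exact: is_derive_cst.
  have h1 := dp x; have h2 := is_derive_gaussian i x.
  by apply: is_derive_eq; rewrite /GRing.scale/=; ring.
have tn0 : (2 * t)%:C != 0 :> R[i].
  by rewrite (inj_eq (@complexI R)) gt_eqF// mulr_gt0.
rewrite fmorphV; apply: (mulfI tn0); rewrite mulVKf//.
move: h; rewrite rmorphN mulNr => /eqP; rewrite subr_eq => /eqP ->.
by rewrite mulNr addrAC addNr add0r.
Qed.

Local Notation q := (((2 * t)^-1)%:C : R[i]).
Local Notation E := (gmoment (fun=> 1)).

Lemma gmoment0 xi : gmoment (fun=> 0) xi = 0.
Proof.
rewrite /gmoment /ft (@eq_cintegral _ _ _ _ _ (fun=> (0 : R)%:C)).
  by rewrite cintegral_real /Rintegral integral0.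
by move=> y; rewrite !mul0r.
Qed.

Lemma is_derive_coord_delta i j x :
  is_derive x (delta_mx ord0 i) (fun y : 'rV[R]_n => y ord0 j) ((i == j)%:R).
Proof.
by have := is_derive_coord (delta_mx ord0 i) x j; rewrite mxE eqxx eq_sym.
Qed.

Lemma measurable_coordZ (b : R) i :
  measurable_fun setT (fun y : 'rV[R]_n => b * y ord0 i : measurableTypeR R).
Proof. by apply: measurable_funM => //; exact: measurable_coord. Qed.

Lemma measurable_coordM i j :
  measurable_fun setT (fun y : 'rV[R]_n => y ord0 i * y ord0 j : measurableTypeR R).
Proof. by apply: measurable_funM; exact: measurable_coord. Qed.

Lemma polybounded_coordZ (b : R) i : polybounded (fun y => b * y ord0 i).
Proof. by apply: polyboundedM; [exact: polybounded_cst|exact: polybounded_coord]. Qed.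

Lemma gmoment1 i xi : gmoment (fun y => y ord0 i) xi = q * ixi xi i * E xi.
Proof.
rewrite (_ : (fun y => _) = (fun y : 'rV[R]_n => y ord0 i * 1)); last first.
  by apply/funext => y; rewrite mulr1.
rewrite (@gmoment_rec i (fun=> 1) (fun=> 0))//.
- by rewrite gmoment0 add0r /ixi mulrA.
- exact: polybounded_cst.
- exact: polybounded_cst.
- by move=> x; exact: is_derive_cst.
Qed.

(** This and the next two are instances of Wick's formula: a sum over partial pairings of the
    indices. A pairing turns two coordinates into a Kronecker delta and lowers the power of 1/(2t)
    by one, so m indices with k pairs carry (2t)^(-(m-k)). *)
Lemma gmoment2 i j xi : gmoment (fun y => y ord0 i * y ord0 j) xi =
  (q ^+ 2 * (ixi xi i * ixi xi j) + q * kron R i j) * E xi.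
Proof.
rewrite (@gmoment_rec i (fun y => y ord0 j) (fun=> (i == j)%:R))//.
- rewrite gmoment1.
  rewrite (_ : (fun=> _) = (fun y : 'rV[R]_n => (i == j)%:R * 1)); last first.
    by apply/funext => y; rewrite mulr1.
  rewrite gmomentZ//; last exact: polybounded_cst.
  by rewrite /kron /ixi rmorph_nat; ring.
- exact: measurable_coord.
- exact: polybounded_coord.
- exact: polybounded_cst.
- exact: is_derive_coord_delta.
Qed.

Lemma gmoment3 i j k xi : gmoment (fun y => y ord0 i * (y ord0 j * y ord0 k)) xi =
  (q ^+ 3 * (ixi xi i * ixi xi j * ixi xi k) +
   q ^+ 2 * (kron R i j * ixi xi k + kron R i k * ixi xi j + kron R j k * ixi xi i)) * E xi.
Proof.
have mc := @measurable_coord R n; have bc := polybounded_coord.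
rewrite (@gmoment_rec i (fun y => y ord0 j * y ord0 k)
   (fun y => (i == j)%:R * y ord0 k + (i == k)%:R * y ord0 j))//.
- rewrite gmoment2 gmomentD ?gmomentZ ?gmoment1//;
    try by [exact: measurable_coordZ|exact: polybounded_coordZ].
  by rewrite /kron /ixi !rmorph_nat ; ring.
- exact: measurable_coordM.
- exact: polyboundedM.
- by apply: measurable_funD; exact: measurable_coordZ.
- by apply: polyboundedD; exact: polybounded_coordZ.
- move=> x; have h1 := is_derive_coord_delta i j x; have h2 := is_derive_coord_delta i k x.
  by apply: is_derive_eq; rewrite /GRing.scale/=; ring.
Qed.

Lemma gmoment4 i j k l xi :
  gmoment (fun y => y ord0 i * (y ord0 j * (y ord0 k * y ord0 l))) xi =
  (q ^+ 4 * (ixi xi i * ixi xi j * ixi xi k * ixi xi l) +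
   q ^+ 3 * (kron R i j * ixi xi k * ixi xi l + kron R i k * ixi xi j * ixi xi l +
             kron R i l * ixi xi j * ixi xi k + kron R j k * ixi xi i * ixi xi l +
             kron R j l * ixi xi i * ixi xi k + kron R k l * ixi xi i * ixi xi j) +
   q ^+ 2 * (kron R i j * kron R k l + kron R i k * kron R j l + kron R i l * kron R j k)) * E xi.
Proof.
have mc := @measurable_coord R n; have bc := polybounded_coord.
have m2 := measurable_coordM.
have b2 u v : polybounded (fun y => y ord0 u * y ord0 v) by apply: polyboundedM.
have mZ (b : bool) u v : measurable_fun setT (fun y : 'rV[R]_n => b%:R * (y ord0 u * y ord0 v) : measurableTypeR R).
  by apply: measurable_funM => //; exact: m2.
have bZ (b : bool) u v : polybounded (fun y => b%:R * (y ord0 u * y ord0 v)).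
  by apply: polyboundedM => //; exact: polybounded_cst.
rewrite (@gmoment_rec i (fun y => y ord0 j * (y ord0 k * y ord0 l))
   (fun y => (i == j)%:R * (y ord0 k * y ord0 l) + ((i == k)%:R * (y ord0 j * y ord0 l) +
     (i == l)%:R * (y ord0 j * y ord0 k))))//.
- rewrite gmoment3 gmomentD//; last 2 first.
  + by apply: measurable_funD; exact: mZ.
  + by apply: polyboundedD; exact: bZ.
  rewrite gmomentD// !gmomentZ// !gmoment2.
  by rewrite /kron /ixi !rmorph_nat ; ring.
- by apply: measurable_funM; [exact: mc|exact: m2].
- exact: polyboundedM.
- by apply: measurable_funD; [exact: mZ|apply: measurable_funD; exact: mZ].
- by apply: polyboundedD; [exact: bZ|apply: polyboundedD; exact: bZ].
- move=> x; have h1 := is_derive_coord_delta i j x; have h2 := is_derive_coord_delta i k x.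
  have h3 := is_derive_coord_delta i l x.
  by apply: is_derive_eq; rewrite /GRing.scale/=; ring.
Qed.

Lemma integral_gaussian : (\int[lam]_x (gaussian x)%:E = ((Num.sqrt pi / Num.sqrt t) ^+ n)%:E)%E.
Proof.
have st0 : 0 < Num.sqrt t by rewrite sqrtr_gt0.
have mF : measurable_fun setT (fun b : measurableTypeR R => expR (- (t * (b * b))) : measurableTypeR R).
  apply: (measurableT_comp (@measurable_expR R)); apply: measurableT_comp => //.
  by do 2 apply: measurable_funM => //.
have h1 : (\int[lebesgue_measure]_b (expR (- (t * (b * b))))%:E = (Num.sqrt pi / Num.sqrt t)%:E)%E.
  have := @ge0_integral_affine R (Num.sqrt t) 0 (fun b => (gauss_fun b)%:E) st0 _ _.
  rewrite integralT_gauss => h.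
  rewrite mulrC EFinM -h.
  - rewrite muleA -EFinM mulVf ?gt_eqF// mul1e; apply: eq_integral => b _.
    by rewrite /gauss_fun addr0 exprMn sqr_sqrtr ?ltW// expr2.
  - by apply/measurable_EFinP; exact: measurable_gauss_fun.
  - by move=> b; rewrite lee_fin gauss_fun_ge0.
transitivity (\int[lam]_x (\prod_(i < n) expR (- (t * (x ord0 i * x ord0 i))))%:E)%E.
  apply: eq_integral => x _; congr EFin.
  rewrite /gaussian -(big_morph (@expR R) (@expRD R) (@expR0 R)).
  by rewrite /dotr mulr_sumr sumrN.
rewrite (@ge0_integral_rV_prod R n (fun _ b => expR (- (t * (b * b)))))//.
by rewrite (eq_bigr _ (fun _ _ => h1)) prodEFin prodr_const card_ord.
Qed.

Lemma Rintegral_gaussian : \int[lam]_x gaussian x = (Num.sqrt pi / Num.sqrt t) ^+ n.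
Proof. by rewrite /Rintegral integral_gaussian. Qed.

Lemma gmoment_sum (r : seq 'I_n) (b : 'I_n -> R) xi :
  gmoment (fun y => \sum_(i <- r) y ord0 i * b i) xi =
  \sum_(i <- r) (b i)%:C * gmoment (fun y => y ord0 i) xi.
Proof.
have mc := @measurable_coord R n; have bc := polybounded_coord.
elim: r => [|i r IH].
  rewrite big_nil -(gmoment0 xi); congr gmoment.
  by apply/funext => y; rewrite big_nil.
rewrite big_cons -IH -gmomentZ//.
rewrite -gmomentD//.
- by congr gmoment; apply/funext => y; rewrite big_cons mulrC.
- exact: measurable_coordZ.
- exact: polybounded_coordZ.
- by apply: measurable_sum => j; apply: measurable_funM => //; exact: mc.
- elim: r {IH} => [|j r IH].
    by under eq_fun do rewrite big_nil; exact: polybounded_cst.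
  under eq_fun do rewrite big_cons; apply: polyboundedD => //.
  by apply: polyboundedM => //; exact: polybounded_cst.
Qed.

Lemma polybounded_dotr xi : polybounded (fun y => dotr y xi).
Proof.
rewrite /dotr; elim: (index_enum _) => [|j r IH].
  by under eq_fun do rewrite big_nil; exact: polybounded_cst.
under eq_fun do rewrite big_cons; apply: polyboundedD => //.
by apply: polyboundedM; [exact: polybounded_coord|exact: polybounded_cst].
Qed.

(** Stated for an abstract oscillation T so that cosine and sine, hence real and imaginary parts of
    the transform, share one differentiation under the integral. The dominating function is |y.xi|
    times the Gaussian. *)
Lemma is_derive_gaussian_osc (T T' : R -> R) xi (r : R) :
  (forall b : R, is_derive b 1 T (T' b)) -> (forall b, `|T b| <= 1) -> (forall b, `|T' b| <= 1) ->
  is_derive r 1 (fun r => \int[lam]_y (gaussian y * T (r * dotr y xi)))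
    (\int[lam]_y (dotr y xi * gaussian y * T' (r * dotr y xi))).
Proof.
move=> dT T1 T1'.
pose f (r : R) y := gaussian y * T (r * dotr y xi).
have dfE (b : R) y : is_derive b 1 (f^~ y) (dotr y xi * gaussian y * T' (b * dotr y xi)).
  have h : is_derive b 1 (fun b => b * dotr y xi) (dotr y xi).
    by apply: is_derive_eq; rewrite /GRing.scale/= mulr0 add0r mulr1.
  have := @is_derive1_comp R T (fun b => b * dotr y xi) b _ _ (dT _) h => h2.
  by apply: is_derive_eq; rewrite /GRing.scale/=; ring.
have cT : continuous T.
  by move=> b; apply/differentiable_continuous/derivable1_diffP; have [] := dT b.
have mf (b : R) : measurable_fun setT (f b : _ -> measurableTypeR R).
  apply: measurable_funM; first exact: measurable_gaussian.
  apply: (measurableT_comp (continuous_measurable_fun cT)).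
  by apply: measurable_funM => //; exact: measurable_dotr.
have rI : `](r - 1), (r + 1)[%classic r by rewrite /= in_itv/= ltrBlDr ltrDl ltr01.
have intf (b : R) : `](r - 1), (r + 1)[%classic b -> lam.-integrable setT (EFin \o f b).
  move=> _; apply: (@le_integrableR _ _ _ _ _ gaussian) => //.
    by move=> y; rewrite normrM ger0_norm ?gaussian_ge0// ler_piMr ?gaussian_ge0.
  by apply: rapid_integrable; [exact: measurable_gaussian|exact: rapid_gaussian].
pose G y := `|dotr y xi * gaussian y|.
have iG : lam.-integrable setT (EFin \o G).
  apply: (integrable_norm (f := fun y => dotr y xi * gaussian y)).
  apply: rapid_integrable.
    by apply: measurable_funM; [exact: measurable_dotr|exact: measurable_gaussian].
  by apply: rapid_pgaussian; exact: polybounded_dotr.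
have G0 y : 0 <= G y by exact: normr_ge0.
have derf1 (b : R) y : `](r - 1), (r + 1)[%classic b -> setT y -> derivable (f^~ y) b 1.
  by move=> _ _; have [] := dfE b y.
have Gub (b : R) y : `](r - 1), (r + 1)[%classic b -> setT y -> `|partial1of2 f b y| <= G y.
  move=> _ _; rewrite partial1of2E (@derive_val _ _ _ _ _ _ _ (dfE b y)).
  by rewrite normrM ler_piMr.
split.
  exact: (@derivable_under_integral R _ _ lam f setT measurableT r _ _ rI intf derf1 G G0 iG Gub).
rewrite -derive1E.
rewrite (@differentiation_under_integral R _ _ lam f setT measurableT r _ _ rI intf derf1 G G0 iG Gub)//.
by apply: eq_Rintegral => y _; rewrite partial1of2E (@derive_val _ _ _ _ _ _ _ (dfE r y)).
Qed.

Lemma Re_gmoment p (r : R) xi : Re (gmoment p (r *: xi)) =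
  \int[lam]_y (p y * gaussian y * cos (r * dotr y xi)).
Proof.
apply: eq_Rintegral => y _; rewrite Re_mul /= mul0r subr0.
by rewrite dotrC dotrZ (dotrC xi).
Qed.

Lemma Im_gmoment p (r : R) xi : Im (gmoment p (r *: xi)) =
  \int[lam]_y (p y * gaussian y * sin (r * dotr y xi)).
Proof.
apply: eq_Rintegral => y _; rewrite Im_mul /= mul0r addr0.
by rewrite dotrC dotrZ (dotrC xi).
Qed.

Lemma gmoment_dotr (r : R) xi : gmoment (fun y => dotr y xi) (r *: xi) =
  'i * (r * dotr xi xi * (2 * t)^-1)%:C * E (r *: xi).
Proof.
rewrite /dotr gmoment_sum.
under eq_bigr do rewrite gmoment1 /ixi mxE.
rewrite (eq_bigr (fun i => ('i * q * r%:C * E (r *: xi)) * (xi ord0 i * xi ord0 i)%:C)); last first.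
  by move=> i _; rewrite !rmorphM/=; ring.
by rewrite -mulr_sumr -rmorph_sum/= !rmorphM/=; ring.
Qed.

(** Integrating factor: g(r) e^(k r^2/2) has zero derivative. *)
Let cst_of_ode (g : R -> R) (k : R) : (forall r : R, is_derive r 1 g (- (k * r) * g r)) ->
  g 1 = g 0 * expR (- (k / 2)).
Proof.
move=> dg; pose h (r : R) := g r * expR (k / 2 * (r * r)).
have h01 : h 1 = h 0.
  apply: is_derive_0_is_cst => r.
  have d1 := dg r.
  have d2 : is_derive r 1 (fun r : R => k / 2 * (r * r)) (k * r).
    by apply: is_derive_eq; rewrite /GRing.scale/=; field.
  have d3 := @is_derive1_comp R expR (fun r : R => k / 2 * (r * r)) r _ _ (is_derive_expR _) d2.
  by apply: is_derive_eq; rewrite /GRing.scale/=; ring.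
move: h01; rewrite /h !mulr0 expR0 !mulr1 => <-.
by rewrite -mulrA -expRD subrr expR0 mulr1.
Qed.

(* Along a line r |-> r xi the transform solves g' = - r |xi|^2 / (2t) g. *)
Lemma gaussian_ft xi : E xi =
  ((Num.sqrt pi / Num.sqrt t) ^+ n * expR (- (dotr xi xi / (4 * t))))%:C.
Proof.
pose k := dotr xi xi * (2 * t)^-1.
(* Differentiation in r produces the first moment in the direction xi; the moment recurrence returns
   it as a multiple of the transform itself, which closes the equation. *)
have D r : gmoment (fun y => dotr y xi) (r *: xi) = 'i * (k * r)%:C * E (r *: xi).
  by rewrite gmoment_dotr; congr (_ * _%:C * _); rewrite /k; ring.
have Ek : expR (- (k / 2)) = expR (- (dotr xi xi / (4 * t))).
  by congr (expR (- _)); rewrite /k; field; rewrite gt_eqF.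
have Rd (r : R) : is_derive r 1 (fun r => Re (E (r *: xi))) (- (k * r) * Re (E (r *: xi))).
  have := @is_derive_gaussian_osc (@cos R) (fun b => - sin b) xi r _ _ _.
  have -> : (fun r => \int[lam]_y (gaussian y * cos (r * dotr y xi))) = (fun r => Re (E (r *: xi))).
    by apply/funext => b; rewrite Re_gmoment; apply: eq_Rintegral => y _; rewrite mul1r.
  have -> : \int[lam]_y (dotr y xi * gaussian y * - sin (r * dotr y xi)) = - (k * r) * Re (E (r *: xi)).
    transitivity (- Im (gmoment (fun y => dotr y xi) (r *: xi))).
      rewrite Im_gmoment -mulN1r -RintegralZl//.
        by apply: eq_Rintegral => y _; rewrite mulrN mulN1r.
      have [_ h] := cintegrable_cis (r *: xi) (pgaussian_cintegrable (measurable_dotr xi) (polybounded_dotr xi)).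
      apply: eq_integrable h => // y _; congr EFin.
      by rewrite Im_mul /= mul0r addr0 (dotrC y (r *: xi)) dotrZ (dotrC xi).
    by rewrite D Im_mul Re_mul Im_mul /=; ring.
  by apply => b; rewrite ?normrN; [exact: cos_max|exact: sin_max].
have Id (r : R) : is_derive r 1 (fun r => Im (E (r *: xi))) (- (k * r) * Im (E (r *: xi))).
  have := @is_derive_gaussian_osc (@sin R) (@cos R) xi r _ _ _.
  have -> : (fun r => \int[lam]_y (gaussian y * sin (r * dotr y xi))) = (fun r => Im (E (r *: xi))).
    by apply/funext => b; rewrite Im_gmoment; apply: eq_Rintegral => y _; rewrite mul1r.
  have -> : \int[lam]_y (dotr y xi * gaussian y * cos (r * dotr y xi)) = - (k * r) * Im (E (r *: xi)).
    rewrite -Re_gmoment D.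
    by rewrite Re_mul Im_mul Re_mul /=; ring.
  by apply => b; [exact: sin_max|exact: cos_max].
have R0 := cst_of_ode Rd; have I0 := cst_of_ode Id.
have R1 : Re (E (0 *: xi)) = (Num.sqrt pi / Num.sqrt t) ^+ n.
  rewrite [LHS]Re_gmoment -Rintegral_gaussian; apply: eq_Rintegral => y _.
  by rewrite mul1r mul0r cos0 mulr1.
have I1 : Im (E (0 *: xi)) = 0.
  rewrite [LHS]Im_gmoment (@eq_Rintegral _ _ _ _ _ (fun=> 0)).
    by rewrite /Rintegral integral0.
  by move=> y _; rewrite mul0r sin0 mulr0.
move: R0 I0; rewrite scale1r R1 I1 Ek mul0r => R0 I0.
by apply: complex_ext; rewrite ?R0 ?I0.
Qed.

End gaussian.

(** * Polar coordinates *)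

Lemma integral_indicM d (T : measurableType d) (R : realType)
    (mu : {measure set T -> \bar R}) (D : set T) (h : T -> \bar R) :
  (\int[mu]_(x in D) h x = \int[mu]_x ((\1_D x)%:E * h x))%E.
Proof.
rewrite integral_mkcond; apply: eq_integral => x _.
by rewrite patchE indicE; case: ifPn => _; rewrite ?mul1e ?mul0e.
Qed.

Section sphere.
Variables (R : realType) (n : nat).
Notation lam := (lebesgue_rV R n).
Notation S := (@unit_sphere R n).
Local Notation B := [set x : 'rV[R]_n | enorm x <= 1].

Lemma measurable_unit_sphere : measurable S.
Proof.
have := @measurable_enorm R n measurableT [set 1] (measurable_set1 _).
by rewrite setTI.
Qed.

Lemma enorm_normalize (x : 'rV[R]_n) : x != 0 -> enorm (normalize x) = 1.
Proof.
move=> x0; rewrite /normalize enormZ ger0_norm ?invr_ge0 ?enorm_ge0//.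
by rewrite mulVf// enorm_eq0.
Qed.

Lemma enorm0 : enorm (0 : 'rV[R]_n) = 0.
Proof. by apply/eqP; rewrite enorm_eq0. Qed.

Lemma normalize0 : normalize (0 : 'rV[R]_n) = 0.
Proof. by rewrite /normalize scaler0. Qed.

Lemma unit_sphere_normalize (x : 'rV[R]_n) : S (normalize x) <-> x != 0.
Proof.
split=> [|/enorm_normalize//]; apply: contraPneq => ->.
by rewrite /unit_sphere/= normalize0 enorm0//; apply/eqP; rewrite eq_sym oner_neq0.
Qed.

Definition punctured_ball : set 'rV[R]_n := [set x | 0 < enorm x <= 1].
Local Notation U := punctured_ball.

Lemma measurable_enorm_itv (I : set R) : measurable (I : set (measurableTypeR R)) ->
  measurable [set x : 'rV[R]_n | I (enorm x)].
Proof. by move=> mI; have := @measurable_enorm R n measurableT I mI; rewrite setTI. Qed.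

Lemma measurable_punctured_ball : measurable U.
Proof.
rewrite (_ : U = [set x | `]0, 1]%classic (enorm x)]); last first.
  by apply/seteqP; split => x /=; rewrite in_itv.
by apply: measurable_enorm_itv; exact: measurable_itv.
Qed.

(** The surface measure is n times the image of the volume of the unit ball under [normalize]. The
    origin is normalized to 0, which is off the sphere, so only the punctured ball contributes. *)
Lemma ge0_integral_sphere (F : 'rV[R]_n -> \bar R) : measurable_fun setT F ->
  (forall x, 0 <= F x)%E ->
  (\int[@sphere_measure R n]_(xi in S) F xi =
   n%:R%:E * \int[lam]_x ((\1_U x)%:E * F (normalize x)))%E.
Proof.
move=> mF F0.
have mS := measurable_unit_sphere.
have mB := @measurable_unit_ball R n.
have mFN : measurable_fun setT (fun x => (F \_ S)%E (normalize x)).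
  apply: (measurableT_comp _ (@measurable_normalize R n)).
  by apply/(measurable_restrictT _ _).1 => //; exact: measurable_funTS.
have FS0 x : (0 <= (F \_ S) x)%E by rewrite patchE; case: ifPn.
rewrite integral_mkcond.
pose P : {measure set 'rV[R]_n -> \bar R} :=
  measure_function_pushforward__canonical__measure_function_Measure
    (mrestr lam mB) (@measurable_normalize R n).
rewrite (@eq_measure_integral _ _ _ _ (mscale n%:R%:nng P)); last first.
  move=> A mA _; rewrite /mscale /= /sphere_measure; congr (_ * _)%E.
  by rewrite /P /= /pushforward /mrestr setIC.
rewrite ge0_integral_mscale//; last first.
  by apply/(measurable_restrictT _ _).1 => //; exact: measurable_funTS.
congr (_ * _)%E.
rewrite [LHS]ge0_integral_pushforward//; last 2 first.
- exact: measurable_normalize.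
- by apply/(measurable_restrictT _ _).1 => //; exact: measurable_funTS.
rewrite preimage_setT.
rewrite (@ge0_negligible_integral _ _ _ _ setT (~` B))//; first last.
- by rewrite /= /mrestr setICl measure0.
- by move=> x _; exact: FS0.
- exact: measurableC.
rewrite setTD setCK.
rewrite (@eq_measure_integral _ _ _ _ lam); last first.
  by move=> A mA AB; rewrite /= /mrestr setIidl.
rewrite integral_indicM; apply: eq_integral => x _.
rewrite /= !indicE patchE.
have [->|x0] := eqVneq x 0.
  rewrite (memNset (A := S)); last first.
    by move=> /unit_sphere_normalize; rewrite eqxx.
  rewrite mule0 (memNset (A := U)) ?mul0e// /U/= => -[]; by rewrite enorm0// ltxx.
rewrite (mem_set (A := S)); last exact/unit_sphere_normalize.
congr ((nat_of_bool _)%:R%:E * _)%E.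
have e0 : 0 < enorm x by rewrite enorm_gt0.
by apply/idP/idP; rewrite !inE /U/= e0.
Qed.

(** On the unit ball 1 + |x| <= 2, so the indicator is at most 2^(2n) times the integrable
    weight. *)
Lemma unit_ball_lty : (lam B < +oo)%E.
Proof.
have mB := @measurable_unit_ball R n.
have -> : lam B = (\int[lam]_x (\1_B x)%:E)%E by rewrite integral_indic ?setIT.
have /integrableP[_] := @integrableZR _ _ _ lam (2 ^+ n.*2) _ (integrable_rV_weight R n).
apply: le_lt_trans; apply: ge0_le_integral => //.
- by apply/measurable_EFinP; exact: measurable_indic.
- apply: measurableT_comp => //; apply/measurable_EFinP; apply: measurable_funM => //.
  exact: measurable_rV_weight.
- move=> x _ /=; rewrite lee_fin ger0_norm; last by rewrite mulr_ge0 ?exprn_ge0// rV_weight_ge0.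
  rewrite indicE; case: (boolP (x \in B)) => [|_]; last by rewrite mulr_ge0 ?exprn_ge0// rV_weight_ge0.
  rewrite inE/= => x1; rewrite ler_pdivlMr ?exprn_gt0 ?onePenorm_gt0// mul1r.
  apply: lerXn2r; rewrite ?nnegrE//; first by rewrite ltW// onePenorm_gt0.
  by have := x1; lra.
Qed.

Lemma sphere_measure_lty (A : set 'rV[R]_n) : measurable A -> (sphere_measure A < +oo)%E.
Proof.
move=> mA; have mB := @measurable_unit_ball R n.
have mN : measurable (@normalize R n @^-1` A).
  by rewrite -[X in measurable X]setTI; exact: measurable_normalize.
apply: (@le_lt_trans _ _ (n%:R%:E * lam B)%E).
  rewrite /sphere_measure lee_wpmul2l ?lee_fin//.
  apply: le_measure; rewrite ?inE//; last by move=> x [].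
  exact: measurableI.
by apply: lte_mul_pinfty => //; exact: unit_ball_lty.
Qed.

(** The 1/n obtained here cancels the factor n in the definition of the surface measure. *)
Lemma ge0_halfline_tail (a : R) : 0 < a -> (0 < n)%N ->
  (\int[lebesgue_measure]_(r in `[a, +oo[) (r ^- n.+1)%:E = (a ^- n / n%:R)%:E)%E.
Proof.
move=> a0 n0.
pose F (r : R) := - (r `^ (- n%:R) / n%:R).
have nn : (n%:R : R) != 0 by rewrite pnatr_eq0 -lt0n.
have dF (r : R) : 0 < r -> is_derive r 1 F (r ^- n.+1).
  move=> r0; rewrite /F; have h := is_derive1_powR (- n%:R) r0.
  apply: is_derive_eq; rewrite /GRing.scale/=.
  have -> : 1 *- n - 1 = - n.+1%:R :> R by rewrite -natr1; ring.
  rewrite !mulr0 add0r powR_invn ?ltW// mulrA mulrN mulVf// mulN1r opprK//.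
have cF (r : R) : 0 < r -> {for r, continuous F}.
  by move=> r0; apply/differentiable_continuous/derivable1_diffP; have [] := dF _ r0.
rewrite (@ge0_continuous_FTC2y R (fun r => r ^- n.+1) F a 0).
- by rewrite /F EFinN oppeK add0e powR_invn ?ltW.
- by move=> r ar; rewrite invr_ge0 exprn_ge0// (le_trans (ltW a0)).
- apply: continuous_in_subspaceT => r; rewrite inE/= in_itv/= andbT => ar.
  apply: cvgV; last exact: exprn_continuous.
  by rewrite gt_eqF// exprn_gt0// (lt_le_trans a0).
- rewrite -oppr0; apply: cvgN; rewrite -[X in _ --> X](mul0r n%:R^-1); apply: cvgM; last exact: cvg_cst.
  have h : r^-1 @[r --> +oo%R] --> (0 : R).
    by apply/gtr0_cvgV0; [near=> r; near: r; exact: nbhs_pinfty_gt|exact: cvg_id].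
  apply: (@squeeze_cvgr _ _ _ _ (cst 0) _ _ _ _ _ h); last exact: cvg_cst.
  near=> r; have r1 : 1 <= r by near: r; exact: nbhs_pinfty_ge.
  rewrite /= powR_ge0/= -powR_inv1 ?(le_trans ler01)//; apply: ler_powR => //.
  by rewrite lerN2 ler1n.
- by move=> r ar; have [] := dF r (lt_trans a0 ar).
- by apply: cvg_at_right_filter; exact: cF.
- move=> r; rewrite in_itv/= andbT => ar; rewrite derive1E.
  by have h := dF r (lt_trans a0 ar); exact: derive_val.
Unshelve. all: end_near. Qed.

Lemma measurable_rV_set0 : measurable ([set 0] : set 'rV[R]_n).
Proof.
rewrite (_ : [set 0] = [set x | [set 0] (enorm x)]); first exact: measurable_enorm_itv.
by apply/seteqP; split => x /= h; apply/eqP; move/eqP: h; rewrite enorm_eq0.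
Qed.

(* Rescaling by 2 multiplies volumes by 2^n but fixes the origin. *)
Lemma lebesgue_rV_set0 : (0 < n)%N -> lam ([set 0%R] : set 'rV[R]_n) = 0%E.
Proof.
move=> n0; have m0 := measurable_rV_set0.
have fin : (lam ([set 0%R] : set 'rV[R]_n) < +oo)%E.
  apply: le_lt_trans unit_ball_lty; apply: le_measure; rewrite ?inE//; first exact: measurable_unit_ball.
  by move=> x /= ->; rewrite enorm0.
have mg : measurable_fun setT (fun x : 'rV[R]_n => (\1_([set 0%R] : set 'rV[R]_n) x : R)%:E).
  by apply/measurable_EFinP; exact: measurable_indic.
have h0 (x : 'rV[R]_n) : (0 <= (\1_([set 0%R] : set 'rV[R]_n) x : R)%:E)%E by rewrite lee_fin indicE.
have := @ge0_integral_rV_scale R n 2 _ (ltr0Sn R 1) mg h0.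
rewrite [X in (_ * X)%E = _](_ : _ = \int[lam]_x (\1_([set 0%R] : set 'rV[R]_n) x : R)%:E)%E; last first.
  apply: eq_integral => x _; rewrite !indicE; congr ((nat_of_bool _)%:R%:E); apply/idP/idP; rewrite !inE/=.
    by move=> /eqP; rewrite scaler_eq0 pnatr_eq0 => /eqP.
  by move=> ->; rewrite scaler0.
rewrite integral_indic// setIT => h.
have fE : lam ([set 0%R] : set 'rV[R]_n) \is a fin_num by rewrite ge0_fin_numE.
have [L hL] : exists L : R, lam ([set 0%R] : set 'rV[R]_n) = L%:E by exists (fine (lam [set 0%R])); rewrite fineK.
have {}h : 2 ^+ n * L = L by apply: EFin_inj; rewrite EFinM -hL.
rewrite hL; congr EFin.
have : (2 ^+ n - 1) * L = 0 by rewrite mulrBl h mul1r subrr.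
move/eqP; rewrite mulf_eq0 subr_eq0 => /orP[/eqP h1|/eqP//].
by have : 1 < 2 ^+ n :> R by [rewrite exprn_egt1 ?ltr1n// -lt0n]; rewrite h1 ltxx.
Qed.

Section polar.
Hypothesis n0 : (0 < n)%N.
Local Notation pR := (`]0%R, +oo[%classic : set R).
Notation mu := (@lebesgue_measure R).

Lemma measurable_scale_prod (g : 'rV[R]_n -> R) :
  measurable_fun setT (g : _ -> measurableTypeR R) ->
  measurable_fun setT (fun p : 'rV[R]_n * measurableTypeR R => g ((p.2 : R) *: p.1) : measurableTypeR R).
Proof.
move=> mg; apply: (measurableT_comp mg); apply: measurable_rVP => i.
under eq_fun do rewrite mxE; apply: measurable_funM; first exact: measurable_snd.
exact: (measurableT_comp (@measurable_coord _ _ _) measurable_fst).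
Qed.

Definition radial (g : 'rV[R]_n -> R) (x : 'rV[R]_n) : \bar R :=
  (\int[mu]_(r in pR) (r ^+ n.-1 * g (r *: x))%:E)%E.

Lemma radialE g x : radial g x = (\int[mu]_r (\1_pR r * (r ^+ n.-1 * g (r *: x)))%:E)%E.
Proof. by rewrite /radial integral_indicM. Qed.

Lemma measurable_radial_integrand (g : 'rV[R]_n -> R) :
  measurable_fun setT (g : _ -> measurableTypeR R) ->
  measurable_fun setT (fun p : 'rV[R]_n * measurableTypeR R =>
    \1_pR (p.2 : R) * ((p.2 : R) ^+ n.-1 * g ((p.2 : R) *: p.1)) : measurableTypeR R).
Proof.
move=> mg; apply: measurable_funM.
  exact: (measurableT_comp (@measurable_indic _ _ R setT pR (measurable_itv _)) measurable_snd).
apply: measurable_funM; last exact: measurable_scale_prod.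
by apply: measurable_funX; exact: measurable_snd.
Qed.

Lemma measurable_radial g : measurable_fun setT (g : _ -> measurableTypeR R) ->
  (forall x, 0 <= g x) -> measurable_fun setT (radial g).
Proof.
move=> mg g0; rewrite (funext (radialE g)).
apply: (measurable_fun_fubini_tonelli_F (m2 := mu) (fun p : 'rV[R]_n * measurableTypeR R =>
   (\1_pR (p.2 : R) * ((p.2 : R) ^+ n.-1 * g ((p.2 : R) *: p.1)))%:E)); last first.
  move=> [x r] /=; rewrite lee_fin indicE; case: (boolP (r \in pR)) => [|_]; last by rewrite mul0r.
  by rewrite inE/= in_itv/= andbT => r0; rewrite mul1r mulr_ge0// exprn_ge0// ltW.
by apply/measurable_EFinP; exact: measurable_radial_integrand.
Qed.

Lemma radial_ge0 g x : (forall x, 0 <= g x) -> (0 <= radial g x)%E.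
Proof.
move=> g0; apply: integral_ge0 => r; rewrite /= in_itv/= andbT => r0.
by rewrite lee_fin mulr_ge0// exprn_ge0// ltW.
Qed.

Lemma radial_normalize g x : measurable_fun setT (g : _ -> measurableTypeR R) ->
  (forall x, 0 <= g x) -> x != 0 ->
  radial g (normalize x) = ((enorm x ^+ n)%:E * radial g x)%E.
Proof.
move=> mg g0 x0; have e0 : 0 < enorm x by rewrite enorm_gt0.
have mf : measurable_fun setT (fun r : measurableTypeR R => (`|(r : R) ^+ n.-1 * g ((r : R) *: normalize x)|)%:E).
  apply/measurable_EFinP; apply: measurableT_comp => //; apply: measurable_funM.
    exact: exprn_measurable.
  exact: (measurableT_comp (measurable_scale_prod mg) (@measurable_pair1 _ _ _ _ (normalize x))).
(* The scaling rule wants an integrand nonnegative on the whole line, whereas r^(n-1) may be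
   negative for r < 0; the absolute value changes nothing on the half line. *)
have absE y : radial g y = (\int[mu]_(r in pR) (`|r ^+ n.-1 * g (r *: y)|)%:E)%E.
  apply: eq_integral => r; rewrite inE/= in_itv/= andbT => r0.
  by rewrite ger0_norm// mulr_ge0// exprn_ge0// ltW.
rewrite absE -(@ge0_integral_halfline_scale R (enorm x) _ e0 mf); last first.
  by move=> r; rewrite lee_fin.
rewrite (absE x).
have -> : enorm x ^+ n = enorm x * enorm x ^+ n.-1 by rewrite -exprS prednK.
rewrite EFinM -muleA; congr (_ * _)%E.
rewrite -ge0_integralZl_EFin ?exprn_ge0 ?enorm_ge0//.
- apply: eq_integral => r _; rewrite -EFinM; congr EFin.
  rewrite scalerA mulrAC mulfV ?gt_eqF// mul1r exprMn -mulrA normrM ger0_norm ?exprn_ge0 ?enorm_ge0//.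
- apply/measurable_EFinP; apply: measurable_funTS; apply: measurableT_comp => //.
  apply: measurable_funM; first exact: exprn_measurable.
  exact: (measurableT_comp (measurable_scale_prod mg) (@measurable_pair1 _ _ _ _ x)).
Qed.

Let ballprod : set ('rV[R]_n * measurableTypeR R) :=
  [set p | 0 < enorm p.1 /\ enorm p.1 <= p.2].

Let measurable_ballprod : measurable ballprod.
Proof.
have me : measurable_fun setT (fun p : 'rV[R]_n * measurableTypeR R => enorm p.1 : measurableTypeR R).
  exact: (measurableT_comp (@measurable_enorm R n) measurable_fst).
have m1 := measurable_fun_ltr (measurable_cst (0 : measurableTypeR R)) me.
have m2 := measurable_fun_ler me measurable_snd.
rewrite (_ : ballprod = [set p | (0 < enorm p.1) = true] `&` [set p | (enorm p.1 <= p.2) = true])//.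
apply: measurableI.
  by have := m1 measurableT [set true] I; rewrite setTI.
by have := m2 measurableT [set true] I; rewrite setTI.
Qed.

Let indic_ge0 d (T : measurableType d) (A : set T) x : 0 <= \1_A x :> R.
Proof. by rewrite indicE. Qed.

Let Phi (g : 'rV[R]_n -> R) (p : 'rV[R]_n * measurableTypeR R) : R :=
  \1_U p.1 * enorm p.1 ^+ n * (\1_pR p.2 * ((p.2 : R) ^+ n.-1 * g ((p.2 : R) *: p.1))).

Let Psi (g : 'rV[R]_n -> R) (p : 'rV[R]_n * measurableTypeR R) : R :=
  \1_ballprod p * (p.2 : R) `^ (- n.+1%:R) * (enorm p.1 ^+ n * g p.1).

(** Polar coordinates without a Jacobian. The left side is n times the integral, over 0 < |x| <= 1
    and r > 0, of |x|^n r^(n-1) g(rx). Substituting y = rx for fixed r turns it into the integral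
    over 0 < |y| <= r of |y|^n r^(-n-1) g(y), and integrating r over [|y|, +oo) leaves g(y)/n. *)
Lemma ge0_polar (g : 'rV[R]_n -> R) : measurable_fun setT (g : _ -> measurableTypeR R) ->
  (forall x, 0 <= g x) ->
  (\int[@sphere_measure R n]_(xi in S) radial g xi = \int[lam]_x (g x)%:E)%E.
Proof.
move=> mg g0.
have mU := measurable_punctured_ball.
have Phi0 p : (0 <= (Phi g p)%:E)%E.
  rewrite lee_fin /Phi; apply: mulr_ge0; first by rewrite mulr_ge0 ?exprn_ge0 ?enorm_ge0.
  rewrite indicE; case: (boolP (p.2 \in pR)) => [|_]; last by rewrite mul0r.
  by rewrite inE/= in_itv/= andbT => r0; rewrite mul1r mulr_ge0// exprn_ge0// ltW.
have Psi0 p : (0 <= (Psi g p)%:E)%E.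
  by rewrite lee_fin /Psi !mulr_ge0 ?powR_ge0 ?exprn_ge0 ?enorm_ge0.
have me1 : measurable_fun setT (fun p : 'rV[R]_n * measurableTypeR R => enorm p.1 ^+ n : measurableTypeR R).
  by apply: measurable_funX; exact: (measurableT_comp (@measurable_enorm R n) measurable_fst).
have mPhi : measurable_fun setT (fun p => (Phi g p)%:E).
  apply/measurable_EFinP; apply: measurable_funM; last exact: measurable_radial_integrand.
  apply: measurable_funM => //.
  exact: (measurableT_comp (@measurable_indic _ _ R setT U mU) measurable_fst).
have mPsi : measurable_fun setT (fun p => (Psi g p)%:E).
  apply/measurable_EFinP; apply: measurable_funM.
    apply: measurable_funM; first exact: measurable_indic.
    exact: (measurableT_comp (@measurable_powR R _) measurable_snd).
  by apply: measurable_funM => //; exact: (measurableT_comp mg measurable_fst).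
rewrite (ge0_integral_sphere (measurable_radial mg g0) (fun x => radial_ge0 x g0)).
transitivity (n%:R%:E * \int[lam]_x \int[mu]_r (Phi g (x, r))%:E)%E.
  congr (_ * _)%E; apply: eq_integral => x _.
  transitivity ((\1_U x * enorm x ^+ n)%:E * radial g x)%E.
    rewrite indicE; case: (boolP (x \in U)) => [|_]; last by rewrite !mul0r !mul0e.
    rewrite inE => -[/andP[x0 _]]; rewrite mul1e mul1r radial_normalize//.
    by rewrite -enorm_eq0 gt_eqF.
  rewrite radialE -ge0_integralZl_EFin ?mulr_ge0 ?exprn_ge0 ?enorm_ge0//.
  - move=> r _; rewrite lee_fin indicE; case: (boolP (r \in pR)) => [|_]; last by rewrite mul0r.
    by rewrite inE/= in_itv/= andbT => r0; rewrite mul1r mulr_ge0// exprn_ge0// ltW.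
  - apply/measurable_EFinP.
    exact: (measurableT_comp (measurable_radial_integrand mg) (@measurable_pair1 _ _ _ _ x)).
rewrite (fubini_tonelli (fun p => (Phi g p)%:E))//.
(* Dilation in y for fixed r: |x|^n becomes |y|^n r^(-n) and the volume contributes another r^(-n),
   so r^(n-1) turns into r^(-n-1). *)
transitivity (n%:R%:E * \int[mu]_r \int[lam]_y (Psi g (y, r))%:E)%E.
  congr (_ * _)%E; apply: eq_integral => r _.
  have [r0|r0] := leP r 0.
    rewrite !integral0_eq// => y _; last first.
      rewrite /Phi/= [\1_pR r]indicE memNset ?mul0r ?mulr0//.
      by rewrite /= in_itv/= andbT; apply/negP; rewrite -leNgt.
    rewrite /Psi/= indicE memNset ?mul0r//=.
    by move=> [y0 yr]; have := lt_le_trans y0 yr; rewrite ltNge r0.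
  have mPsir : measurable_fun setT (fun y => (Psi g (y, r))%:E).
    exact: (measurableT_comp mPsi (@measurable_pair2 _ _ _ _ r)).
  rewrite -(@ge0_integral_rV_scale R n r _ r0 mPsir)//.
  rewrite -ge0_integralZl_EFin ?exprn_ge0 ?ltW//; last first.
    exact: (measurableT_comp mPsir (measurable_rV_scale _)).
  apply: eq_integral => x _; rewrite -EFinM; congr EFin.
  rewrite /Phi /Psi /= [\1_pR r]indicE mem_set ?mul1r; last by rewrite /= in_itv/= r0.
  have -> : \1_ballprod (r *: x, r) = \1_U x :> R.
    rewrite !indicE; congr ((nat_of_bool _)%:R); apply/idP/idP; rewrite !inE /ballprod /U/= enormZ gtr0_norm//.
      by rewrite pmulr_rgt0// => -[-> h]; rewrite /= -(ler_pM2l r0) mulr1.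
    by move=> /andP[h1 h2]; rewrite pmulr_rgt0//; split => //; rewrite -[leRHS]mulr1 ler_pM2l.
  rewrite enormZ gtr0_norm// exprMn powR_invn ?ltW//.
  rewrite -[in r ^- n.+1](prednK n0) -[X in _ = r ^+ X * _](prednK n0) -[X in r ^+ X * enorm x ^+ n](prednK n0) !exprS.
  have r1 : r ^+ n.-1 != 0 by rewrite expf_neq0// gt_eqF.
  have r2 : r != 0 by rewrite gt_eqF.
  move: (r : R) (r ^+ n.-1) r1 r2 (\1_U x : R) (enorm x ^+ n) (g _ : R) => u v v0 u0 A C D.
  by field; rewrite v0 u0.
rewrite -(fubini_tonelli (fun p => (Psi g p)%:E))//.
(* The order is exchanged back; for fixed y the constraint is r >= |y|. Only y = 0 is lost, a null
   set. *)
transitivity (n%:R%:E * \int[lam]_y ((n%:R^-1)%:E * (\1_(~` [set 0]) y * g y)%:E))%E.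
  congr (_ * _)%E; apply: eq_integral => y _.
  have [->|y0] := eqVneq y 0.
    rewrite integral0_eq; first by rewrite indicE memNset ?mul0r ?mule0//= => /(_ erefl).
    move=> r _; rewrite /Psi indicE memNset ?mul0r//=.
    by rewrite /ballprod/= enorm0 ltxx => -[].
  have e0 : 0 < enorm y by rewrite enorm_gt0.
  rewrite [\1_(~` _) y]indicE mem_set ?mul1r; last exact/eqP.
  have me : measurable (`[enorm y, +oo[%classic : set (measurableTypeR R)) by exact: measurable_itv.
  transitivity (\int[mu]_r ((enorm y ^+ n * g y)%:E * ((\1_(`[enorm y, +oo[%classic) r)%:E * (r `^ (- n.+1%:R))%:E)))%E.
    apply: eq_integral => r _; rewrite -!EFinM; congr EFin.
    rewrite /Psi/= !indicE.
    have -> : ((y, r) \in ballprod) = (r \in `[enorm y, +oo[%classic).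
      by apply/idP/idP; rewrite !inE /ballprod/= in_itv/= andbT e0 => // -[].
    by rewrite mulrC.
  rewrite ge0_integralZl_EFin ?mulr_ge0 ?exprn_ge0 ?enorm_ge0//; last 2 first.
  - by move=> r _; rewrite -EFinM lee_fin mulr_ge0 ?powR_ge0// indicE.
  - apply: emeasurable_funM; apply/measurable_EFinP; first exact: measurable_indic.
    exact: measurable_powR.
  rewrite -integral_indicM.
  rewrite (_ : (\int[_]_(_ in _) _)%E = \int[mu]_(r in `[enorm y, +oo[) (r ^- n.+1)%:E)%E; last first.
    apply: eq_integral => r; rewrite inE/= in_itv/= andbT => yr.
    by rewrite powR_invn// (le_trans (ltW e0)).
  rewrite ge0_halfline_tail// -!EFinM; congr EFin.
  have e1 : enorm y ^+ n != 0 by rewrite expf_neq0// gt_eqF.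
  have n1 : (n%:R : R) != 0 by rewrite pnatr_eq0 -lt0n.
  move: (enorm y ^+ n) e1 (n%:R : R) n1 (g y : R) => u u0 v v0 w.
  by field; rewrite v0 u0.
have m0 := @measurable_rV_set0.
rewrite ge0_integralZl_EFin//; last 2 first.
- by move=> y _; rewrite lee_fin mulr_ge0.
- by apply/measurable_EFinP; apply: measurable_funM => //; apply: measurable_indic; exact: measurableC.
rewrite muleA -EFinM mulfV ?pnatr_eq0 -?lt0n// mul1e.
under eq_integral do rewrite EFinM.
rewrite -integral_indicM -setTD -ge0_negligible_integral//.
- exact/measurable_EFinP.
- by move=> x _; rewrite lee_fin.
- exact: lebesgue_rV_set0.
Qed.

Lemma integrable_radial (h : 'rV[R]_n -> R) :
  (forall x, 0 <= h x) -> lam.-integrable setT (fun x => (h x)%:E) ->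
  (@sphere_measure R n).-integrable S (radial h).
Proof.
move=> h0 ih; have mh := integrable_measurable ih.
have mr := measurable_radial mh h0.
apply/integrableP; split; first exact: measurable_funTS.
under eq_integral do rewrite gee0_abs ?radial_ge0//.
rewrite ge0_polar//; have /integrableP[_] := ih.
by under eq_integral do rewrite gee0_abs ?lee_fin//.
Qed.

Lemma measurable_halfline_section (g : 'rV[R]_n -> R) x :
  measurable_fun setT (g : _ -> measurableTypeR R) ->
  measurable_fun setT (fun r : measurableTypeR R => (r : R) ^+ n.-1 * g ((r : R) *: x) : measurableTypeR R).
Proof.
move=> mg; apply: measurable_funM; first exact: exprn_measurable.
exact: (measurableT_comp (measurable_scale_prod mg) (@measurable_pair1 _ _ _ _ x)).
Qed.

(** The nonnegative case is applied to the positive and negative parts of theta g. Since theta is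
    constant along rays, it comes out of the radial integral. *)
Lemma Rintegral_polar (theta g : 'rV[R]_n -> R) :
  measurable_fun setT (theta : _ -> measurableTypeR R) ->
  (forall x, `|theta x| <= 1) ->
  (forall (r : R) x, 0 < r -> S x -> theta (r *: x) = theta x) ->
  lam.-integrable setT (fun x => (g x)%:E) ->
  \int[@sphere_measure R n]_(xi in S) (theta xi * \int[mu]_(r in pR) (r ^+ n.-1 * g (r *: xi))) =
  \int[lam]_x (theta x * g x).
Proof.
move=> mth th1 hom ig; have mg := integrable_measurable ig.
have mS := measurable_unit_sphere.
pose g' x := theta x * g x.
have mg' : measurable_fun setT (g' : _ -> measurableTypeR R) by apply: measurable_funM.
have iag : lam.-integrable setT (fun x => (`|g x|)%:E).
  by have := integrable_abse ig; apply: eq_integrable.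
have ig' : lam.-integrable setT (fun x => (g' x)%:E).
  apply: le_integrableR iag => // x; rewrite /g' normrM -[leRHS]mul1r.
  exact: ler_wpM2r.
pose gp x := Num.max (g' x) 0; pose gm x := Num.max (- g' x) 0.
have gp0 x : 0 <= gp x by rewrite /gp le_max lexx orbT.
have gm0 x : 0 <= gm x by rewrite /gm le_max lexx orbT.
have mgp : measurable_fun setT (gp : _ -> measurableTypeR R) by apply: measurable_maxr.
have mgm : measurable_fun setT (gm : _ -> measurableTypeR R).
  by apply: measurable_maxr => //; exact: measurableT_comp.
have igp : lam.-integrable setT (fun x => (gp x)%:E).
  apply: le_integrableR iag => // x; rewrite ger0_norm// /gp ge_max normr_ge0 andbT.
  by rewrite (le_trans (ler_norm _))// /g' normrM -[leRHS]mul1r ler_wpM2r.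
have igm : lam.-integrable setT (fun x => (gm x)%:E).
  apply: le_integrableR iag => // x; rewrite ger0_norm// /gm ge_max normr_ge0 andbT.
  by rewrite (le_trans (ler_norm _))// normrN /g' normrM -[leRHS]mul1r ler_wpM2r.
have innerE xi : (\int[mu]_(r in pR) (r ^+ n.-1 * g' (r *: xi))%:E =
    radial gp xi - radial gm xi)%E.
  rewrite integralE; congr (_ - _)%E; apply: eq_integral => r; rewrite inE/= in_itv/= andbT => r0.
    by rewrite funeposE -EFin_max /gp maxr_pMr ?mulr0// exprn_ge0// ltW.
  by rewrite funenegE -EFinN -EFin_max /gm maxr_pMr ?mulr0 ?mulrN// exprn_ge0// ltW.
rewrite /Rintegral; congr fine.
rewrite [RHS]integralE.
have -> : (\int[lam]_x (fun x => (theta x * g x)%:E)^\+ x = \int[lam]_x (gp x)%:E)%E.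
  by apply: eq_integral => x _; rewrite funeposE -EFin_max.
have -> : (\int[lam]_x (fun x => (theta x * g x)%:E)^\- x = \int[lam]_x (gm x)%:E)%E.
  by apply: eq_integral => x _; rewrite funenegE -EFinN -EFin_max.
rewrite -(ge0_polar mgp gp0) -(ge0_polar mgm gm0) -integralB//; [|exact: integrable_radial..].
have mI : measurable_fun setT (fun xi : 'rV[R]_n => \int[mu]_(r in pR) (r ^+ n.-1 * g (r *: xi)) : measurableTypeR R).
  rewrite (_ : (fun xi : 'rV[R]_n => _) = fun xi : 'rV[R]_n => \int[mu]_r (\1_pR r * (r ^+ n.-1 * g (r *: xi)))); last first.
    apply/funext => xi; rewrite /Rintegral integral_indicM; congr fine.
  exact: (@measurable_Rintegral_prod _ _ _ _ _ mu _ (measurable_radial_integrand mg)).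
apply: ae_eq_integral => //.
- by apply/measurable_EFinP; apply: measurable_funTS; apply: measurable_funM.
- apply: measurable_funTS; apply: emeasurable_funB; exact: measurable_radial.
(* The radial integral of |g| is finite only in almost every direction, and only there may theta be
   pulled out and [fine] undone. *)
have ira := integrable_radial (fun x => normr_ge0 (g x)) iag.
have := integrable_ae mS ira; apply: filterS => xi fxi Sxi.
rewrite -innerE -/(Rintegral _ _ _).
have ixi : mu.-integrable pR (EFin \o (fun r : R => r ^+ n.-1 * g (r *: xi))).
  apply/integrableP; split.
    by apply/measurable_EFinP; apply: measurable_funTS; exact: measurable_halfline_section.
  have /fxi := Sxi; rewrite ge0_fin_numE ?radial_ge0//; apply: le_lt_trans.
  rewrite le_eqVlt; apply/orP; left; apply/eqP; apply: eq_integral => r; rewrite inE/= in_itv/= andbT => r0.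
  by rewrite normrM ger0_norm// exprn_ge0// ltW.
rewrite -RintegralZl//.
rewrite /Rintegral fineK.
  apply: eq_integral => r; rewrite inE/= in_itv/= andbT => r0.
  by rewrite /g' hom// mulrCA.
apply: integrable_fin_num; first exact: measurable_itv.
exact: eq_integrable (@integrableZl _ _ _ mu pR (measurable_itv `]0%R, +oo[) (theta xi) _ ixi).
Qed.

(** In polar coordinates every radial integral equals Gamma(n-a), and the sphere has finite
    measure. *)
Lemma integrable_powR_expR (a : R) : a < n%:R ->
  lam.-integrable setT (fun y => (enorm y `^ (- a) * expR (- enorm y))%:E).
Proof.
move=> an; have b0 : 0 < n%:R - a by rewrite subr_gt0.
pose w (y : 'rV[R]_n) : R := enorm y `^ (- a) * expR (- enorm y).
have w0 y : 0 <= w y by rewrite mulr_ge0 ?powR_ge0 ?expR_ge0.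
have mw : measurable_fun setT (w : _ -> measurableTypeR R).
  apply: measurable_funM; first exact: (measurableT_comp (measurable_powR _) (@measurable_enorm R n)).
  apply: (measurableT_comp (@measurable_expR R)).
  by apply: measurableT_comp => //; exact: measurable_enorm.
apply/integrableP; split; first exact/measurable_EFinP.
under eq_integral do rewrite gee0_abs ?lee_fin ?w0//.
rewrite -(ge0_polar mw w0).
have -> : (\int[@sphere_measure R n]_(xi in S) radial w xi =
    \int[@sphere_measure R n]_(xi in S) (Gamma (n%:R - a))%:E)%E.
  apply: eq_integral => xi; rewrite inE /unit_sphere/= => xi1.
  rewrite -gammaE//; apply: eq_integral => r; rewrite inE/= in_itv/= andbT => r0.
  rewrite /w /gamma_fun enormZ xi1 mulr1 gtr0_norm// mulrA; congr (_ * _)%:E.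
  rewrite -powR_mulrn ?ltW// -powRD; last by rewrite (gt_eqF r0) implybT.
  congr (_ `^ _); rewrite -(prednK n0) -natr1 /=; ring.
rewrite integral_cst//; last exact: measurable_unit_sphere.
apply: lte_mul_pinfty => //; first by rewrite lee_fin ltW// Gamma_gt0.
by apply: sphere_measure_lty; exact: measurable_unit_sphere.
Qed.

End polar.

End sphere.

(** * Fourier transforms of homogeneous kernels *)

Section cintegral_sum.
Context d (T : measurableType d) (R : realType) (mu : {measure set T -> \bar R}).

Lemma cintegrable0 : cintegrable mu (fun _ : T => 0 : R[i]).
Proof. by split; exact: integrable0. Qed.

Lemma cintegrable_sum I (r : seq I) (F : I -> T -> R[i]) :
  (forall i, cintegrable mu (F i)) -> cintegrable mu (fun x => \sum_(i <- r) F i x).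
Proof.
move=> iF; elim: r => [|i r IH].
  by under eq_fun do rewrite big_nil; exact: cintegrable0.
by under eq_fun do rewrite big_cons; exact: cintegrableD.
Qed.

Lemma cintegral_sum I (r : seq I) (F : I -> T -> R[i]) :
  (forall i, cintegrable mu (F i)) ->
  cintegral mu setT (fun x => \sum_(i <- r) F i x) = \sum_(i <- r) cintegral mu setT (F i).
Proof.
move=> iF; elim: r => [|i r IH].
  rewrite big_nil (_ : (fun=> _) = fun=> (0 : R)%:C); last by apply/funext => x; rewrite big_nil.
  by rewrite cintegral_real /Rintegral integral0.
rewrite big_cons -IH -cintegralD//; last exact: cintegrable_sum.
by apply: eq_cintegral => x; rewrite big_cons.
Qed.

End cintegral_sum.

Section fubini_sum.
Context d1 d2 (T1 : measurableType d1) (T2 : measurableType d2) (R : realType).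
Variable m1 : {sigma_finite_measure set T1 -> \bar R}.
Variable m2 : {sigma_finite_measure set T2 -> \bar R}.

Lemma cintegrable_prod_inner2 (f : T1 * T2 -> R[i]) : cintegrable (m1 \x m2)%E f ->
  cintegrable m2 (fun y => cintegral m1 setT (fun x => f (x, y))).
Proof.
move=> fi.
have mf := cintegrable_cmeasurable fi.
have main (g : T1 * T2 -> R) : (m1 \x m2)%E.-integrable setT (fun z => (g z)%:E) ->
    m2.-integrable setT (fun y => (\int[m1]_x g (x, y))%:E).
  move=> gi; have mg := integrable_measurable gi.
  have mag : measurable_fun setT (fun z => (`|g z|)%:E) by apply/measurable_EFinP; exact: measurableT_comp.
  have iG : m2.-integrable setT (fun y => \int[m1]_x (`|g (x, y)|)%:E)%E.
    apply/integrableP; split.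
      by apply: (measurable_fun_fubini_tonelli_G (m1 := m1) (fun z => (`|g z|)%:E)).
    under eq_integral do rewrite gee0_abs ?integral_ge0//.
    rewrite -(fubini_tonelli2 (fun z => (`|g z|)%:E))//.
    by have /integrableP[_] := gi.
  apply: (le_integrable measurableT _ _ iG) => //.
    apply/measurable_EFinP.
    apply: (@measurable_Rintegral_prod _ _ _ _ _ m1 (fun p : T2 * T1 => g (p.2, p.1))).
    exact: (measurableT_comp mg (@measurable_swap _ _ T2 T1)).
  move=> y _; rewrite [leRHS]gee0_abs ?integral_ge0//.
  have mgy : measurable_fun setT (fun x => (g (x, y))%:E).
    by apply/measurable_EFinP; exact: (measurableT_comp mg (@measurable_pair2 _ _ _ _ y)).
  apply: (le_trans _ (le_abse_integral m1 measurableT mgy)).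
  rewrite /Rintegral; case: (\int[m1]_x _)%E => [r| |] //=; rewrite normr0 ?leey//.
by case: fi => f1 f2; split; [exact: (main (fun z => Re (f z)))|exact: (main (fun z => Im (f z)))].
Qed.

Variables (N : nat) (v : 'I_N -> T1 -> R[i]) (g : 'I_N -> T1 * T2 -> R) (k : 'I_N -> T1 -> R).
Hypothesis mv : forall i, cmeasurable (v i).
Hypothesis mg : forall i, measurable_fun setT (g i : _ -> measurableTypeR R).
Hypothesis g0 : forall i z, 0 <= g i z.
Hypothesis gk : forall i x, v i x != 0 -> (\int[m2]_t (g i (x, t))%:E = (k i x)%:E)%E.
Hypothesis ik : forall i, m1.-integrable setT (fun x => (normc (v i x) * k i x)%:E).

Let mvg i : cmeasurable (fun z : T1 * T2 => v i z.1 * (g i z)%:C).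
Proof.
apply: cmeasurableM; last exact: cmeasurable_real.
exact: (cmeasurable_comp (mv i) measurable_fst).
Qed.

Let mgx i x : measurable_fun setT (fun t => g i (x, t) : measurableTypeR R).
Proof. exact: (measurableT_comp (mg i) (@measurable_pair1 _ _ _ _ x)). Qed.

Let ivg i : cintegrable (m1 \x m2)%E (fun z : T1 * T2 => v i z.1 * (g i z)%:C).
Proof.
apply: cintegrable_prod => //.
have /integrableP[_] := ik i; apply: le_lt_trans.
have mk : measurable_fun setT (fun x => (normc (v i x) * k i x)%:E).
  exact: measurable_int (ik i).
apply: ge0_le_integral => //.
- move=> x _; apply: integral_ge0 => t _; exact: normc_ge0.
- apply: (measurable_fun_fubini_tonelli_F (m2 := m2) (fun z => (normc (v i z.1 * (g i z)%:C))%:E)).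
    by apply/measurable_EFinP; exact: cmeasurable_normc.
  by move=> z; rewrite lee_fin normc_ge0.
- by apply: measurableT_comp.
move=> x _ /=.
have [v0|v0] := eqVneq (v i x) 0.
  rewrite integral0_eq//= => t _; by rewrite v0 mul0r Normc.normc0.
under eq_integral do rewrite Normc.normcM normc_real ger0_norm// EFinM.
rewrite ge0_integralZl_EFin//=.
- by rewrite gk// -EFinM lee_fin ler_norm.
- by move=> t _; rewrite lee_fin.
- by apply/measurable_EFinP; exact: mgx.
- exact: normc_ge0.
Qed.

(** The kernel integrals need to be known only where the coefficient [v i] is nonzero. This is
    essential: the Gamma integrals diverge at the origin, and those of nonpositive order are
    accompanied by a zero coefficient. *)
Lemma fubini_sum :
  cintegral m2 setT (fun t => cintegral m1 setT (fun x => \sum_(i < N) v i x * (g i (x, t))%:C)) =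
  cintegral m1 setT (fun x => \sum_(i < N) v i x * (k i x)%:C).
Proof.
rewrite -(@cfubini _ _ _ _ _ m1 m2 (fun z => \sum_(i < N) v i z.1 * (g i z)%:C)); last first.
  have h := @cintegrable_sum _ _ _ (m1 \x m2)%E _ (index_enum 'I_N) _ ivg.
  exact: h.
apply: eq_cintegral => x /=.
have igx i : v i x != 0 -> m2.-integrable setT (fun t => (g i (x, t))%:E).
  move=> v0; apply/integrableP; split; first by apply/measurable_EFinP; exact: mgx.
  by under eq_integral do rewrite gee0_abs ?lee_fin//; rewrite gk// ltry.
rewrite cintegral_sum.
  apply: eq_bigr => i _.
  have [->|v0] := eqVneq (v i x) 0.
    rewrite mul0r (_ : (fun _ => _) = (fun=> (0 : R)%:C)).
      by rewrite cintegral_real /Rintegral integral0.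
    by apply/funext => t; rewrite mul0r.
  by rewrite cintegralZ_real ?igx// /Rintegral gk.
move=> i; have [->|v0] := eqVneq (v i x) 0.
  by under eq_fun do rewrite mul0r; exact: cintegrable0.
apply: cintegrableZ; split => /=; [exact: igx|exact: integrable0].
Qed.

End fubini_sum.

Section weights.
Variables (R : realType) (n : nat) (al : R).
Hypotheses (n0 : (0 < n)%N) (al0 : 0 <= al) (aln : al < n%:R).
Notation lam := (lebesgue_rV R n).

(** An integrable substitute for |y|^(-al) near the origin: the factor e makes it dominate on the
    unit ball, while outside |y|^(-al) <= 1. *)
Definition peak (y : 'rV[R]_n) : R := expR 1 * (enorm y `^ (- al) * expR (- enorm y)).

Lemma peak_ge0 y : 0 <= peak y.
Proof. by rewrite !mulr_ge0 ?expR_ge0 ?powR_ge0. Qed.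

Lemma integrable_peak : lam.-integrable setT (fun y => (peak y)%:E).
Proof. by apply: integrableZR; exact: integrable_powR_expR. Qed.

Lemma powR_le_peak (y : 'rV[R]_n) : enorm y `^ (- al) <= peak y + 1.
Proof.
have [y1|y1] := leP (enorm y) 1.
  rewrite /peak mulrCA -expRD.
  rewrite (le_trans _ (_ : enorm y `^ (- al) * expR (1 - enorm y) <= _)) ?lerDl//.
  by rewrite -[leLHS]mulr1 ler_wpM2l ?powR_ge0// -[leLHS]expR0 ler_expR subr_ge0.
rewrite (@le_trans _ _ 1)// ?lerDr ?peak_ge0//.
rewrite powRN invf_le1 ?powR_gt0 ?(lt_trans _ y1)//.
have := @ge0_ler_powR R al al0 1 (enorm y); rewrite powR1 !nnegrE; apply => //; last exact: ltW.
exact: enorm_ge0.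
Qed.

Lemma measurable_enorm_powR (b : R) : measurable_fun setT (fun y : 'rV[R]_n => enorm y `^ b : measurableTypeR R).
Proof. exact: (measurableT_comp (measurable_powR _) (@measurable_enorm R n)). Qed.

Lemma powRM_le (u : 'rV[R]_n -> R) (M : R) y : 0 <= u y <= M ->
  enorm y `^ (- al) * u y <= M * peak y + u y.
Proof.
move=> /andP[u0 uM]; rewrite (le_trans (ler_wpM2r u0 (powR_le_peak y)))//.
by rewrite mulrDl mul1r lerD2r mulrC ler_wpM2r// peak_ge0.
Qed.

Lemma integrable_powRM (u : 'rV[R]_n -> R) (M : R) : (forall y, 0 <= u y <= M) ->
  lam.-integrable setT (fun y => (u y)%:E) ->
  lam.-integrable setT (fun y => (enorm y `^ (- al) * u y)%:E).
Proof.
move=> uM iu; apply: (@le_integrableR _ _ _ _ _ (fun y => M * peak y + u y)).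
- by apply: measurable_funM; [exact: measurable_enorm_powR|exact: integrable_measurable iu].
- move=> y; have /andP[u0 _] := uM y.
  by rewrite ger0_norm ?mulr_ge0 ?powR_ge0// powRM_le.
- under eq_fun do rewrite EFinD.
  by apply: integrableD => //; apply: integrableZR; exact: integrable_peak.
Qed.

End weights.
Section ft_product.
Variables (R : realType) (n : nat).
Notation lam := (lebesgue_rV R n).

Lemma dotrZr c (x y : 'rV[R]_n) : dotr x (c *: y) = c * dotr x y.
Proof. by rewrite dotrC dotrZ dotrC. Qed.

Lemma measurable_dotr_prod : measurable_fun setT
  (fun p : 'rV[R]_n * 'rV[R]_n => dotr p.1 p.2 : measurableTypeR R).
Proof.
apply: measurable_sum => i; apply: measurable_funM.
  exact: (measurableT_comp (@measurable_coord _ _ _) measurable_fst).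
exact: (measurableT_comp (@measurable_coord _ _ _) measurable_snd).
Qed.

(* The sign e = -1 turns [ft] into [fourier]. *)
Lemma ft_product (e : R) (u w : 'rV[R]_n -> R[i]) : cintegrable lam u -> cintegrable lam w ->
  cintegral lam setT (fun x => u x * ft w (e *: x)) =
  cintegral lam setT (fun xi => w xi * ft u (e *: xi)).
Proof.
move=> iu iw; have mu := cintegrable_cmeasurable iu; have mw := cintegrable_cmeasurable iw.
pose F (p : 'rV[R]_n * 'rV[R]_n) := u p.1 * (w p.2 * cis (e * dotr p.1 p.2)).
have mF : cmeasurable F.
  apply: cmeasurableM; first exact: (cmeasurable_comp mu measurable_fst).
  apply: cmeasurableM; first exact: (cmeasurable_comp mw measurable_snd).
  by apply: cmeasurable_cis; apply: measurable_funM => //; exact: measurable_dotr_prod.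
have iF : cintegrable (lam \x lam)%E F.
  apply: cintegrable_prod => //.
  pose B : R := \int[lam]_x normc (w x).
  have -> : (\int[lam]_x \int[lam]_y (normc (F (x, y)))%:E = \int[lam]_x (B * normc (u x))%:E)%E.
    apply: eq_integral => x _.
    transitivity (\int[lam]_y ((normc (u x))%:E * (normc (w y))%:E))%E.
      by apply: eq_integral => y _; rewrite /F/= !Normc.normcM normc_cis mulr1 EFinM.
    rewrite ge0_integralZl_EFin ?normc_ge0//; last 2 first.
    - by move=> y _; rewrite lee_fin normc_ge0.
    - by apply/measurable_EFinP; exact: cmeasurable_normc.
    rewrite mulrC EFinM; congr (_ * _)%E; rewrite /B /Rintegral fineK//.
    by apply: integrable_fin_num => //; exact: integrable_normc.
  have /integrableP[_] := integrableZR B (integrable_normc iu); apply: le_lt_trans.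
  apply: ge0_le_integral => //.
  - by move=> x _; rewrite lee_fin mulr_ge0 ?normc_ge0// Rintegral_ge0// => y _; exact: normc_ge0.
  - apply/measurable_EFinP; apply: measurable_funM => //; exact: cmeasurable_normc.
  - apply: measurableT_comp => //; apply/measurable_EFinP; apply: measurable_funM => //; exact: cmeasurable_normc.
  - by move=> x _; rewrite lee_fin ler_norm.
have := cfubini iF; rewrite /F /= => h.
rewrite (_ : cintegral _ _ _ = cintegral lam setT (fun x => cintegral lam setT (fun y => u x * (w y * cis (e * dotr x y))))).
  rewrite h; apply: eq_cintegral => y; rewrite /ft -cintegralZ; last exact: cintegrable_cis.
  by apply: eq_cintegral => x; rewrite dotrZr mulrCA.
apply: eq_cintegral => x; rewrite /ft -cintegralZ; last exact: cintegrable_cis.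
by apply: eq_cintegral => y; rewrite dotrZr (dotrC y).
Qed.

Lemma ft_shift (f : 'rV[R]_n -> R[i]) (y zeta : 'rV[R]_n) : cintegrable lam f ->
  ft (fun x => f (x + y)) zeta = cis (- dotr y zeta) * ft f zeta.
Proof.
move=> jf; have mf := cintegrable_cmeasurable jf.
rewrite /ft -cintegralZ; last exact: cintegrable_cis.
rewrite -[RHS](cintegral_rV_shift y); last first.
  apply: cmeasurableM; first exact: cmeasurable_cst.
  by apply: cmeasurableM => //; exact: cmeasurable_cis_dotr.
apply: eq_cintegral => x; rewrite dotrD mulrCA -cisD; congr (_ * cis _).
by rewrite addrCA addNr addr0.
Qed.

End ft_product.

Section correlation.
Variables (R : realType) (n : nat) (al : R).
Hypotheses (n0 : (0 < n)%N) (al0 : 0 <= al) (aln : al < n%:R).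
Notation lam := (lebesgue_rV R n).
Notation mu := (@lebesgue_measure R).
Variable K : 'rV[R]_n -> R.
Hypothesis mK : measurable_fun setT (K : _ -> measurableTypeR R).
Hypothesis Kle : forall y, `|K y| <= enorm y `^ (- al).
Variables (f : 'rV[R]_n -> R[i]) (M : R).
Hypothesis fi : cintegrable lam f.
Hypothesis fM : forall x, normc (f x) <= M.

(** A correlation rather than a convolution, because the beam evaluates f at x + t xi. *)
Definition correlation (x : 'rV[R]_n) : R[i] := cintegral lam setT (fun y => (K y)%:C * f (x + y)).

Let mf := cintegrable_cmeasurable fi.
Let mfx (x : 'rV[R]_n) : cmeasurable (fun y : 'rV[R]_n => f (x + y)).
Proof.
by under eq_fun do rewrite addrC; exact: (cmeasurable_comp mf (measurable_rV_shift x)).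
Qed.

(** Boundedness of f controls the singularity of the kernel and integrability of f its tail. By
    translation invariance the integral in y is independent of x. *)
Let dom (x y : 'rV[R]_n) : R := M * peak al y + normc (f (x + y)).

Let KfE x y : normc ((K y)%:C * f (x + y)) <= dom x y.
Proof.
rewrite Normc.normcM normc_real (le_trans (ler_wpM2r (normc_ge0 _) (Kle y)))//.
have := @powRM_le R n al al0 (fun y => normc (f (x + y))) M y; apply; by rewrite normc_ge0 fM.
Qed.

Let inormfx x : lam.-integrable setT (fun y => (normc (f (x + y)))%:E).
Proof.
under eq_fun do rewrite addrC.
apply/(@integrable_rV_shift _ _ x (fun y => normc (f y))); first exact: cmeasurable_normc.
exact: integrable_normc.
Qed.

Let ipk : lam.-integrable setT (fun y => (M * peak al y)%:E).
Proof. by apply: integrableZR; exact: integrable_peak. Qed.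

Let idom x : lam.-integrable setT (fun y => (dom x y)%:E).
Proof.
under eq_fun do rewrite EFinD; exact: integrableD.
Qed.

Let B : R := M * (\int[lam]_y peak al y) + \int[lam]_y normc (f y).

Let intdom x : \int[lam]_y dom x y = B.
Proof.
rewrite RintegralD//.
rewrite RintegralZl//; last exact: integrable_peak.
congr (_ + _).
rewrite -[RHS](Rintegral_rV_shift x); last exact: cmeasurable_normc.
  by apply: eq_Rintegral => y _; rewrite addrC.
exact: inormfx.
Qed.

Lemma correlation_integrable x : cintegrable lam (fun y => (K y)%:C * f (x + y)).
Proof.
apply: (cintegrable_le _ (KfE x) (idom x)).
by apply: cmeasurableM; [exact: cmeasurable_real|exact: mfx].
Qed.

Lemma correlation_bounded x : normc (correlation x) <= 2 * B.
Proof.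
rewrite -(intdom x); apply: le_normc_cintegral (KfE x) (idom x).
exact: cintegrable_cmeasurable (correlation_integrable x).
Qed.

Let mF1 : cmeasurable (fun p : 'rV[R]_n * 'rV[R]_n => (K p.2)%:C * f (p.1 + p.2)).
Proof.
apply: cmeasurableM; first by apply: cmeasurable_real; exact: (measurableT_comp mK measurable_snd).
apply: (cmeasurable_comp mf); apply: measurable_rVP => i.
under eq_fun do rewrite mxE; apply: measurable_funD.
  exact: (measurableT_comp (@measurable_coord _ _ _) measurable_fst).
exact: (measurableT_comp (@measurable_coord _ _ _) measurable_snd).
Qed.

Lemma cmeasurable_correlation : cmeasurable correlation.
Proof. exact: (@cmeasurable_prod _ _ _ _ _ lam _ mF1). Qed.

Variable psi : 'rV[R]_n -> R[i].
Hypothesis ipsi : cintegrable lam psi.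

Let F1 (p : 'rV[R]_n * 'rV[R]_n) := (K p.2)%:C * f (p.1 + p.2) * psi p.1.

Let iF1 : cintegrable (lam \x lam)%E F1.
Proof.
have mpsi := cintegrable_cmeasurable ipsi.
have mF : cmeasurable F1.
  by apply: cmeasurableM => //; exact: (cmeasurable_comp mpsi measurable_fst).
apply: cintegrable_prod => //.
have /integrableP[_] := integrableZR B (integrable_normc ipsi); apply: le_lt_trans.
apply: ge0_le_integral => //.
- by move=> x _; apply: integral_ge0 => y _; rewrite lee_fin normc_ge0.
- apply: (measurable_fun_fubini_tonelli_F (m2 := lam) (fun z => (normc (F1 z))%:E)).
    by apply/measurable_EFinP; exact: cmeasurable_normc.
  by move=> z; rewrite lee_fin normc_ge0.
- apply: measurableT_comp => //; apply/measurable_EFinP; apply: measurable_funM => //; exact: cmeasurable_normc.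
move=> x _.
apply: (@le_trans _ _ (\int[lam]_y ((normc (psi x))%:E * (dom x y)%:E))%E).
  apply: ge0_le_integral => //.
  - by move=> y _; rewrite lee_fin normc_ge0.
  - apply/measurable_EFinP.
    exact: (measurableT_comp (cmeasurable_normc mF) (@measurable_pair1 _ _ _ _ x)).
  - apply: emeasurable_funM => //; exact: measurable_int (idom x).
  - by move=> y _; rewrite /F1 /= Normc.normcM -EFinM lee_fin mulrC; apply: ler_wpM2l; [exact: normc_ge0|exact: KfE].
rewrite integralZl//; have fE : (\int[lam]_y (dom x y)%:E)%E \is a fin_num by exact: integrable_fin_num.
rewrite -(fineK fE) -/(Rintegral _ _ _) intdom -EFinM lee_fin mulrC; exact: ler_norm.
Qed.

Let h (y : 'rV[R]_n) : R[i] := cintegral lam setT (fun x => f (x + y) * psi x).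

Let ifpsi y : cintegrable lam (fun x => f (x + y) * psi x).
Proof.
apply: (@cintegrable_bounded _ _ _ lam (fun x => f (x + y)) psi M) => //.
exact: (cmeasurable_comp mf (measurable_rV_shift y)).
Qed.

Let innerE y : cintegral lam setT (fun x => F1 (x, y)) = (K y)%:C * h y.
Proof.
by rewrite /h -cintegralZ//; apply: eq_cintegral => x; rewrite /F1/= mulrA.
Qed.

(** Fubini transfers the x-integral onto f and psi, so that the kernel is left multiplying one
    function of y. Absolute convergence comes from [dom], K itself not being assumed integrable. *)
Lemma cintegral_correlation : cintegral lam setT (fun x => correlation x * psi x) =
  cintegral lam setT (fun y => (K y)%:C * h y).
Proof.
have := cfubini iF1; under [in X in _ = X]eq_cintegral do rewrite innerE.
move=> <-; apply: eq_cintegral => x; rewrite /correlation -cintegralZr//.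
exact: correlation_integrable.
Qed.

Lemma correlation_dual_integrable : cintegrable lam (fun y => (K y)%:C * h y).
Proof. by have := cintegrable_prod_inner2 iF1; under eq_fun do rewrite innerE. Qed.

End correlation.

Lemma measurable_rV_opp (R : realType) n : measurable_fun setT (fun x : 'rV[R]_n => - x).
Proof.
rewrite (_ : (fun x => - x) = fun x : 'rV[R]_n => -1 *: x); first exact: measurable_rV_scale.
by apply/funext => x; rewrite scaleN1r.
Qed.

Section offzero.
Variables (R : realType) (n : nat).
Hypothesis n0 : (0 < n)%N.
Notation lam := (lebesgue_rV R n).

(* Negative powers of |y| have the junk value 0 at the origin and diverging
   subordination integrals there; [offzero] makes identities valid off 0 hold
   everywhere. *)
Definition offzero (w : 'rV[R]_n -> R[i]) (y : 'rV[R]_n) : R[i] := (y != 0)%:R * w y.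

Lemma offzero0 w : offzero w 0 = 0.
Proof. by rewrite /offzero eqxx mul0r. Qed.

Lemma offzeroE w y : y != 0 -> offzero w y = w y.
Proof. by rewrite /offzero => ->; rewrite mul1r. Qed.

Lemma normc_offzero w y : normc (offzero w y) <= normc (w y).
Proof.
have [->|y0] := eqVneq y 0; last by rewrite offzeroE.
by rewrite offzero0 Normc.normc0 normc_ge0.
Qed.

Lemma cmeasurable_offzero w : cmeasurable w -> cmeasurable (offzero w).
Proof.
move=> mw; apply: cmeasurableM => //.
have -> : (fun y : 'rV[R]_n => (y != 0)%:R) = (fun y => (\1_(~` [set (0 : 'rV[R]_n)]) y)%:C) :> (_ -> R[i]).
  apply/funext => y; rewrite indicE /= rmorph_nat; congr ((nat_of_bool _)%:R).
  by apply/idP/idP; rewrite inE/= => /eqP.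
by apply: cmeasurable_real; apply: measurable_indic; apply: measurableC; exact: measurable_rV_set0.
Qed.

Lemma cintegral_offzero (f g : 'rV[R]_n -> R[i]) : cmeasurable f -> cmeasurable g ->
  (forall y, y != 0 -> f y = g y) -> cintegral lam setT f = cintegral lam setT g.
Proof.
move=> mf mg fg; apply: (@ae_eq_cintegral _ _ _ lam f g [set 0]) => //.
- exact: measurable_rV_set0.
- exact: lebesgue_rV_set0.
- by move=> y /eqP; exact: fg.
Qed.

End offzero.

Section gamma_kernels.
Variables (R : realType) (n : nat).
Notation mu := (@lebesgue_measure R).
Local Notation pR := (`]0%R, +oo[%classic : set R).

Definition gauss_kernel (b : R) (p : 'rV[R]_n * measurableTypeR R) : R :=
  \1_pR (p.2 : R) * ((p.2 : R) `^ (b - 1) * expR (- (dotr p.1 p.1 * p.2))).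

(** The frequency-side counterpart of [gauss_kernel]. The inverse of t is written as a real power so
    that measurability on the whole line follows from that of powers; on t > 0 it is 1/t. *)
Definition heat_kernel (b : R) (p : 'rV[R]_n * measurableTypeR R) : R :=
  \1_pR (p.2 : R) * ((p.2 : R) `^ (- b - 1) * expR (- (dotr p.1 p.1 / 4 * (p.2 : R) `^ (-1)))).

Let measurable_dotr2 : measurable_fun setT
  (fun p : 'rV[R]_n * measurableTypeR R => dotr p.1 p.1 : measurableTypeR R).
Proof.
by apply: measurable_sum => i; apply: measurable_funM;
  exact: (measurableT_comp (@measurable_coord _ _ _) measurable_fst).
Qed.

Let mind : measurable_fun setT (fun p : 'rV[R]_n * measurableTypeR R => \1_pR (p.2 : R) : measurableTypeR R).
Proof. exact: (measurableT_comp (@measurable_indic _ _ R setT pR (measurable_itv _)) measurable_snd). Qed.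

Lemma measurable_gauss_kernel b : measurable_fun setT (gauss_kernel b : _ -> measurableTypeR R).
Proof.
apply: measurable_funM; first exact: mind.
apply: measurable_funM; first exact: (measurableT_comp (measurable_powR _) measurable_snd).
apply: (measurableT_comp (@measurable_expR R)); apply: measurableT_comp => //.
by apply: measurable_funM => //; exact: measurable_snd.
Qed.

Lemma measurable_heat_kernel b : measurable_fun setT (heat_kernel b : _ -> measurableTypeR R).
Proof.
apply: measurable_funM; first exact: mind.
apply: measurable_funM; first exact: (measurableT_comp (measurable_powR _) measurable_snd).
apply: (measurableT_comp (@measurable_expR R)); apply: measurableT_comp => //.
apply: measurable_funM; first by apply: measurable_funM.
exact: (measurableT_comp (measurable_powR _) measurable_snd).
Qed.

Lemma gauss_kernel_ge0 b p : 0 <= gauss_kernel b p.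
Proof. by rewrite /gauss_kernel indicE !mulr_ge0 ?powR_ge0 ?expR_ge0. Qed.

Lemma heat_kernel_ge0 b p : 0 <= heat_kernel b p.
Proof. by rewrite /heat_kernel indicE !mulr_ge0 ?powR_ge0 ?expR_ge0. Qed.

Lemma dotr_gt0 (y : 'rV[R]_n) : y != 0 -> 0 < dotr y y.
Proof.
by move=> y0; rewrite -sqr_enorm exprn_gt0// enorm_gt0.
Qed.

Lemma dotr_powR (y : 'rV[R]_n) (b : R) : dotr y y `^ b = enorm y `^ (2 * b).
Proof. by rewrite -sqr_enorm -powR_mulrn ?enorm_ge0// -powRrM. Qed.

Lemma integral_gauss_kernel b y : 0 < b -> y != 0 ->
  (\int[mu]_t (gauss_kernel b (y, t))%:E = (Gamma b * enorm y `^ (- (2 * b)))%:E)%E.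
Proof.
move=> b0 y0; rewrite -mulrN -dotr_powR -(integral_gamma_scale b0 (dotr_gt0 y0)).
by rewrite [RHS]integral_indicM; apply: eq_integral => t _; rewrite -EFinM.
Qed.

Lemma integral_heat_kernel b y : 0 < b -> y != 0 ->
  (\int[mu]_t (heat_kernel b (y, t))%:E = (Gamma b * 4 `^ b * enorm y `^ (- (2 * b)))%:E)%E.
Proof.
move=> b0 y0; have d0 := dotr_gt0 y0.
have -> : Gamma b * 4 `^ b * enorm y `^ (- (2 * b)) = Gamma b * (dotr y y / 4) `^ (- b).
  rewrite powRM ?ltW ?invr_gt0// dotr_powR mulrN -mulrA [4 `^ b * _]mulrC; congr (_ * (_ * _)).
  by rewrite -powR_inv1// -powRrM mulN1r opprK.
rewrite -integral_gamma_inv ?divr_gt0// [RHS]integral_indicM; apply: eq_integral => t _.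
rewrite -EFinM /heat_kernel /= indicE; case: (boolP (t \in _)) => [|_]; last by rewrite !mul0r.
by rewrite inE/= in_itv/= andbT => t0; rewrite powR_inv1 ?ltW.
Qed.

End gamma_kernels.

(** * The weak Fourier transform of one homogeneous kernel *)

Section kernel_lemma.
Variables (R : realType) (n : nat).
Notation lam := (lebesgue_rV R n).
Notation mu := (@lebesgue_measure R).
Local Notation pR := (`]0%R, +oo[%classic : set R).
Variables (s : R) (m : nat) (p : 'rV[R]_n -> R) (c : nat -> 'rV[R]_n -> R[i]) (A : R).
Hypotheses (s0 : 0 < s) (sn : 2 * s < n%:R) (n0 : (0 < n)%N).
Hypothesis mp : measurable_fun setT (p : _ -> measurableTypeR R).
Hypothesis ple : forall y, `|p y| <= enorm y ^+ m.
Hypothesis mc : forall k, cmeasurable (c k).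
Hypothesis c0 : forall k xi, (m < k.*2)%N -> c k xi = 0.
Hypothesis cle : forall k xi, (k.*2 <= m)%N -> normc (c k xi) <= A * enorm xi ^+ (m - k.*2).
Hypothesis pc : forall t xi, 0 < t -> gmoment t p xi =
  (\sum_(k < 3) c k xi * ((2 * t)^-1)%:C ^+ (m - k)) * gmoment t (fun=> 1) xi.

Local Notation a := (n%:R + m%:R - 2 * s).
Local Notation b k := (s + m%:R / 2 - k%:R).

(** In the applications p is a monomial of degree m, so the kernel is homogeneous of degree m - a =
    2s - n. *)
Definition riesz_kernel (y : 'rV[R]_n) : R := p y * enorm y `^ (- a).

(** Origin of the factors: pi^(n/2) from the Gaussian transform, 2^(-(m-k)) from the k-pair terms of
    the moment, Gamma(b_k) 4^(b_k) from the t-integral of the heat kernel, and 1/Gamma(a/2) from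
    writing |y|^(-a) as a Gamma integral. *)
Definition kernel_const (k : nat) : R :=
  Num.sqrt pi ^+ n * 2 ^- (m - k) * (Gamma (b k) * 4 `^ b k) / Gamma (a / 2).

Definition kernel_symbol (xi : 'rV[R]_n) : R[i] :=
  \sum_(k < 3) c k xi * (kernel_const k * enorm xi `^ (- (2 * b k)))%:C.

Lemma gauss_order_gt0 : 0 < a / 2.
Proof. by rewrite divr_gt0//; move: (ler0n R m) sn; lra. Qed.

Lemma heat_order_gt0 k : (k.*2 <= m)%N -> 0 < b k.
Proof. by rewrite -(ler_nat R) -muln2 natrM; have := s0; lra. Qed.

Lemma measurable_riesz_kernel : measurable_fun setT (riesz_kernel : _ -> measurableTypeR R).
Proof. by apply: measurable_funM => //; exact: measurable_enorm_powR. Qed.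

Lemma riesz_kernel_le y : `|riesz_kernel y| <= enorm y `^ (- (n%:R - 2 * s)).
Proof.
rewrite normrM [X in _ * X]ger0_norm ?powR_ge0//.
rewrite (le_trans (ler_wpM2r (powR_ge0 _ _) (ple y)))//.
have [->|y0] := eqVneq y 0.
  (* At the origin a power with nonzero exponent has the value 0, so the left side vanishes. *)
  rewrite enorm0 [X in _ * X]powR0 ?mulr0 ?powR_ge0//.
  by rewrite oppr_eq0; move: gauss_order_gt0; lra.
have e0 : 0 < enorm y by rewrite enorm_gt0.
rewrite -powR_mulrn ?enorm_ge0// -powRD; last by rewrite (gt_eqF e0) implybT.
by rewrite le_eqVlt; apply/orP; left; apply/eqP; congr (_ `^ _); ring.
Qed.

(** The growth m - 2k of the coefficient and the order -2 b_k of the heat integral add up to -2s for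
    every k, so all terms of the symbol have the same homogeneity. *)
Lemma heat_order_powR k (xi : 'rV[R]_n) : (k.*2 <= m)%N -> xi != 0 ->
  enorm xi ^+ (m - k.*2) * enorm xi `^ (- (2 * b k)) = enorm xi `^ (- (2 * s)) .
Proof.
move=> km xi0; have e0 : 0 < enorm xi by rewrite enorm_gt0.
rewrite -powR_mulrn ?enorm_ge0// -powRD; last by rewrite (gt_eqF e0) implybT.
by congr (_ `^ _); rewrite natrB// -muln2 natrM; field.
Qed.

Lemma kernel_symbol_le xi : normc (kernel_symbol xi) <=
  (`|A| * \sum_(k < 3) `|kernel_const k|) * enorm xi `^ (- (2 * s)).
Proof.
rewrite /kernel_symbol.
have H (k : nat) : normc (c k xi * (kernel_const k * enorm xi `^ (- (2 * b k)))%:C) <=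
    `|A| * `|kernel_const k| * enorm xi `^ (- (2 * s)).
  have [mk|km] := ltnP m k.*2.
    by rewrite c0// mul0r Normc.normc0 !mulr_ge0 ?powR_ge0.
  have [->|xi0] := eqVneq xi 0.
    rewrite enorm0 powR0 ?mulr0 ?Normc.normc0 ?mulr_ge0 ?powR_ge0//.
    by rewrite oppr_eq0 mulf_neq0 ?pnatr_eq0// gt_eqF// heat_order_gt0.
  rewrite -(heat_order_powR km xi0) Normc.normcM normc_real normrM [`|_ `^ _|]ger0_norm ?powR_ge0//.
  rewrite mulrA mulrA ler_wpM2r ?powR_ge0// mulrAC ler_wpM2r// (le_trans (cle xi km))//.
  by rewrite ler_wpM2r ?exprn_ge0 ?enorm_ge0 ?ler_norm.
rewrite mulr_sumr mulr_suml; apply: (big_ind2 (fun z r => normc z <= r)) => //.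
  by rewrite Normc.normc0.
by move=> z r z' r' zr zr'; rewrite (le_trans (le_normcD _ _))// lerD.
Qed.

Lemma cmeasurable_kernel_symbol : cmeasurable kernel_symbol.
Proof.
apply: cmeasurable_sum => k; apply: cmeasurableM => //.
by apply: cmeasurable_real; apply: measurable_funM => //; exact: measurable_enorm_powR.
Qed.

(** Bookkeeping of exponents of t: (a/2 - 1) - (m - k) - n/2 = -b_k - 1, which is the exponent of
    [heat_kernel]. *)
Lemma heat_powR (t : R) k : 0 < t -> (k.*2 <= m)%N ->
  t `^ (a / 2 - 1) * (2 * t)^-1 ^+ (m - k) * (Num.sqrt pi / Num.sqrt t) ^+ n =
  2 ^- (m - k) * Num.sqrt pi ^+ n * t `^ (- b k - 1).
Proof.
move=> t0 km.
have -> : (2 * t)^-1 ^+ (m - k) = 2 ^- (m - k) * t `^ (- (m - k)%:R).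
  by rewrite powR_invn ?ltW// invfM exprMn !exprVn.
have -> : (Num.sqrt pi / Num.sqrt t) ^+ n = Num.sqrt pi ^+ n * t `^ (- (n%:R / 2)).
  rewrite exprMn exprVn; congr (_ * _).
  by rewrite -powR12_sqrt ?ltW// -powR_mulrn ?powR_ge0// -powRrM mulrC -powRN.
have -> : t `^ (- b k - 1) = t `^ (a / 2 - 1) * t `^ (- (m - k)%:R) * t `^ (- (n%:R / 2)).
  rewrite -!powRD; try by rewrite (gt_eqF t0) implybT.
  congr (_ `^ _); rewrite natrB; last by rewrite (leq_trans _ km)// -addnn leq_addr.
  by field.
ring.
Qed.

Variables (f : 'rV[R]_n -> R[i]) (M : R).
Hypothesis fi : cintegrable lam f.
Hypothesis fM : forall x, normc (f x) <= M.
Variable phi : 'rV[R]_n -> R[i].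
Hypothesis hphi : schwartz phi.

Lemma fourier_cintegrable : cintegrable lam (fourier phi).
Proof.
have [C hC] := ft_decay hphi.
apply: (@cintegrable_le _ _ _ _ _ (fun xi : 'rV[R]_n => C * \prod_(i < n) (oneDsqr (xi ord0 i))^-1)).
- rewrite (funext (fourierE phi)); apply: (cmeasurable_comp (cmeasurable_ft (schwartz_cmeasurable hphi [::]))).
  exact: measurable_rV_opp.
- move=> xi; rewrite fourierE (le_trans (hC _))// le_eqVlt; apply/orP; left; apply/eqP; congr (_ * _).
  by apply: eq_bigr => i _; rewrite mxE /oneDsqr sqrrN.
- by apply: integrableZR; exact: integrable_prod_oneDsqrV.
Qed.

Let w (xi : 'rV[R]_n) : R[i] := ft f (- xi) * phi xi.

Let ftf_le xi : normc (ft f xi) <= 2 * \int[lam]_x normc (f x).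
Proof. exact: le_normc_ft. Qed.

Let mftf : cmeasurable (fun xi : 'rV[R]_n => ft f (- xi)).
Proof.
apply: (cmeasurable_comp (cmeasurable_ft (cintegrable_cmeasurable fi))).
exact: measurable_rV_opp.
Qed.

Let iw : cintegrable lam w.
Proof.
apply: (cintegrable_bounded mftf) => //; exact: schwartz_cintegrable.
Qed.

Let h y := cintegral lam setT (fun x => f (x + y) * fourier phi x).

(** The multiplication formula moves the transform from phi to the translate of f, and the
    translation becomes the exponential that makes the result a transform in y. *)
Let hE y : h y = ft (offzero w) y.
Proof.
have ify : cintegrable lam (fun x => f (x + y)).
  by apply/cintegrable_rV_shift => //; exact: cintegrable_cmeasurable fi.
transitivity (cintegral lam setT (fun x => f (x + y) * ft phi (-1 *: x))).
  by apply: eq_cintegral => x; rewrite fourierE scaleN1r.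
rewrite ft_product//; last exact: schwartz_cintegrable.
transitivity (ft w y).
  apply: eq_cintegral => xi; rewrite ft_shift// scaleN1r /w.
  rewrite dotrC dotrN opprK; ring.
apply: cintegral_offzero => //; [exact: cintegrable_cmeasurable (cintegrable_cis _ iw)| |].
  apply: cmeasurableM; last exact: cmeasurable_cis_dotr.
  by apply: cmeasurable_offzero; exact: cintegrable_cmeasurable iw.
by move=> xi xi0; rewrite offzeroE.
Qed.

Let ksn : 0 <= n%:R - 2 * s.
Proof. by rewrite subr_ge0 ltW. Qed.

Let knn : n%:R - 2 * s < n%:R.
Proof. by move: s0; lra. Qed.

Let iKh : cintegrable lam (fun y => (riesz_kernel y)%:C * h y).
Proof.
exact: (correlation_dual_integrable n0 ksn knn measurable_riesz_kernel riesz_kernel_le fi fM fourier_cintegrable).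
Qed.

Let mh : cmeasurable h.
Proof.
rewrite (funext hE); apply: cmeasurable_ft; apply: cmeasurable_offzero.
exact: cintegrable_cmeasurable iw.
Qed.

Let subordination : cintegral mu setT (fun t => cintegral lam setT (fun y =>
    offzero (fun y => (p y)%:C * h y) y * (gauss_kernel (a / 2) (y, t))%:C)) =
  (Gamma (a / 2))%:C * cintegral lam setT (fun y => (riesz_kernel y)%:C * h y).
Proof.
(* A one-term sum, so that [fubini_sum] serves both here and for the three-term sum on the frequency
   side. *)
pose v (i : 'I_1) := offzero (fun y => (p y)%:C * h y).
have mv i : cmeasurable (v i).
  by apply: cmeasurable_offzero; apply: cmeasurableM => //; exact: cmeasurable_real.
have gk i y : v i y != 0 -> (\int[mu]_t (gauss_kernel (a / 2) (y, t))%:E =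
    (Gamma (a / 2) * enorm y `^ (- (2 * (a / 2))))%:E)%E.
  move=> vy; apply: integral_gauss_kernel; first exact: gauss_order_gt0.
  by apply: contraNneq vy => ->; rewrite /v offzero0.
have aE : 2 * (a / 2) = a by field.
have vE (i : 'I_1) y : v i y * (Gamma (a / 2) * enorm y `^ (- (2 * (a / 2))))%:C =
    (Gamma (a / 2))%:C * ((riesz_kernel y)%:C * h y).
  rewrite aE; have [->|y0] := eqVneq y 0.
    rewrite /v offzero0 /riesz_kernel enorm0 powR0 ?mulr0 ?mul0r ?mulr0//.
    by rewrite oppr_eq0; move: gauss_order_gt0; lra.
  by rewrite /v offzeroE// /riesz_kernel !rmorphM/=; ring.
have ik i : lam.-integrable setT (fun y => (normc (v i y) * (Gamma (a / 2) * enorm y `^ (- (2 * (a / 2)))))%:E).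
  have := integrableZR (Gamma (a / 2)) (integrable_normc iKh); apply: eq_integrable => // y _; congr EFin.
  have G0 := ltW (Gamma_gt0 gauss_order_gt0).
  rewrite -[X in X * _ = _]ger0_norm// -normc_real -Normc.normcM -(vE i) Normc.normcM normc_real ger0_norm//.
  by rewrite mulr_ge0// powR_ge0.
have := fubini_sum mv (fun _ => measurable_gauss_kernel _) (fun _ => gauss_kernel_ge0 _) gk ik.
under eq_cintegral do under eq_cintegral do rewrite big_ord1.
move=> ->; rewrite -cintegralZ//; apply: eq_cintegral => y; rewrite big_ord1; exact: (vE ord0).
Qed.

Let heat_coef (k : 'I_3) (xi : 'rV[R]_n) : R[i] :=
  offzero w xi * c k xi * (2 ^- (m - k) * Num.sqrt pi ^+ n)%:C.

Let mw0 : cmeasurable (offzero w).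
Proof. by apply: cmeasurable_offzero; exact: cintegrable_cmeasurable iw. Qed.

Let iw0 : cintegrable lam (offzero w).
Proof. exact: cintegrable_le (normc_offzero w) (integrable_normc iw). Qed.

Let hM y : normc (h y) <= 2 * \int[lam]_xi normc (offzero w xi).
Proof. by rewrite hE; exact: le_normc_ft. Qed.

Let ppoly : polybounded p.
Proof.
exists 1, m => y; rewrite mul1r (le_trans (ple y))// lerXn2r ?nnegrE ?enorm_ge0//.
  by rewrite ltW// onePenorm_gt0.
by rewrite lerDr.
Qed.

(** For fixed t > 0 the multiplication formula exchanges the polynomial Gaussian for its explicit
    transform, whose powers of t assemble into heat kernels. For t <= 0 the indicators make both
    sides vanish. *)
Let slice (t : R) : 
  cintegral lam setT (fun y => offzero (fun y => (p y)%:C * h y) y * (gauss_kernel (a / 2) (y, t))%:C) =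
  cintegral lam setT (fun xi => \sum_(k < 3) heat_coef k xi * (heat_kernel (b k) (xi, t))%:C).
Proof.
have [t0|t0] := leP t 0.
  have z : \1_pR t = 0 :> R.
    by rewrite indicE memNset//= in_itv/= andbT; apply/negP; rewrite -leNgt.
  apply: eq_cintegral => y; rewrite /gauss_kernel/= z mul0r mulr0 big1// => k _.
  by rewrite /heat_kernel/= z mul0r mulr0.
have z : \1_pR t = 1 :> R by rewrite indicE mem_set//= in_itv/= t0.
pose tau : R := t `^ (a / 2 - 1).
pose u (y : 'rV[R]_n) : R[i] := tau%:C * (p y * gaussian t y)%:C.
have ig := pgaussian_cintegrable t0 mp ppoly.
have iu : cintegrable lam u by exact: cintegrableZ.
transitivity (cintegral lam setT (fun y => u y * ft (offzero w) (1 *: y))).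
  apply: (cintegral_offzero n0).
  - apply: cmeasurableM.
      by apply: cmeasurable_offzero; apply: cmeasurableM => //; exact: cmeasurable_real.
    apply: cmeasurable_real.
    exact: (measurableT_comp (measurable_gauss_kernel _) (@measurable_pair2 _ _ _ _ t)).
  - apply: cmeasurableM; first exact: cintegrable_cmeasurable iu.
    by under eq_fun do rewrite scale1r; exact: cmeasurable_ft.
  - move=> y y0; rewrite offzeroE// scale1r -hE /u /gauss_kernel/= z mul1r -/tau.
    rewrite /gaussian (mulrC t) !rmorphM/=; ring.
rewrite ft_product//; apply: eq_cintegral => xi; rewrite scale1r.
have -> : ft u xi = tau%:C * gmoment t p xi.
  rewrite /gmoment /ft -cintegralZ; last exact: cintegrable_cis.
  by apply: eq_cintegral => y; rewrite /u mulrA.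
rewrite pc// gaussian_ft// mulrCA mulr_suml !mulr_sumr; apply: eq_bigr => k _.
rewrite /heat_coef.
have [mk|km] := ltnP m k.*2; first by rewrite c0// !(mul0r, mulr0).
rewrite /heat_kernel/= z mul1r powR_inv1 ?ltW//.
have -> : - (dotr xi xi / 4 * t^-1) = - (dotr xi xi / (4 * t)) by rewrite invfM mulrA.
have H : tau%:C * ((2 * t)^-1)%:C ^+ (m - k) * ((Num.sqrt pi / Num.sqrt t) ^+ n)%:C =
    (2 ^- (m - k) * Num.sqrt pi ^+ n)%:C * (t `^ (- b k - 1))%:C :> R[i].
  by rewrite -rmorphXn -!rmorphM/= heat_powR.
transitivity (offzero w xi * c k xi * (expR (- (dotr xi xi / (4 * t))))%:C *
    (tau%:C * ((2 * t)^-1)%:C ^+ (m - k) * ((Num.sqrt pi / Num.sqrt t) ^+ n)%:C)).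
  by rewrite (rmorphM _ _ (expR _))/=; ring.
by rewrite H (rmorphM _ _ (expR _))/=; ring.
Qed.

Let integrable_symbol_bound :
  lam.-integrable setT (fun xi => (enorm xi `^ (- (2 * s)) * normc (w xi))%:E).
Proof.
have [_ /(_ [::] 0)[N hN]] := hphi.
have wM xi : normc (w xi) <= 2 * (\int[lam]_x normc (f x)) * N.
  rewrite Normc.normcM ler_pM ?normc_ge0//.
  by have := hN xi; rewrite expr0 mul1r.
apply: (integrable_powRM n0 _ sn (M := 2 * (\int[lam]_x normc (f x)) * N)).
- by rewrite mulr_ge0// ltW.
- by move=> y; rewrite normc_ge0 wM.
- exact: integrable_normc.
Qed.

(** Multiplied by Gamma(a/2), the left side is an integral over t of Gaussian slices. Each slice is
    transformed exactly, and integrating the resulting heat kernels in t gives back powers of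
    |xi|. *)
Lemma kernel_fourier :
  cintegral lam setT (fun x => correlation riesz_kernel f x * fourier phi x) =
  cintegral lam setT (fun xi => kernel_symbol xi * fourier f xi * phi xi).
Proof.
have G0 : (Gamma (a / 2))%:C != 0 :> R[i].
  by rewrite fmorph_eq0 gt_eqF// Gamma_gt0// gauss_order_gt0.
rewrite (cintegral_correlation n0 ksn knn measurable_riesz_kernel riesz_kernel_le fi fM fourier_cintegrable).
apply: (mulfI G0); rewrite -subordination.
under eq_cintegral do rewrite slice.
have mcoef k : cmeasurable (heat_coef k).
  by apply: cmeasurableM; [exact: cmeasurableM|exact: cmeasurable_cst].
have coef0 k xi : heat_coef k xi != 0 -> xi != 0 /\ ((k : nat).*2 <= m)%N.
  move=> h0; split; first by apply: contraNneq h0 => ->; rewrite /heat_coef offzero0 !mul0r.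
  by rewrite leqNgt; apply/negP => mk; move: h0; rewrite /heat_coef c0// mulr0 mul0r eqxx.
have gk (k : 'I_3) xi : heat_coef k xi != 0 -> (\int[mu]_t (heat_kernel (b k) (xi, t))%:E =
    (Gamma (b k) * 4 `^ b k * enorm xi `^ (- (2 * b k)))%:E)%E.
  by move=> /coef0[xi0 km]; apply: integral_heat_kernel => //; exact: heat_order_gt0.
have ik (k : 'I_3) : lam.-integrable setT (fun xi => (normc (heat_coef k xi) *
    (Gamma (b k) * 4 `^ b k * enorm xi `^ (- (2 * b k))))%:E).
  (* The polynomial growth of the coefficient is absorbed by the negative power, leaving |xi|^(-2s)
     |w|, integrable because 2s < n and w is bounded and integrable. *)
  pose D : R := `|A| * `|2 ^- (m - k) * Num.sqrt pi ^+ n| * `|Gamma (b k) * 4 `^ b k|.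
  apply: (@le_integrableR _ _ _ _ _ (fun xi => D * (enorm xi `^ (- (2 * s)) * normc (w xi)))).
  - apply: measurable_funM; first exact: cmeasurable_normc.
    by apply: measurable_funM => //; exact: measurable_enorm_powR.
  - move=> xi.
    have [->|/coef0[xi0 km]] := eqVneq (heat_coef k xi) 0.
      by rewrite Normc.normc0 mul0r normr0 !mulr_ge0 ?powR_ge0 ?normc_ge0.
    rewrite normrM [`|normc _|]ger0_norm ?normc_ge0// [X in _ * X]normrM [`|_ `^ (- (2 * b k))|]ger0_norm ?powR_ge0//.
    rewrite /heat_coef offzeroE// !Normc.normcM normc_real -(heat_order_powR km xi0) /D.
    have := le_trans (cle xi km) (ler_wpM2r (exprn_ge0 _ (enorm_ge0 xi)) (ler_norm A)).
    move: (normc (c k xi)) (enorm xi ^+ _) (enorm xi `^ _) (powR_ge0 (enorm xi) (- (2 * b k))) => cc ee qq q0 ce.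
    set k1 := `|2 ^- (m - k) * Num.sqrt pi ^+ n|; set k2 := `|Gamma (b k) * 4 `^ b k|.
    have k10 : 0 <= k1 := normr_ge0 _.
    have k20 : 0 <= k2 := normr_ge0 _.
    move: k1 k2 k10 k20 => k1 k2 k10 k20.
    rewrite -[in leLHS]Normc.normcM -[in leRHS]Normc.normcM -/(w xi).
    have -> : normc (w xi) * cc * k1 * (k2 * qq) = k1 * k2 * normc (w xi) * qq * cc by ring.
    have -> : `|A| * k1 * k2 * (ee * qq * normc (w xi)) = k1 * k2 * normc (w xi) * qq * (`|A| * ee) by ring.
    by apply: ler_wpM2l => //; apply: mulr_ge0 => //; apply: mulr_ge0; [exact: mulr_ge0|exact: normc_ge0].
  - by apply: integrableZR; exact: integrable_symbol_bound.
rewrite (fubini_sum mcoef (fun k => measurable_heat_kernel (b k)) (fun k => heat_kernel_ge0 (b k)) gk ik).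
have mphi := schwartz_cmeasurable hphi [::].
have mS : cmeasurable (fun xi => kernel_symbol xi * fourier f xi * phi xi).
  apply: cmeasurableM => //; apply: cmeasurableM; first exact: cmeasurable_kernel_symbol.
  by rewrite (funext (fourierE f)).
rewrite -cintegralZ; last first.
  apply: (cintegrable_le mS _ (integrableZR (`|A| * \sum_(k < 3) `|kernel_const k|) integrable_symbol_bound)) => xi.
  rewrite -mulrA Normc.normcM fourierE mulrA.
  by rewrite ler_wpM2r ?normc_ge0// kernel_symbol_le.
apply: (cintegral_offzero n0).
- apply: cmeasurable_sum => k; apply: cmeasurableM; first exact: mcoef.
  apply: cmeasurable_real; apply: measurable_funM => //; exact: measurable_enorm_powR.
- by apply: cmeasurableM => //; exact: cmeasurable_cst.
move=> xi xi0; rewrite /kernel_symbol !mulr_suml mulr_sumr; apply: eq_bigr => k _.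
rewrite /heat_coef offzeroE// /w fourierE /kernel_const.
have E : 2 ^- (m - k) * Num.sqrt pi ^+ n * (Gamma (b k) * 4 `^ b k * enorm xi `^ (- (2 * b k))) =
    Gamma (a / 2) * (Num.sqrt pi ^+ n * 2 ^- (m - k) * (Gamma (b k) * 4 `^ b k) / Gamma (a / 2) *
      enorm xi `^ (- (2 * b k))).
  have : Gamma (a / 2) != 0 by rewrite gt_eqF// Gamma_gt0// gauss_order_gt0.
  by move: (Gamma (a / 2)) (2 ^- (m - k)) => ga u ga0; field.
rewrite -[LHS]mulrA -rmorphM [X in _ * X](congr1 (fun z : R => z%:C) E) rmorphM/=.
rewrite [LHS]mulrCA; congr (_ * _); ring.
Qed.

End kernel_lemma.

(** * Fourier pairs of tempered distributions *)

Section fourier_pairs.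
Variables (R : realType) (n : nat).
Hypothesis n0 : (0 < n)%N.
Notation lam := (lebesgue_rV R n).
Implicit Types (T U : functional R n) (g h : 'rV[R]_n -> R[i]).

Lemma tempered_fun_cmeasurable g : tempered_fun g -> cmeasurable g.
Proof. by case=> g1 g2 _; split. Qed.

Lemma tempered_funP g : tempered_fun g <->
  cmeasurable g /\ exists N : nat, lam.-integrable setT (fun x => (normc (g x) / (1 + enorm x) ^+ N)%:E).
Proof. by split=> [[? ? ?]|[[? ?] ?]]; split. Qed.

Lemma schwartz_le (phi : 'rV[R]_n -> R[i]) N : schwartz phi -> exists M : R, 0 <= M /\ forall x,
  (1 + enorm x) ^+ N * normc (phi x) <= M.
Proof.
move=> [_ /(_ [::] N)[M hM]]; exists M; split => //.
by apply: le_trans (hM 0); rewrite mulr_ge0 ?normc_ge0// exprn_ge0// ltW// onePenorm_gt0.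
Qed.

Lemma tempered_fun_cintegrable g phi : tempered_fun g -> schwartz phi ->
  cintegrable lam (fun x => g x * phi x).
Proof.
move=> /tempered_funP[mg [N iN]] hphi; have [M [M0 hM]] := schwartz_le N hphi.
apply: (cintegrable_le _ _ (integrableZR M iN)).
  by apply: cmeasurableM => //; exact: (schwartz_cmeasurable hphi [::]).
move=> x; have e0 : 0 < (1 + enorm x) ^+ N by rewrite exprn_gt0// onePenorm_gt0.
rewrite Normc.normcM mulrCA ler_wpM2l ?normc_ge0// ler_pdivlMr// mulrC; exact: hM.
Qed.

Lemma tempered_fun_lin (a : R[i]) g h : tempered_fun g -> tempered_fun h ->
  tempered_fun (fun x => a * g x + h x).
Proof.
move=> /tempered_funP[mg [N iN]] /tempered_funP[mh [N' iN']]; apply/tempered_funP.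
have m1 : cmeasurable (fun x => a * g x + h x).
  by apply: cmeasurableD => //; apply: cmeasurableM => //; exact: cmeasurable_cst.
split=> //; exists (N + N')%N.
apply: (@le_integrableR _ _ _ _ _ (fun x => normc a * (normc (g x) / (1 + enorm x) ^+ N) +
   normc (h x) / (1 + enorm x) ^+ N')).
- by apply: measurable_funM; [exact: cmeasurable_normc|exact: measurable_onePenorm_exp].
- move=> x; have e1 := onePenorm_ge1 x; have e0 := onePenorm_gt0 x.
  rewrite ger0_norm ?divr_ge0 ?normc_ge0 ?exprn_ge0 ?(ltW e0)//.
  rewrite (le_trans (ler_wpM2r _ (le_normcD _ _))) ?invr_ge0 ?exprn_ge0 ?(ltW e0)//.
  rewrite Normc.normcM mulrDl lerD//.
    rewrite -mulrA ler_wpM2l ?normc_ge0// ler_wpM2l ?normc_ge0// lef_pV2 ?posrE ?exprn_gt0//.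
    by rewrite ler_weXn2l// leq_addr.
  by rewrite ler_wpM2l ?normc_ge0// lef_pV2 ?posrE ?exprn_gt0// ler_weXn2l// leq_addl.
- under eq_fun do rewrite EFinD.
  by apply: integrableD => //; exact: integrableZR.
Qed.

Lemma tempered_fun_offzero g h : tempered_fun g -> cmeasurable h ->
  (forall x, x != 0 -> g x = h x) -> tempered_fun h.
Proof.
move=> /tempered_funP[mg [N iN]] mh gh; apply/tempered_funP; split=> //; exists N.
have m1 (k : 'rV[R]_n -> R[i]) : cmeasurable k ->
    measurable_fun setT (fun x => normc (k x) / (1 + enorm x) ^+ N : measurableTypeR R).
  by move=> mk; apply: measurable_funM; [exact: cmeasurable_normc|exact: measurable_onePenorm_exp].
have /integrableP[_ fin] := iN; apply/integrableP; split; first by apply/measurable_EFinP; exact: m1.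
rewrite (_ : (\int[_]_(_ in _) _)%E = \int[lam]_x `|(normc (g x) / (1 + enorm x) ^+ N)%:E|)%E//.
apply: ae_eq_integral => //.
- by apply: measurableT_comp => //; apply/measurable_EFinP; exact: m1.
- by apply: measurableT_comp => //; apply/measurable_EFinP; exact: m1.
exists [set 0]; split; [exact: measurable_rV_set0|exact: lebesgue_rV_set0|].
move=> x /= nx; apply/eqP; apply: contrapT => /negP x0; apply: nx => _.
by rewrite gh.
Qed.

(** Both distributions in [fourier_multiplier] are described by such pairs, with symbols g and m g;
    pairs are stable under linear combinations, multipliers are then read off. *)
Definition fourier_pair T g :=
  [/\ tempered T, tempered_fun g & eq_dist (fourier_dist T) (dist_of g)].

Lemma dist_of_lin (a : R[i]) g h phi : tempered_fun g -> tempered_fun h -> schwartz phi ->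
  dist_of (fun x => a * g x + h x) phi = a * dist_of g phi + dist_of h phi.
Proof.
move=> tg th hphi; rewrite /dist_of -cintegralZ; last exact: tempered_fun_cintegrable.
rewrite -cintegralD; last 2 first.
- by apply: cintegrableZ; exact: tempered_fun_cintegrable.
- exact: tempered_fun_cintegrable.
by apply: eq_cintegral => x; rewrite mulrDl mulrA.
Qed.

Lemma tempered_lin (a : R[i]) T U : tempered T -> tempered U ->
  tempered (fun phi => a * T phi + U phi).
Proof.
move=> [lT [C [N bT]]] [lU [C' [N' bU]]]; split.
  by move=> b phi psi hp hq; rewrite lT// lU//; ring.
exists (normc a * C + C'), (N + N')%N => phi hphi M hM.
have weaken k : (k <= N + N')%N -> forall l : seq 'I_n, (size l <= k)%N -> forall x : 'rV[R]_n,
    (1 + enorm x) ^+ k * normc (cpartials l phi x) <= M.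
  move=> kN l lk x; apply: le_trans (hM l (leq_trans lk kN) x).
  by rewrite ler_wpM2r ?normc_ge0// ler_weXn2l// onePenorm_ge1.
rewrite (le_trans (le_normcD _ _))// Normc.normcM mulrDl lerD//.
  rewrite -mulrA ler_wpM2l ?normc_ge0//; apply: bT => //; apply: weaken; exact: leq_addr.
by apply: bU => //; apply: weaken; exact: leq_addl.
Qed.

Lemma fourier_pair_lin (a : R[i]) T U g h : fourier_pair T g -> fourier_pair U h ->
  fourier_pair (fun phi => a * T phi + U phi) (fun xi => a * g xi + h xi).
Proof.
move=> [tT tg eT] [tU th eU]; split; [exact: tempered_lin|exact: tempered_fun_lin|].
move=> phi hphi; rewrite dist_of_lin// /fourier_dist.
by congr (_ * _ + _); [exact: eT|exact: eU].
Qed.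

(** The origin is a null set, so identities between powers of |xi| that fail there because of
    default values can still be used to rewrite a symbol. *)
Lemma fourier_pair_offzero T g h : fourier_pair T g -> cmeasurable h ->
  (forall xi, xi != 0 -> g xi = h xi) -> fourier_pair T h.
Proof.
move=> [tT tg eT] mh gh; split => //; first exact: tempered_fun_offzero gh.
move=> phi hphi; rewrite eT//; apply: cintegral_offzero => //.
- apply: cmeasurableM; [exact: tempered_fun_cmeasurable|exact: (schwartz_cmeasurable hphi [::])].
- by apply: cmeasurableM => //; exact: (schwartz_cmeasurable hphi [::]).
- by move=> xi xi0; rewrite gh.
Qed.

Lemma tempered_zero : tempered ((fun=> 0) : functional R n).
Proof.
split; first by move=> *; rewrite mulr0 addr0.
by exists 0, 0%N => *; rewrite mul0r Normc.normc0.
Qed.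

Lemma tempered_fun0 : tempered_fun ((fun=> 0) : 'rV[R]_n -> R[i]).
Proof.
apply/tempered_funP; split; first exact: cmeasurable_cst.
exists 0%N; under eq_fun do rewrite Normc.normc0 mul0r; exact: integrable0.
Qed.

Lemma fourier_pair0 : fourier_pair (fun=> 0) (fun=> 0).
Proof.
split; [exact: tempered_zero|exact: tempered_fun0|].
move=> phi _; rewrite /fourier_dist /dist_of.
by rewrite (_ : (fun _ => _) = (fun=> (0 : R)%:C)) ?cintegral_real ?/Rintegral ?integral0//; apply/funext => x; rewrite mul0r.
Qed.

Lemma fourier_pair_sum I (r : seq I) (T : I -> functional R n) (g : I -> 'rV[R]_n -> R[i]) :
  (forall i, fourier_pair (T i) (g i)) ->
  fourier_pair (fun phi => \sum_(i <- r) T i phi) (fun xi => \sum_(i <- r) g i xi).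
Proof.
move=> H; elim: r => [|i r IH].
  rewrite (_ : (fun phi => _) = fun=> 0); last by apply/funext => phi; rewrite big_nil.
  rewrite (_ : (fun xi => _) = fun=> 0); first exact: fourier_pair0.
  by apply/funext => xi; rewrite big_nil.
rewrite (_ : (fun phi => _) = fun phi => 1 * T i phi + \sum_(i <- r) T i phi); last first.
  by apply/funext => phi; rewrite big_cons mul1r.
rewrite (_ : (fun xi => _) = fun xi => 1 * g i xi + \sum_(i <- r) g i xi); last first.
  by apply/funext => xi; rewrite big_cons mul1r.
exact: fourier_pair_lin.
Qed.

Lemma fourier_pairZ (a : R[i]) T g : fourier_pair T g ->
  fourier_pair (fun phi => a * T phi) (fun xi => a * g xi).
Proof.
move=> H; have := fourier_pair_lin a H fourier_pair0.
by under eq_fun do rewrite addr0; under [X in fourier_pair _ X]eq_fun do rewrite addr0.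
Qed.

Lemma tempered_bounded g (M : R) : cmeasurable g -> (forall x, normc (g x) <= M) ->
  tempered_fun g.
Proof.
move=> mg gM; apply/tempered_funP; split => //; exists n.*2.
apply: (le_integrableR _ _ (integrableZR M (integrable_rV_weight R n))).
  by apply: measurable_funM; [exact: cmeasurable_normc|exact: measurable_onePenorm_exp].
move=> x; rewrite ger0_norm; last first.
  by rewrite divr_ge0 ?normc_ge0 ?exprn_ge0// ltW// onePenorm_gt0.
by rewrite ler_wpM2r// invr_ge0 exprn_ge0// ltW// onePenorm_gt0.
Qed.

Lemma tempered_dist_of_bounded g (M : R) : cmeasurable g -> (forall x, normc (g x) <= M) ->
  tempered (dist_of g).
Proof.
move=> mg gM; have tg := tempered_bounded mg gM; split.
  move=> a phi psi hp hq; rewrite /dist_of -cintegralZ; last exact: tempered_fun_cintegrable.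
  rewrite -cintegralD; last 2 first.
  - by apply: cintegrableZ; exact: tempered_fun_cintegrable.
  - exact: tempered_fun_cintegrable.
  by apply: eq_cintegral => x; rewrite mulrDr mulrCA.
exists (2 * (M * \int[lam]_x rV_weight x)), n.*2 => phi hphi B hB.
have M0 : 0 <= M by exact: le_trans (normc_ge0 _) (gM 0).
have -> : 2 * (M * \int[lam]_x rV_weight x) * B = 2 * \int[lam]_x (M * B * rV_weight x).
  by rewrite RintegralZl//; [ring|exact: integrable_rV_weight].
apply: le_normc_cintegral.
- exact: cintegrable_cmeasurable (tempered_fun_cintegrable tg hphi).
- move=> x; rewrite Normc.normcM -mulrA ler_pM ?normc_ge0// ler_pdivlMr ?exprn_gt0 ?onePenorm_gt0//.
  by rewrite mulrC; exact: (hB [::]).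
- by apply: integrableZR; exact: integrable_rV_weight.
Qed.

(** The multiplication formula with sign -1. Boundedness of g makes its distribution tempered,
    integrability makes its transform bounded. *)
Lemma fourier_pair_dist_of g : cintegrable lam g -> (exists M : R, forall x, normc (g x) <= M) ->
  fourier_pair (dist_of g) (fourier g).
Proof.
move=> ig [M gM]; have mg := cintegrable_cmeasurable ig.
have mF : cmeasurable (fourier g).
  rewrite (funext (fourierE g)).
  exact: (cmeasurable_comp (cmeasurable_ft mg) (@measurable_rV_opp _ _)).
split.
- exact: tempered_dist_of_bounded gM.
- apply: (@tempered_bounded _ (2 * \int[lam]_x normc (g x))) => // xi.
  by rewrite fourierE; exact: le_normc_ft.
- move=> phi hphi; rewrite /fourier_dist /dist_of.
  under eq_cintegral do rewrite fourierE -scaleN1r.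
  rewrite ft_product//; last exact: schwartz_cintegrable.
  by apply: eq_cintegral => x; rewrite fourierE scaleN1r mulrC.
Qed.

Lemma fourier_multiplierP (m : 'rV[R]_n -> R[i]) T U g :
  fourier_pair T g -> fourier_pair U (fun xi => m xi * g xi) -> fourier_multiplier m T U.
Proof. by move=> [tT tg eT] [tU tU' eU]; split=> //; exists g; split. Qed.

End fourier_pairs.

Section bounded_measurable.
Variables (R : realType) (n : nat).
Implicit Types d : 'rV[R]_n -> R[i].

Definition cbounded_measurable d := cmeasurable d /\ exists A : R, forall x, normc (d x) <= A.
Local Notation cbm := cbounded_measurable.

Lemma cbm_cst z : cbm (fun=> z).
Proof. by split; [exact: cmeasurable_cst|exists (normc z)]. Qed.

Lemma cbmD d d' : cbm d -> cbm d' -> cbm (fun x => d x + d' x).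
Proof.
move=> [m [A hA]] [m' [A' hA']]; split; first exact: cmeasurableD.
by exists (A + A') => x; rewrite (le_trans (le_normcD _ _))// lerD.
Qed.

Lemma cbmM d d' : cbm d -> cbm d' -> cbm (fun x => d x * d' x).
Proof.
move=> [m [A hA]] [m' [A' hA']]; split; first exact: cmeasurableM.
by exists (A * A') => x; rewrite Normc.normcM ler_pM ?normc_ge0.
Qed.

(* The Riesz transform R_i has symbol - idir xi i. *)
Definition idir (xi : 'rV[R]_n) i : R[i] := ixi (normalize xi) i.

Lemma normalize_coord (x : 'rV[R]_n) i : normalize x ord0 i = x ord0 i / enorm x.
Proof. by rewrite mxE mulrC. Qed.

Lemma normalize_coord_le (x : 'rV[R]_n) i : `|normalize x ord0 i| <= 1.
Proof.
rewrite normalize_coord normrM normfV [`|enorm x|]ger0_norm ?enorm_ge0//.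
have [->|x0] := eqVneq x 0; first by rewrite mxE normr0 mul0r.
by rewrite ler_pdivrMr ?mul1r ?coord_le_enorm// enorm_gt0.
Qed.

Lemma cbm_idir i : cbm (fun xi => idir xi i).
Proof.
split.
  apply: cmeasurableM; first exact: cmeasurable_cst.
  apply: cmeasurable_real.
  exact: (measurableT_comp (@measurable_coord _ _ _) (@measurable_normalize R n)).
exists (normc ('i : R[i])) => xi; rewrite /idir /ixi Normc.normcM normc_real -[leRHS]mulr1.
by rewrite ler_wpM2l ?normc_ge0// normalize_coord_le.
Qed.

Lemma ixiE xi i : ixi xi i = (enorm xi)%:C * idir xi i.
Proof.
rewrite /idir /ixi mulrCA -rmorphM/= normalize_coord; congr (_ * _%:C).
have [->|x0] := eqVneq xi 0; first by rewrite enorm0 mul0r mxE.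
by rewrite mulrC divfK// enorm_eq0.
Qed.

End bounded_measurable.

(** * Symbols of monomial kernels and realizable multipliers *)

Section riesz_pairs.
Variables (R : realType) (n : nat) (s : R).
Hypotheses (n0 : (0 < n)%N) (s0 : 0 < s) (sn : 2 * s < n%:R).
Notation lam := (lebesgue_rV R n).
Local Notation cbm := (@cbounded_measurable R n).

Definition iso_symbol (xi : 'rV[R]_n) : R[i] := (enorm xi `^ (- (2 * s)))%:C.

Lemma cmeasurable_iso_symbol : cmeasurable iso_symbol.
Proof. by apply: cmeasurable_real; exact: measurable_enorm_powR. Qed.

Section generic.
Variables (m : nat) (p : 'rV[R]_n -> R) (d : nat -> 'rV[R]_n -> R[i]).
Hypothesis mp : measurable_fun setT (p : _ -> measurableTypeR R).
Hypothesis ple : forall y, `|p y| <= enorm y ^+ m.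
Hypothesis bd : forall k, cbm (d k).
Hypothesis d0 : forall k xi, (m < k.*2)%N -> d k xi = 0.
Hypothesis pd : forall t xi, 0 < t -> gmoment t p xi =
  (\sum_(k < 3) (enorm xi ^+ (m - k.*2))%:C * d k xi * ((2 * t)^-1)%:C ^+ (m - k)) *
  gmoment t (fun=> 1) xi.
Variable f : 'rV[R]_n -> R[i].
Hypothesis hf : schwartz f.

Let c (k : nat) (xi : 'rV[R]_n) : R[i] := (enorm xi ^+ (m - k.*2))%:C * d k xi.

Let mc k : cmeasurable (c k).
Proof.
apply: cmeasurableM; last by have [] := bd k.
by apply: cmeasurable_real; apply: measurable_funX; exact: measurable_enorm.
Qed.

Let c0 k xi : (m < k.*2)%N -> c k xi = 0.
Proof. by move=> /d0 h; rewrite /c h mulr0. Qed.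

Let cle : exists A : R, forall k xi, (k.*2 <= m)%N -> normc (c k xi) <= A * enorm xi ^+ (m - k.*2).
Proof.
have /choice[A hA] : forall k, exists A : R, forall x, normc (d k x) <= A by move=> k; have [_] := bd k.
(* One bound for all k: only finitely many satisfy 2k <= m. *)
exists (\sum_(k < m.+1) `|A k|) => k xi km.
have km' : (k < m.+1)%N by rewrite ltnS (leq_trans _ km)// -addnn leq_addr.
rewrite Normc.normcM normc_real ger0_norm ?exprn_ge0 ?enorm_ge0// mulrC ler_wpM2r ?exprn_ge0 ?enorm_ge0//.
rewrite (le_trans (hA k xi))// (le_trans (ler_norm _))//.
by rewrite (bigD1 (Ordinal km'))//= lerDl sumr_ge0.
Qed.

Let ksn : 0 <= n%:R - 2 * s.
Proof. by rewrite subr_ge0 ltW. Qed.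

Let knn : n%:R - 2 * s < n%:R.
Proof. by move: s0; lra. Qed.

(** Writing the coefficients as |xi|^(m-2k) times bounded functions of the direction lets |xi|^(-2s)
    factor out of the whole symbol. The factorization is valid off the origin, which is enough. *)
Lemma riesz_kernel_pair : fourier_pair (dist_of (correlation (riesz_kernel s m p) f))
  (fun xi => iso_symbol xi * (\sum_(k < 3) (kernel_const n s m k)%:C * d k xi) * fourier f xi).
Proof.
have [A hA] := cle.
have fi := schwartz_cintegrable hf.
have [M [_ fM]] := schwartz_le 0 hf.
have {}fM x : normc (f x) <= M by have := fM x; rewrite expr0 mul1r.
have mf : cmeasurable (fourier f).
  rewrite (funext (fourierE f)).
  exact: (cmeasurable_comp (cmeasurable_ft (cintegrable_cmeasurable fi)) (@measurable_rV_opp _ _)).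
have mk := cmeasurable_correlation (measurable_riesz_kernel s m mp) fi.
have ms := cmeasurable_kernel_symbol s m mc.
apply: (@fourier_pair_offzero _ _ n0 _ (fun xi => kernel_symbol s m c xi * fourier f xi)).
- split.
  + apply: tempered_dist_of_bounded => //.
    exact: (correlation_bounded n0 ksn knn (measurable_riesz_kernel s m mp) (riesz_kernel_le sn ple) fi fM).
  + apply/tempered_funP; split; first exact: cmeasurableM.
    pose C : R := (`|A| * \sum_(k < 3) `|kernel_const n s m k|) * (2 * \int[lam]_x normc (f x)).
    have w1 (y : 'rV[R]_n) : 0 <= rV_weight y <= 1.
      rewrite rV_weight_ge0 /rV_weight invf_le1 ?exprn_gt0 ?onePenorm_gt0//.
      by rewrite exprn_ege1// onePenorm_ge1.
    exists n.*2; apply: (le_integrableR _ _ (integrableZR C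
      (integrable_powRM n0 _ sn w1 (integrable_rV_weight R n)))).
    * apply: measurable_funM; last exact: measurable_onePenorm_exp.
      by apply: cmeasurable_normc; exact: cmeasurableM.
    * move=> xi; rewrite ger0_norm; last by rewrite mulr_ge0 ?normc_ge0// rV_weight_ge0.
      rewrite -/(rV_weight xi) mulrA ler_wpM2r ?rV_weight_ge0// Normc.normcM /C mulrAC.
      rewrite ler_pM ?normc_ge0//; first exact: kernel_symbol_le.
      by rewrite fourierE; exact: le_normc_ft.
    * by rewrite mulr_ge0// ltW.
  + move=> phi hphi; exact: (kernel_fourier s0 sn n0 mp ple mc c0 hA pd fi fM hphi).
- apply: cmeasurableM => //; apply: cmeasurableM; first exact: cmeasurable_iso_symbol.
  apply: cmeasurable_sum => k; apply: cmeasurableM; first exact: cmeasurable_cst.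
  by have [] := bd k.
- move=> xi xi0; congr (_ * _); rewrite /kernel_symbol mulr_sumr; apply: eq_bigr => k _.
  have [mk0|km] := ltnP m k.*2; first by rewrite c0// d0// !(mul0r, mulr0).
  rewrite /c /iso_symbol -(heat_order_powR s km xi0) !rmorphM/=; ring.
Qed.

End generic.

Lemma fourier_pair_eq (T : functional R n) g h : fourier_pair T g -> g =1 h -> fourier_pair T h.
Proof. by move=> + /funext <-. Qed.

(** At most four indices occur, hence at most two pairs. *)
Definition moment_coef (d0 d1 d2 : 'rV[R]_n -> R[i]) (k : nat) : 'rV[R]_n -> R[i] :=
  match k with 0 => d0 | 1 => d1 | 2 => d2 | _ => fun=> 0 end.

Lemma moment_coef_cbm d0 d1 d2 k : cbm d0 -> cbm d1 -> cbm d2 -> cbm (moment_coef d0 d1 d2 k).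
Proof. by case: k => [|[|[|k]]]//= *; exact: cbm_cst. Qed.

Variable f : 'rV[R]_n -> R[i].
Hypothesis hf : schwartz f.

Local Notation K m k := ((kernel_const n s m k)%:C : R[i]).
Local Notation pair m p g := (fourier_pair (dist_of (correlation (riesz_kernel s m p) f))
  (fun xi => iso_symbol xi * g xi * fourier f xi)).

Let pair_coef m p d0 d1 d2 :
  measurable_fun setT (p : _ -> measurableTypeR R) -> (forall y, `|p y| <= enorm y ^+ m) ->
  cbm d0 -> cbm d1 -> cbm d2 ->
  (forall k xi, (m < k.*2)%N -> moment_coef d0 d1 d2 k xi = 0) ->
  (forall t xi, 0 < t -> gmoment t p xi =
    ((enorm xi ^+ m)%:C * d0 xi * ((2 * t)^-1)%:C ^+ m +
     (enorm xi ^+ (m - 2))%:C * d1 xi * ((2 * t)^-1)%:C ^+ (m - 1) +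
     (enorm xi ^+ (m - 4))%:C * d2 xi * ((2 * t)^-1)%:C ^+ (m - 2)) * gmoment t (fun=> 1) xi) ->
  pair m p (fun xi => K m 0 * d0 xi + K m 1 * d1 xi + K m 2 * d2 xi).
Proof.
move=> mp ple b0 b1 b2 d0' pd.
have := @riesz_kernel_pair m p (moment_coef d0 d1 d2) mp ple
  (fun k => moment_coef_cbm k b0 b1 b2) d0' _ f hf.
move=> H; apply: (fourier_pair_eq (H _)); last first.
  by move=> xi; rewrite !big_ord_recr big_ord0/= add0r.
move=> t xi t0; rewrite !big_ord_recr big_ord0/= add0r !subn0; exact: pd.
Qed.

Let le_prod (r : seq 'I_n) (y : 'rV[R]_n) : `|\prod_(i <- r) y ord0 i| <= enorm y ^+ size r.
Proof.
rewrite normr_prod; elim: r => [|i r IH]; first by rewrite big_nil expr0.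
by rewrite big_cons /= exprS ler_pM ?coord_le_enorm// prodr_ge0.
Qed.

Lemma riesz_pair0 : pair 0 (fun=> 1) (fun=> K 0 0).
Proof.
have := @pair_coef 0 (fun=> 1) (fun=> 1) (fun=> 0) (fun=> 0) (measurable_cst _) _
  (@cbm_cst R n 1) (@cbm_cst R n 0) (@cbm_cst R n 0).
move=> H; apply: (fourier_pair_eq (H _ _ _)); last by move=> xi; rewrite !mulr0 !addr0 mulr1.
- by move=> y; rewrite normr1 expr0.
- by case=> [|[|[|k]]].
- by move=> t xi t0; rewrite !mulr0 !mul0r !addr0 !expr0 !mulr1 mul1r.
Qed.

Lemma riesz_pair1 i : pair 1 (fun y => y ord0 i) (fun xi => K 1 0 * idir xi i).
Proof.
have := @pair_coef 1 (fun y => y ord0 i) (fun xi => idir xi i) (fun=> 0) (fun=> 0)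
  (@measurable_coord _ _ _) _ (@cbm_idir R n i) (@cbm_cst R n 0) (@cbm_cst R n 0).
move=> H; apply: (fourier_pair_eq (H _ _ _)); last by move=> xi; rewrite !mulr0 !addr0.
- by move=> y; rewrite expr1 coord_le_enorm.
- by case=> [|[|[|k]]].
- by move=> t xi t0; rewrite gmoment1// ixiE !mulr0 !mul0r !addr0 !expr1; congr (_ * _); ring.
Qed.

Lemma riesz_pair2 i j : pair 2 (fun y => y ord0 i * y ord0 j)
  (fun xi => K 2 0 * (idir xi i * idir xi j) + K 2 1 * kron R i j).
Proof.
have := @pair_coef 2 (fun y => y ord0 i * y ord0 j) (fun xi => idir xi i * idir xi j) (fun=> kron R i j)
  (fun=> 0) (@measurable_coordM _ _ _ _) _ (cbmM (@cbm_idir R n i) (@cbm_idir R n j)) (@cbm_cst R n _) (@cbm_cst R n 0).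
move=> H; apply: (fourier_pair_eq (H _ _ _)); last by move=> xi; rewrite !mulr0 !addr0.
- by move=> y; have := le_prod [:: i; j] y; rewrite !big_cons big_nil mulr1.
- by case=> [|[|[|k]]].
- move=> t xi t0; rewrite gmoment2// !ixiE !rmorphXn/=; congr (_ * _).
  rewrite !mulr0 !mul0r !addr0 subnn expr0 expr1; ring.
Qed.

Lemma riesz_pair3 i j k : pair 3 (fun y => y ord0 i * (y ord0 j * y ord0 k))
  (fun xi => K 3 0 * (idir xi i * idir xi j * idir xi k) +
    K 3 1 * (kron R i j * idir xi k + kron R i k * idir xi j + kron R j k * idir xi i)).
Proof.
have b1 := cbmM (cbmM (@cbm_idir R n i) (@cbm_idir R n j)) (@cbm_idir R n k).
have b2 := cbmD (cbmD (cbmM (@cbm_cst R n (kron R i j)) (@cbm_idir R n k)) (cbmM (@cbm_cst R n (kron R i k)) (@cbm_idir R n j)))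
  (cbmM (@cbm_cst R n (kron R j k)) (@cbm_idir R n i)).
have := @pair_coef 3 (fun y => y ord0 i * (y ord0 j * y ord0 k)) _ _ (fun=> 0) _ _ b1 b2 (@cbm_cst R n 0).
move=> H; apply: (fourier_pair_eq (H _ _ _ _)); last by move=> xi; rewrite !mulr0 !addr0.
- apply: measurable_funM; [exact: measurable_coord|exact: measurable_coordM].
- by move=> y; have := le_prod [:: i; j; k] y; rewrite !big_cons big_nil mulr1.
- by case=> [|[|[|l]]].
- move=> t xi t0; rewrite gmoment3// !ixiE !rmorphXn/=; congr (_ * _).
  rewrite (_ : (3 - 2 = 1)%N)// (_ : (3 - 1 = 2)%N)// (_ : (3 - 4 = 0)%N)//; ring.
Qed.

Lemma riesz_pair4 i j k l : pair 4 (fun y => y ord0 i * (y ord0 j * (y ord0 k * y ord0 l)))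
  (fun xi => K 4 0 * (idir xi i * idir xi j * idir xi k * idir xi l) +
    K 4 1 * (kron R i j * idir xi k * idir xi l + kron R i k * idir xi j * idir xi l +
             kron R i l * idir xi j * idir xi k + kron R j k * idir xi i * idir xi l +
             kron R j l * idir xi i * idir xi k + kron R k l * idir xi i * idir xi j) +
    K 4 2 * (kron R i j * kron R k l + kron R i k * kron R j l + kron R i l * kron R j k)).
Proof.
have b1 := cbmM (cbmM (cbmM (@cbm_idir R n i) (@cbm_idir R n j)) (@cbm_idir R n k)) (@cbm_idir R n l).
have b2' a b c := cbmM (cbmM (@cbm_cst R n (a : R[i])) (@cbm_idir R n b)) (@cbm_idir R n c).
have b2 := cbmD (cbmD (cbmD (cbmD (cbmD (b2' (kron R i j) k l) (b2' (kron R i k) j l)) (b2' (kron R i l) j k))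
  (b2' (kron R j k) i l)) (b2' (kron R j l) i k)) (b2' (kron R k l) i j).
apply: (@pair_coef 4 _ _ _ (fun=> _) _ _ b1 b2 (@cbm_cst R n _)).
- apply: measurable_funM; first exact: measurable_coord.
  by apply: measurable_funM; [exact: measurable_coord|exact: measurable_coordM].
- by move=> y; have := le_prod [:: i; j; k; l] y; rewrite !big_cons big_nil mulr1.
- by case=> [|[|[|k']]].
- move=> t xi t0; rewrite gmoment4// !ixiE !rmorphXn/=; congr (_ * _).
  rewrite (_ : (4 - 2 = 2)%N)// (_ : (4 - 1 = 3)%N)// (_ : (4 - 4 = 0)%N)//; ring.
Qed.

(** Existence of a Riesz transform amounts to realizability of the multiplied symbol, a property
    preserved by finite sums and scalars. *)
Definition realizable (g : 'rV[R]_n -> R[i]) := exists T, fourier_pair T g.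

Lemma pair_realizable T g : fourier_pair T g -> realizable g.
Proof. by exists T. Qed.

Lemma realizableZ a g : realizable g -> realizable (fun xi => a * g xi).
Proof. by move=> [T HT]; eexists; exact: fourier_pairZ HT. Qed.

Lemma realizableD g h : realizable g -> realizable h -> realizable (fun xi => g xi + h xi).
Proof.
move=> [T HT] [U HU]; have := fourier_pair_lin 1 HT HU.
by move=> H; eexists; apply: (fourier_pair_eq H) => xi; rewrite mul1r.
Qed.

Lemma realizable_sum I (r : seq I) (g : I -> 'rV[R]_n -> R[i]) :
  (forall i, realizable (g i)) -> realizable (fun xi => \sum_(i <- r) g i xi).
Proof. by move=> /choice[T HT]; eexists; exact: fourier_pair_sum HT. Qed.

Lemma realizable_eq g h : realizable g -> g =1 h -> realizable h.
Proof. by move=> rg /funext <-. Qed.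

Let K_neq0 m : K m 0 != 0.
Proof.
rewrite fmorph_eq0 /kernel_const gt_eqF// subr0.
have m0 : 0 < s + m%:R / 2 by rewrite ltr_pwDl// divr_ge0.
by rewrite divr_gt0 ?mulr_gt0 ?Gamma_gt0 ?invr_gt0 ?exprn_gt0 ?powR_gt0 ?sqrtr_gt0 ?pi_gt0//;
  move: (ler0n R m) sn; lra.
Qed.

Local Notation real g := (realizable (fun xi => iso_symbol xi * g xi * fourier f xi)).

Lemma realizable0 : real (fun=> 1).
Proof.
have := realizableZ (K 0 0)^-1 (pair_realizable riesz_pair0).
move=> H'; apply: (realizable_eq H') => xi /=; have := K_neq0 0; move: (K 0 0) => c c0; field; exact: c0.
Qed.

Lemma realizable1 i : real (fun xi => idir xi i).
Proof.
have := realizableZ (K 1 0)^-1 (pair_realizable (riesz_pair1 i)).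
move=> H'; apply: (realizable_eq H') => xi /=; have := K_neq0 1; move: (K 1 0) => c c0; field; exact: c0.
Qed.

(** The pair for the monomial kernel is solved for its top-degree term: the leading constant is
    nonzero, and the terms with Kronecker deltas have lower degree and are realizable already.
    Degrees three and four follow the same pattern. *)
Lemma realizable2 i j : real (fun xi => idir xi i * idir xi j).
Proof.
have := realizableD (realizableZ (K 2 0)^-1 (pair_realizable (riesz_pair2 i j)))
  (realizableZ (- (K 2 1 / K 2 0 * kron R i j)) realizable0).
move=> H'; apply: (realizable_eq H') => xi /=; have := K_neq0 2; move: (K 2 0) => c c0; field; exact: c0.
Qed.

Lemma realizable3 i j k : real (fun xi => idir xi i * idir xi j * idir xi k).
Proof.
have := realizableD (realizableZ (K 3 0)^-1 (pair_realizable (riesz_pair3 i j k)))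
  (realizableD (realizableZ (- (K 3 1 / K 3 0 * kron R i j)) (realizable1 k))
  (realizableD (realizableZ (- (K 3 1 / K 3 0 * kron R i k)) (realizable1 j))
    (realizableZ (- (K 3 1 / K 3 0 * kron R j k)) (realizable1 i)))).
move=> H'; apply: (realizable_eq H') => xi /=; have := K_neq0 3; move: (K 3 0) => c c0; field; exact: c0.
Qed.

Lemma realizable4 i j k l : real (fun xi => idir xi i * idir xi j * idir xi k * idir xi l).
Proof.
have H a b c := realizableZ (- (K 4 1 / K 4 0 * a)) (realizable2 b c).
have := realizableD (realizableZ (K 4 0)^-1 (pair_realizable (riesz_pair4 i j k l)))
  (realizableD (realizableZ (- (K 4 2 / K 4 0 * (kron R i j * kron R k l + kron R i k * kron R j l +
     kron R i l * kron R j k))) realizable0)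
  (realizableD (H (kron R i j) k l) (realizableD (H (kron R i k) j l) (realizableD (H (kron R i l) j k)
  (realizableD (H (kron R j k) i l) (realizableD (H (kron R j l) i k) (H (kron R k l) i j))))))).
move=> H'; apply: (realizable_eq H') => xi /=; have := K_neq0 4; move: (K 4 0) => c c0; field; exact: c0.
Qed.

End riesz_pairs.

(** * The averages *)

Section complex_polar.
Variables (R : realType) (n : nat).
Hypothesis n0 : (0 < n)%N.
Notation lam := (lebesgue_rV R n).
Notation mu := (@lebesgue_measure R).
Local Notation S := (@unit_sphere R n).
Local Notation pR := (`]0%R, +oo[%classic : set R).

Lemma eq_cintegral_in d (T : measurableType d) (m : {measure set T -> \bar R}) (D : set T)
    (f g : T -> R[i]) : (forall x, D x -> f x = g x) -> cintegral m D f = cintegral m D g.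
Proof.
by move=> fg; rewrite /cintegral; congr Complex; apply: eq_Rintegral => x; rewrite inE => /fg ->.
Qed.

Lemma cpolar (theta : 'rV[R]_n -> R) (w : 'rV[R]_n -> R[i]) :
  measurable_fun setT (theta : _ -> measurableTypeR R) ->
  (forall x, `|theta x| <= 1) ->
  (forall (r : R) x, 0 < r -> S x -> theta (r *: x) = theta x) ->
  cintegrable lam w ->
  cintegral (@sphere_measure R n) S (fun xi => (theta xi)%:C *
    cintegral mu pR (fun r : measurableTypeR R => ((r : R) ^+ n.-1)%:C * w ((r : R) *: xi))) =
  cintegral lam setT (fun y => (theta y)%:C * w y).
Proof.
move=> mth th1 hom [w1 w2].
have ReM (a : R) z : Re (a%:C * z) = a * Re z by rewrite Re_mul Re_real Im_real mul0r subr0.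
have ImM (a : R) z : Im (a%:C * z) = a * Im z by rewrite Im_mul Re_real Im_real mul0r addr0.
rewrite /cintegral; congr Complex.
  rewrite -(eq_Rintegral _ (fun y _ => esym (ReM (theta y) (w y)))) -(Rintegral_polar n0 mth th1 hom w1).
  apply: eq_Rintegral => xi _; rewrite ReM; congr (_ * _); apply: eq_Rintegral => r _; exact: ReM.
rewrite -(eq_Rintegral _ (fun y _ => esym (ImM (theta y) (w y)))) -(Rintegral_polar n0 mth th1 hom w2).
by apply: eq_Rintegral => xi _; rewrite ImM; congr (_ * _); apply: eq_Rintegral => r _; exact: ImM.
Qed.

Variables (s : R) (f : 'rV[R]_n -> 'M[R[i]]_n).
Hypotheses (s0 : 0 < s) (sn : 2 * s < n%:R).
Hypothesis hf : forall j k, schwartz (fun x => f x j k).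

Local Notation K2 j k := (riesz_kernel s 2 (fun y : 'rV[R]_n => y ord0 j * y ord0 k)).

Let mp j k : measurable_fun setT (fun y : 'rV[R]_n => y ord0 j * y ord0 k : measurableTypeR R).
Proof. exact: measurable_coordM. Qed.

Let ple j k (y : 'rV[R]_n) : `|y ord0 j * y ord0 k| <= enorm y ^+ 2.
Proof. by rewrite normrM expr2 ler_pM ?coord_le_enorm. Qed.

Let iK j k x : cintegrable lam (fun y => (K2 j k y)%:C * f (x + y) j k).
Proof.
have [M [_ fM]] := schwartz_le 0 (hf j k).
apply: (correlation_integrable n0 _ _ (measurable_riesz_kernel s 2 (mp j k)) (riesz_kernel_le sn (ple j k))
  (schwartz_cintegrable (hf j k)) (M := M)).
- by rewrite subr_ge0 ltW.
- by move: s0; lra.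
- by move=> y; have := fM y; rewrite expr0 mul1r.
Qed.

(** The weight theta must be a function on the whole space, constant along rays from the sphere, so
    that it can be carried from the sphere integral into the volume integral. *)
Lemma sphere_beam (theta : 'rV[R]_n -> R) x :
  measurable_fun setT (theta : _ -> measurableTypeR R) ->
  (forall x, `|theta x| <= 1) ->
  (forall (r : R) x, 0 < r -> S x -> theta (r *: x) = theta x) ->
  cintegral (@sphere_measure R n) S (fun xi => (theta xi)%:C * divergent_beam s f x xi) =
  \sum_(j < n) \sum_(k < n) cintegral lam setT (fun y => (theta y * K2 j k y)%:C * f (x + y) j k).
Proof.
move=> mth th1 hom.
pose w y := \sum_(j < n) \sum_(k < n) (K2 j k y)%:C * f (x + y) j k.
have iw : cintegrable lam w by apply: cintegrable_sum => j; apply: cintegrable_sum.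
transitivity (cintegral lam setT (fun y => (theta y)%:C * w y)).
  rewrite -(cpolar mth th1 hom iw); apply: eq_cintegral_in => xi xi1; congr (_ * _).
  apply: eq_cintegral_in => r; rewrite /= in_itv/= andbT => r0.
  rewrite /w !mulr_sumr; apply: eq_bigr => j _; rewrite !mulr_sumr; apply: eq_bigr => k _.
  (* The kernel has degree 2s - n, so together with the radial density r^(n-1) it yields precisely
     the weight of the beam. *)
  have E : r ^+ n.-1 * K2 j k (r *: xi) = r `^ (2 * s - 1) * (xi ord0 j * xi ord0 k).
    rewrite /riesz_kernel !mxE enormZ gtr0_norm// xi1 mulr1.
    have -> : r `^ (2 * s - 1) = r ^+ n.-1 * r ^+ 2 * r `^ (- (n%:R + 2%:R - 2 * s)).
      rewrite -!powR_mulrn ?ltW// -!powRD; try by rewrite (gt_eqF r0) implybT.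
      by congr (_ `^ _); rewrite -{2}(prednK n0) -natr1; ring.
    ring.
  transitivity ((r ^+ n.-1 * K2 j k (r *: xi))%:C * f (x + (r : R) *: xi) j k).
    by rewrite E !rmorphM/=; ring.
  by rewrite rmorphM -mulrA.
have mw j k : cintegrable lam (fun y => (theta y * K2 j k y)%:C * f (x + y) j k).
  have := @cintegrable_bounded _ _ _ lam (fun y => (theta y)%:C) _ 1 (cmeasurable_real mth) _ (iK j k x).
  under eq_fun do rewrite mulrA -rmorphM; apply => y; by rewrite normc_real.
transitivity (cintegral lam setT (fun y => \sum_(j < n) \sum_(k < n) (theta y * K2 j k y)%:C * f (x + y) j k)).
  apply: eq_cintegral => y; rewrite /w mulr_sumr; apply: eq_bigr => j _; rewrite mulr_sumr.
  by apply: eq_bigr => k _; rewrite mulrA -rmorphM.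
rewrite cintegral_sum; last by move=> j; exact: cintegrable_sum.
by apply: eq_bigr => j _; rewrite cintegral_sum.
Qed.

Lemma normalize_hom (r : R) (x : 'rV[R]_n) i : 0 < r -> S x ->
  normalize (r *: x) ord0 i = normalize x ord0 i.
Proof.
move=> r0 x1; rewrite !normalize_coord mxE enormZ gtr0_norm// invfM.
by field; rewrite x1 oner_neq0 gt_eqF.
Qed.

(** Multiplying by y_i/|y| raises the polynomial degree and the exponent of 1/|y| by one each and
    keeps the homogeneity 2s - n. At the origin both sides are 0. *)
Lemma riesz_kernel_dir m (p : 'rV[R]_n -> R) i y :
  normalize y ord0 i * riesz_kernel s m p y = riesz_kernel s m.+1 (fun y => y ord0 i * p y) y.
Proof.
rewrite /riesz_kernel normalize_coord.
have [->|y0] := eqVneq y 0; first by rewrite !mxE !mul0r.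
have e0 : 0 < enorm y by rewrite enorm_gt0.
have -> : enorm y `^ (- (n%:R + m.+1%:R - 2 * s)) = (enorm y)^-1 * enorm y `^ (- (n%:R + m%:R - 2 * s)).
  rewrite -powR_inv1 ?enorm_ge0// -powRD; last by rewrite (gt_eqF e0) implybT.
  by congr (_ `^ _); rewrite -natr1; ring.
ring.
Qed.

Let mdir i : measurable_fun setT (fun y : 'rV[R]_n => normalize y ord0 i : measurableTypeR R).
Proof. exact: (measurableT_comp (@measurable_coord _ _ _) (@measurable_normalize R n)). Qed.

Let unit_normalize (xi : 'rV[R]_n) i : S xi -> normalize xi ord0 i = xi ord0 i.
Proof. by move=> xi1; rewrite normalize_coord xi1 divr1. Qed.

Lemma avg0E x : avg0 s f x = (c20 n s)%:C * \sum_(j < n) \sum_(k < n)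
  correlation (K2 j k) (fun x => f x j k) x.
Proof.
rewrite /avg0; congr (_ * _).
transitivity (cintegral (@sphere_measure R n) S (fun xi => (1 : R)%:C * divergent_beam s f x xi)).
  by apply: eq_cintegral_in => xi _; rewrite mul1r.
rewrite (@sphere_beam (fun=> 1)) ?normr1//.
apply: eq_bigr => j _; apply: eq_bigr => k _; apply: eq_cintegral => y.
by rewrite mul1r.
Qed.

Lemma avg1E i x : avg1 s f i x = (c21 n s)%:C * \sum_(j < n) \sum_(k < n)
  correlation (riesz_kernel s 3 (fun y => y ord0 i * (y ord0 j * y ord0 k))) (fun x => f x j k) x.
Proof.
rewrite /avg1; congr (_ * _).
(* On the sphere the coordinate may be replaced by that of the normalized vector, which is constant
   along rays. *)
transitivity (cintegral (@sphere_measure R n) S (fun xi => (normalize xi ord0 i)%:C * divergent_beam s f x xi)).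
  by apply: eq_cintegral_in => xi Sxi; rewrite unit_normalize.
rewrite (@sphere_beam (fun xi => normalize xi ord0 i)).
- apply: eq_bigr => j _; apply: eq_bigr => k _; apply: eq_cintegral => y.
  by rewrite riesz_kernel_dir.
- exact: mdir.
- by move=> y; exact: normalize_coord_le.
- by move=> r y r0 y1; exact: normalize_hom.
Qed.

Lemma avg2E i1 i2 x : avg2 s f i1 i2 x = (c22 n s)%:C * \sum_(j < n) \sum_(k < n)
  correlation (riesz_kernel s 4 (fun y => y ord0 i1 * (y ord0 i2 * (y ord0 j * y ord0 k)))) (fun x => f x j k) x.
Proof.
rewrite /avg2; congr (_ * _).
transitivity (cintegral (@sphere_measure R n) S (fun xi =>
    (normalize xi ord0 i1 * normalize xi ord0 i2)%:C * divergent_beam s f x xi)).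
  by apply: eq_cintegral_in => xi Sxi; rewrite !unit_normalize// rmorphM.
rewrite (@sphere_beam (fun xi => normalize xi ord0 i1 * normalize xi ord0 i2)).
- apply: eq_bigr => j _; apply: eq_bigr => k _; apply: eq_cintegral => y.
  by rewrite -mulrA !riesz_kernel_dir.
- by apply: measurable_funM; exact: mdir.
- by move=> y; rewrite normrM mulr_ile1 ?normalize_coord_le.
- by move=> r y r0 y1; rewrite !normalize_hom.
Qed.

End complex_polar.

Section bounded_pair.
Variables (R : realType) (n : nat).
Notation lam := (lebesgue_rV R n).
Local Notation cbm := (@cbounded_measurable R n).

(** The averages are linear combinations of functions, whereas [fourier_pair_lin] combines
    functionals. Boundedness of the functions supplies the integrability under which [dist_of] is
    linear. *)
Definition bounded_pair (u g : 'rV[R]_n -> R[i]) := cbm u /\ fourier_pair (dist_of u) g.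

Lemma bounded_fourier_cintegrable u phi : cbm u -> schwartz phi ->
  cintegrable lam (fun x => u x * fourier phi x).
Proof.
move=> [mu [M uM]] hphi; apply: (cintegrable_bounded mu uM); exact: fourier_cintegrable.
Qed.

Lemma bounded_pair_lin (a : R[i]) u v g h : bounded_pair u g -> bounded_pair v h ->
  bounded_pair (fun x => a * u x + v x) (fun xi => a * g xi + h xi).
Proof.
move=> [bu [_ tg eu]] [bv [_ th ev]].
have b : cbm (fun x => a * u x + v x) by apply: cbmD => //; apply: cbmM => //; exact: cbm_cst.
split=> //; split.
- by have [m [M hM]] := b; exact: tempered_dist_of_bounded hM.
- exact: tempered_fun_lin.
- move=> phi hphi; rewrite dist_of_lin// -eu// -ev// /fourier_dist /dist_of.
  rewrite -cintegralZ; last exact: bounded_fourier_cintegrable.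
  rewrite -cintegralD; last 2 first.
  + by apply: cintegrableZ; exact: bounded_fourier_cintegrable.
  + exact: bounded_fourier_cintegrable.
  by apply: eq_cintegral => x; rewrite mulrDl mulrA.
Qed.

Lemma bounded_pair0 : bounded_pair (fun=> 0) (fun=> 0).
Proof.
have E : dist_of (fun=> 0 : R[i]) = (fun=> 0) :> functional R n.
  apply/funext => phi; rewrite /dist_of (_ : (fun _ => _) = (fun=> (0 : R)%:C)); last first.
    by apply/funext => x; rewrite mul0r.
  by rewrite cintegral_real /Rintegral integral0.
by split; [exact: cbm_cst|rewrite E; exact: fourier_pair0].
Qed.

Lemma bounded_pair_eq u v g h : bounded_pair u g -> u =1 v -> g =1 h -> bounded_pair v h.
Proof. by move=> + /funext <- /funext <-. Qed.

Lemma bounded_pairZ a u g : bounded_pair u g -> bounded_pair (fun x => a * u x) (fun xi => a * g xi).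
Proof.
move=> H; apply: (bounded_pair_eq (bounded_pair_lin a H bounded_pair0)) => x; exact: addr0.
Qed.

Lemma bounded_pair_sum I (r : seq I) (u g : I -> 'rV[R]_n -> R[i]) :
  (forall i, bounded_pair (u i) (g i)) ->
  bounded_pair (fun x => \sum_(i <- r) u i x) (fun xi => \sum_(i <- r) g i xi).
Proof.
move=> H; elim: r => [|i r IH].
  by apply: (bounded_pair_eq bounded_pair0) => x; rewrite big_nil.
by apply: (bounded_pair_eq (bounded_pair_lin 1 (H i) IH)) => x; rewrite big_cons mul1r.
Qed.

End bounded_pair.

(** * Normalizing constants against kernel constants *)

Section constants.
Variables (R : realType) (n : nat) (s : R).
Hypotheses (n2 : (2 <= n)%N) (s0 : 0 < s) (s1 : s < 1).

Let n2R : 2 <= n%:R :> R.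
Proof. by rewrite ler_nat. Qed.

Let pi_powR : pi `^ (n%:R / 2) = Num.sqrt pi ^+ n :> R.
Proof. by rewrite -powR12_sqrt ?pi_ge0// -powR_mulrn ?powR_ge0// -powRrM mulrC. Qed.

Let two_powR (k : R) : 2 `^ (2 * s - k) = 4 `^ s * 2 `^ (- k) :> R.
Proof.
rewrite powRD; last by rewrite pnatr_eq0 implybT.
by congr (_ * _); rewrite powRrM powR_mulrn//; congr (_ `^ _); ring.
Qed.

Let four_powR (k : nat) : 4 `^ (s + k%:R) = 4 `^ s * 4 ^+ k :> R.
Proof. by rewrite powRD ?powR_mulrn// pnatr_eq0 implybT. Qed.

Let four_powR_half : 4 `^ (1 / 2) = 2 :> R.
Proof.
rewrite mul1r powR12_sqrt// (_ : 4 = 2 ^+ 2); last by ring.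
by rewrite sqrtr_sqr ger0_norm.
Qed.

Let four_powR_half' (k : nat) : 4 `^ (s + 1 / 2 + k%:R) = 4 `^ s * 2 * 4 ^+ k :> R.
Proof.
rewrite powRD ?powR_mulrn ?pnatr_eq0 ?implybT//; congr (_ * _).
by rewrite powRD ?four_powR_half ?pnatr_eq0 ?implybT.
Qed.

Let nz (m : R) : 0 <= m -> Gamma ((n%:R + m - 2 * s) / 2) != 0.
Proof. by move=> m0; rewrite gt_eqF// Gamma_gt0// divr_gt0//; move: n2R s1; lra. Qed.

Let P0 : 4 `^ s != 0 :> R. Proof. by rewrite gt_eqF// powR_gt0. Qed.
Let X0 : Num.sqrt pi ^+ n != 0 :> R. Proof. by rewrite expf_neq0// gt_eqF// sqrtr_gt0 pi_gt0. Qed.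
Let G0 : Gamma s != 0. Proof. by rewrite gt_eqF// Gamma_gt0. Qed.
Let G1 : Gamma (s + 1 / 2) != 0. Proof. by rewrite gt_eqF// Gamma_gt0// addr_gt0. Qed.
Let two1 : 2 `^ (-1) = 2^-1 :> R. Proof. by rewrite powR_inv1. Qed.
Let two2 : 2 `^ (-2) = 4^-1 :> R. Proof. by rewrite powR_invn//; congr (_^-1); ring. Qed.

(** The Gamma factor containing n, the power of pi and 4^s cancel. What remains is a quotient
    Gamma(s+1)/Gamma(s) or Gamma(s)/Gamma(s), evaluated by the recurrence. *)
Lemma c20_const : c20 n s * kernel_const n s 2 0 = - (2 * s) /\ c20 n s * kernel_const n s 2 1 = -1.
Proof.
rewrite /c20 /kernel_const pi_powR two_powR two1.
have := nz (ler0n R 2); move: (Gamma ((n%:R + 2 - 2 * s) / 2)) => g g0.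
split.
  rewrite (_ : s + 2%:R / 2 - 0%:R = s + 1); last by field.
  by rewrite GammaS// (four_powR 1); field; rewrite P0 X0 G0 g0.
rewrite (_ : s + 2%:R / 2 - 1%:R = s); last by field.
by field; rewrite P0 X0 G0 g0.
Qed.

Lemma c21_const : c21 n s * kernel_const n s 3 0 = - (2 * s + 1) /\ c21 n s * kernel_const n s 3 1 = -1.
Proof.
rewrite /c21 /kernel_const pi_powR two_powR two1.
have := nz (ler0n R 3); move: (Gamma ((n%:R + 3 - 2 * s) / 2)) => g g0.
split.
  rewrite (_ : s + 3%:R / 2 - 0%:R = s + 1 / 2 + 1); last by field.
  rewrite GammaS ?addr_gt0// (four_powR_half' 1).
  by field; rewrite P0 X0 G1 g0.
rewrite (_ : s + 3%:R / 2 - 1%:R = s + 1 / 2); last by field.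
have := four_powR_half' 0; rewrite addr0 => ->.
by field; rewrite P0 X0 G1 g0.
Qed.

(** The orders b_k are s+2, s+1 and s, so the recurrence is used twice, once and not at all. The
    power 2^(2s-2) in c22 is what brings the last product to -1. *)
Lemma c22_const : [/\ c22 n s * kernel_const n s 4 0 = - (4 * s * (s + 1)),
  c22 n s * kernel_const n s 4 1 = - (2 * s) & c22 n s * kernel_const n s 4 2 = -1].
Proof.
rewrite /c22 /kernel_const pi_powR two_powR two2.
have := nz (ler0n R 4); move: (Gamma ((n%:R + 4 - 2 * s) / 2)) => g g0.
split.
- rewrite (_ : s + 4%:R / 2 - 0%:R = s + 1 + 1); last by field.
  rewrite GammaS ?addr_gt0// GammaS// -addrA (four_powR 2).
  by field; rewrite P0 X0 G0 g0.
- rewrite (_ : s + 4%:R / 2 - 1%:R = s + 1); last by field.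
  by rewrite GammaS// (four_powR 1); field; rewrite P0 X0 G0 g0.
- rewrite (_ : s + 4%:R / 2 - 2%:R = s); last by field.
  by field; rewrite P0 X0 G0 g0.
Qed.

End constants.
Lemma fourier_pair_ext (R : realType) n (T U : functional R n) g h :
  fourier_pair T g -> T =1 U -> g =1 h -> fourier_pair U h.
Proof. by move=> + /funext <- /funext <-. Qed.

(** * Symbols of the averages and of their Riesz transforms *)

Section average_pairs.
Variables (R : realType) (n : nat) (s : R) (f : 'rV[R]_n -> 'M[R[i]]_n).
Hypotheses (n2 : (2 <= n)%N) (s0 : 0 < s) (s1 : s < 1).
Hypothesis hf : forall j k, schwartz (fun x => f x j k).
Notation lam := (lebesgue_rV R n).
Local Notation cbm := (@cbounded_measurable R n).

Let n0 : (0 < n)%N. Proof. exact: ltnW. Qed.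
Let sn : 2 * s < n%:R.
Proof. by have : 2 <= n%:R :> R; [rewrite ler_nat|move: s1; lra]. Qed.

Local Notation T := (@idir R n).
Local Notation S := (@iso_symbol R n s).
Local Notation fh j k := (fourier (fun x => f x j k)).

Lemma correlation_bounded_pair m (p : 'rV[R]_n -> R) u g : schwartz u ->
  measurable_fun setT (p : _ -> measurableTypeR R) -> (forall y, `|p y| <= enorm y ^+ m) ->
  fourier_pair (dist_of (correlation (riesz_kernel s m p) u)) g ->
  bounded_pair (correlation (riesz_kernel s m p) u) g.
Proof.
move=> hu mp ple H; split=> //; split.
  exact: (cmeasurable_correlation (measurable_riesz_kernel s m mp) (schwartz_cintegrable hu)).
have [M [_ fM]] := schwartz_le 0 hu.
have {}fM x : normc (u x) <= M by have := fM x; rewrite expr0 mul1r.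
eexists => x; apply: (correlation_bounded n0 _ _ (measurable_riesz_kernel s m mp) (riesz_kernel_le sn ple)
  (schwartz_cintegrable hu) fM).
- by rewrite subr_ge0 ltW.
- by move: s0; lra.
Qed.

(** The common shape of all symbols that occur. Equalities between them reduce to equalities of the
    coefficients F j k, where f no longer appears. *)
Definition contraction (F : 'I_n -> 'I_n -> 'rV[R]_n -> R[i]) (xi : 'rV[R]_n) : R[i] :=
  \sum_(j < n) \sum_(k < n) S xi * F j k xi * fh j k xi.

Lemma contractionZ a F xi : a * contraction F xi = contraction (fun j k xi => a * F j k xi) xi.
Proof.
rewrite /contraction mulr_sumr; apply: eq_bigr => j _; rewrite mulr_sumr; apply: eq_bigr => k _; ring.
Qed.

Lemma contractionD F G xi : contraction F xi + contraction G xi =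
  contraction (fun j k xi => F j k xi + G j k xi) xi.
Proof.
rewrite /contraction -big_split; apply: eq_bigr => j _ /=; rewrite -big_split; apply: eq_bigr => k _ /=; ring.
Qed.

Lemma eq_contraction F G xi : (forall j k, F j k xi = G j k xi) -> contraction F xi = contraction G xi.
Proof. by move=> FG; apply: eq_bigr => j _; apply: eq_bigr => k _; rewrite FG. Qed.

Lemma realizable_contraction F :
  (forall j k, realizable (fun xi => S xi * F j k xi * fh j k xi)) -> realizable (contraction F).
Proof. by move=> H; apply: realizable_sum => j; apply: realizable_sum => k. Qed.

Lemma contraction_kron i1 i2 xi :
  contraction (fun j k _ => kron R i1 j * kron R i2 k) xi = S xi * fh i1 i2 xi.
Proof.
rewrite /contraction (bigD1 i1)//= [X in _ + X]big1 ?addr0; last first.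
  by move=> j ji; apply: big1 => k _; rewrite /kron eq_sym (negPf ji) !(mul0r, mulr0).
rewrite (bigD1 i2)//= big1 ?addr0; first by rewrite /kron !eqxx !mulr1.
by move=> k ki; rewrite /kron [i2 == k]eq_sym (negPf ki) !(mul0r, mulr0).
Qed.

Let pair_avg m (c : R) (p : 'I_n -> 'I_n -> 'rV[R]_n -> R) g G :
  (forall j k, measurable_fun setT (p j k : _ -> measurableTypeR R)) ->
  (forall j k y, `|p j k y| <= enorm y ^+ m) ->
  (forall j k, fourier_pair (dist_of (correlation (riesz_kernel s m (p j k)) (fun x => f x j k)))
    (fun xi => S xi * g j k xi * fh j k xi)) ->
  (forall j k xi, c%:C * g j k xi = G j k xi) ->
  bounded_pair (fun x => c%:C * \sum_(j < n) \sum_(k < n) correlation (riesz_kernel s m (p j k)) (fun x => f x j k) x)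
    (contraction G).
Proof.
move=> mp ple H cg.
have H' : bounded_pair (fun x => \sum_(j < n) \sum_(k < n) correlation (riesz_kernel s m (p j k)) (fun x => f x j k) x)
    (contraction g).
  by apply: bounded_pair_sum => j; apply: bounded_pair_sum => k; exact: correlation_bounded_pair.
apply: (bounded_pair_eq (bounded_pairZ c%:C H')) => // xi.
by rewrite contractionZ; apply: eq_contraction.
Qed.

(** This and the next two symbols are written in the variables T = i xi/|xi|, in which a Riesz
    transform is multiplication by -T i and all coefficients are real. *)
Definition symbol0 j k (xi : 'rV[R]_n) : R[i] :=
  - ((2 * s)%:C * (T xi j * T xi k) + kron R j k).

Definition symbol1 i j k (xi : 'rV[R]_n) : R[i] :=
  - ((2 * s + 1)%:C * (T xi i * T xi j * T xi k) +
     (kron R i j * T xi k + kron R i k * T xi j + kron R j k * T xi i)).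

Definition symbol2 i j k l (xi : 'rV[R]_n) : R[i] :=
  - ((4 * s * (s + 1))%:C * (T xi i * T xi j * T xi k * T xi l) +
     (2 * s)%:C * (kron R i j * T xi k * T xi l + kron R i k * T xi j * T xi l +
        kron R i l * T xi j * T xi k + kron R j k * T xi i * T xi l +
        kron R j l * T xi i * T xi k + kron R k l * T xi i * T xi j) +
     (kron R i j * kron R k l + kron R i k * kron R j l + kron R i l * kron R j k)).

Lemma avg0_pair : bounded_pair (avg0 s f) (contraction symbol0).
Proof.
rewrite (funext (avg0E n0 s0 sn hf)); have [c0 c1] := c20_const n2 s0 s1.
apply: (@pair_avg 2 _ (fun j k y => y ord0 j * y ord0 k)).
- by move=> j k; exact: measurable_coordM.
- by move=> j k y; rewrite normrM expr2 ler_pM ?coord_le_enorm.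
- by move=> j k; exact: riesz_pair2.
- move=> j k xi; rewrite mulrDr ![(c20 n s)%:C * (_ * _)]mulrA -!rmorphM/= c0 c1 /symbol0 !rmorphN/=; ring.
Qed.

Lemma avg1_pair i : bounded_pair (avg1 s f i) (contraction (symbol1 i)).
Proof.
rewrite (funext (avg1E n0 s0 sn hf i)); have [c0 c1] := c21_const n2 s0 s1.
apply: (@pair_avg 3 _ (fun j k y => y ord0 i * (y ord0 j * y ord0 k))).
- by move=> j k; apply: measurable_funM; [exact: measurable_coord|exact: measurable_coordM].
- by move=> j k y; rewrite !normrM !exprS expr0 mulr1 !ler_pM ?mulr_ge0 ?coord_le_enorm.
- by move=> j k; exact: riesz_pair3.
- move=> j k xi; rewrite mulrDr ![(c21 n s)%:C * (_ * _)]mulrA -!rmorphM/= c0 c1 /symbol1 !rmorphN/=; ring.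
Qed.

Lemma avg2_pair i1 i2 : bounded_pair (avg2 s f i1 i2) (contraction (symbol2 i1 i2)).
Proof.
rewrite (funext (avg2E n0 s0 sn hf i1 i2)); have [c0 c1 c2] := c22_const n2 s0 s1.
apply: (@pair_avg 4 _ (fun j k y => y ord0 i1 * (y ord0 i2 * (y ord0 j * y ord0 k)))).
- move=> j k; apply: measurable_funM; first exact: measurable_coord.
  by apply: measurable_funM; [exact: measurable_coord|exact: measurable_coordM].
- by move=> j k y; rewrite !normrM !exprS expr0 mulr1 !ler_pM ?mulr_ge0 ?coord_le_enorm.
- by move=> j k; exact: riesz_pair4.
- move=> j k xi; rewrite !mulrDr ![(c22 n s)%:C * (_ * _)]mulrA -!rmorphM/= c0 c1 c2 /symbol2 !rmorphN/=; ring.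
Qed.

Let r0 j k := @realizable0 R n s n0 s0 sn _ (hf j k).
Let r1 a j k := @realizable1 R n s n0 s0 sn _ (hf j k) a.
Let r2 a b j k := @realizable2 R n s n0 s0 sn _ (hf j k) a b.
Let r3 a b c j k := @realizable3 R n s n0 s0 sn _ (hf j k) a b c.
Let r4 a b c d j k := @realizable4 R n s n0 s0 sn _ (hf j k) a b c d.

Lemma riesz_symbol i (y : 'rV[R]_n) : - 'i * (y ord0 i / enorm y)%:C = - T y i.
Proof. by rewrite /idir /ixi normalize_coord mulNr. Qed.

Lemma realizable_riesz_avg0 i : realizable (contraction (fun j k xi => - T xi i * symbol0 j k xi)).
Proof.
apply: realizable_contraction => j k.
have H := realizableD (realizableZ (2 * s)%:C (r3 i j k j k)) (realizableZ (kron R j k) (r1 i j k)).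
apply: (realizable_eq H) => xi /=; rewrite /symbol0; ring.
Qed.

(** After expansion only monomials of degree four and two in the direction occur; the single Riesz
    transform before needs degrees three and one. *)
Lemma realizable_riesz2_avg0 i1 i2 :
  realizable (contraction (fun j k xi => - T xi i1 * (- T xi i2 * symbol0 j k xi))).
Proof.
apply: realizable_contraction => j k.
have H := realizableZ (-1) (realizableD (realizableZ (2 * s)%:C (r4 i1 i2 j k j k)) (realizableZ (kron R j k) (r2 i1 i2 j k))).
apply: (realizable_eq H) => xi /=; rewrite /symbol0; ring.
Qed.

Lemma realizable_riesz_avg1 a i : realizable (contraction (fun j k xi => - T xi a * symbol1 i j k xi)).
Proof.
apply: realizable_contraction => j k.
have H := realizableD (realizableZ (2 * s + 1)%:C (r4 a i j k j k))
  (realizableD (realizableZ (kron R i j) (r2 a k j k))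
  (realizableD (realizableZ (kron R i k) (r2 a j j k)) (realizableZ (kron R j k) (r2 a i j k)))).
apply: (realizable_eq H) => xi /=; rewrite /symbol1; ring.
Qed.

End average_pairs.

(** * Assembly of the inversion formula *)

Theorem theorem4p13 (R : realType) (n : nat) (n_ge2 : (2 <= n)%N)
    (s : R) (s_gt0 : 0 < s) (s_lt1 : s < 1) (s_neq : s != 1 / 2)
    (f : 'rV[R]_n -> 'M[R[i]]_n) (hf : schwartz_sym2_tensor f)
    (i1 i2 : 'I_n) :
  exists R2A0 R1R2A0 R1A1_2 R2A1_1 L : functional R n,
    [/\ is_riesz i2 (dist_of (avg0 s f)) R2A0 /\ is_riesz i1 R2A0 R1R2A0,
        is_riesz i1 (dist_of (avg1 s f i2)) R1A1_2,
        is_riesz i2 (dist_of (avg1 s f i1)) R2A1_1,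
        is_frac_laplacian s
          (fun phi =>
             (i1 == i2)%:R * dist_of (avg0 s f) phi
             - (2 * s)%:C * R1R2A0 phi
             - dist_of (avg2 s f i1 i2) phi
             - (2 * s)%:C * (R1A1_2 phi + R2A1_1 phi)) L &
        eq_dist (dist_of (fun x => f x i1 i2)) (fun phi => (1 / 2)%:C * L phi)].
Proof.
have [fsym fS] := hf.
have n0 : (0 < n)%N by exact: ltnW.
have [_ P0] := avg0_pair n_ge2 s_gt0 s_lt1 fS.
have P1 i := (avg1_pair n_ge2 s_gt0 s_lt1 fS i).2.
have [_ P2] := avg2_pair n_ge2 s_gt0 s_lt1 fS i1 i2.
have [U0 Q0] := realizable_riesz_avg0 n_ge2 s_gt0 s_lt1 fS i2.
have [U00 Q00] := realizable_riesz2_avg0 n_ge2 s_gt0 s_lt1 fS i1 i2.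
have [U1 Q1] := realizable_riesz_avg1 n_ge2 s_gt0 s_lt1 fS i1 i2.
have [U2 Q2] := realizable_riesz_avg1 n_ge2 s_gt0 s_lt1 fS i2 i1.
have rieszP i T U F : fourier_pair T (contraction s f F) ->
    fourier_pair U (contraction s f (fun j k xi => - idir xi i * F j k xi)) -> is_riesz i T U.
  move=> HT HU; apply: (fourier_multiplierP HT); apply: (fourier_pair_eq HU) => xi.
  by rewrite riesz_symbol contractionZ.
pose f12 x := f x i1 i2.
have f12P : fourier_pair (dist_of f12) (fourier f12).
  apply: fourier_pair_dist_of; first exact: (schwartz_cintegrable (fS i1 i2)).
  have [M [_ hM]] := schwartz_le 0 (fS i1 i2).
  by exists M => x; have := hM x; rewrite expr0 mul1r.
(* The fractional Laplacian of the bracket is known beforehand: it must be twice the component f_{i1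
   i2}. *)
exists U0, U00, U1, U2, (fun phi => 2 * dist_of f12 phi); split.
- by split; [exact: rieszP P0 Q0|exact: rieszP Q0 Q00].
- exact: rieszP (P1 i2) Q1.
- exact: rieszP (P1 i1) Q2.
- have B := fourier_pair_lin (i1 == i2)%:R P0 (fourier_pair_lin (- (2 * s)%:C) Q00
    (fourier_pair_lin (-1) P2 (fourier_pair_lin (- (2 * s)%:C) Q1 (fourier_pairZ (- (2 * s)%:C) Q2)))).
  (* The transform of the bracket is 2 |xi|^(-2s) times that of f_{i1 i2}; it remains to check this
     and to multiply by |xi|^(2s). *)
  apply: (fourier_multiplierP (g := fun xi => iso_symbol s xi * (2 * fourier f12 xi))).
    apply: (fourier_pair_ext B) => [phi|xi].
      move: (dist_of (avg0 s f) phi) (U00 phi) (dist_of (avg2 s f i1 i2) phi) (U1 phi) (U2 phi) => a b c d e.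
      ring.
    rewrite !contractionZ !contractionD.
    (* Everything cancels for fixed j, k except the two pairings in the last line of [symbol2] that
       match i1, i2 with j, k. The degree-four terms, for instance, contribute 4s^2 + 4s(s+1) -
       4s(2s+1) = 0. *)
    transitivity (contraction s f (fun j k _ => kron R i1 j * kron R i2 k) xi +
        contraction s f (fun j k _ => kron R i2 j * kron R i1 k) xi).
      rewrite contractionD; apply: eq_contraction => j k.
      rewrite /symbol0 /symbol1 /symbol2 -/(kron R i1 i2); ring.
    rewrite !contraction_kron.
    (* Symmetry of the tensor field merges the two surviving components, giving the factor 2. *)
    have -> : (fun x => f x i2 i1) = f12.
      by apply/funext => x; rewrite /f12 -{1}(fsym x) mxE.
    rewrite -/f12; ring.
  (* The product |xi|^(2s) |xi|^(-2s) is 1 off the origin only: at 0 both powers have the value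
     0. *)
  apply: (fourier_pair_offzero n0 (fourier_pairZ 2 f12P)).
    apply: cmeasurableM; first by apply: cmeasurable_real; exact: measurable_enorm_powR.
    apply: cmeasurableM; first exact: cmeasurable_iso_symbol.
    apply: cmeasurableM; first exact: cmeasurable_cst.
    by have [_ /tempered_fun_cmeasurable] := f12P.
  move=> xi xi0; rewrite mulrA -rmorphM/= -powRD ?subrr ?powRr0 ?mul1r//.
  by rewrite enorm_eq0 xi0 implybT.
- move=> phi _; rewrite mulrA -(rmorph_nat (real_complex R) 2) -rmorphM/=.
  by rewrite mul1r mulVf ?rmorph1 ?mul1r ?pnatr_eq0.
Qed.
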